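(* Let $k$ be an algebraically closed field and let $A=kQ/I$ be a triangular finite-dimensional basic $k$-algebra such that $Q$ has no double arrows, and suppose the Tits form $q_A$ admits a maximal omnipresent root $v$. Then there exists an indecomposable (finitely generated) $A$-module $X$ with $\mathbf{dim}\,X=v$.
   Context: $A=kQ/I$ with $Q$ a finite quiver and $I$ an admissible ideal of $kQ$; triangular means $Q$ has no oriented cycles; ''no double arrows'' means there is at most one arrow between any two vertices. For vertices $i,j$, $I(i,j)$ denotes the elements of $I$ that are combinations of paths from $i$ to $j$, and $r(i,j)=|R\cap I(i,j)|$ for a minimal set $R$ of generators of $I$ contained in $\bigcup_{i,j}I(i,j)$. The Tits form is $q_A(v)=\sum_{i\in Q_0}v(i)^2-\sum_{(i\to j)\in Q_1}v(i)v(j)+\sum_{i,j\in Q_0}r(i,j)v(i)v(j)$ on $\mathbb{Z}^{Q_0}$. A root is a vector with non-negative integer coordinates and $q_A(v)=1$; omnipresent means all coordinates positive; maximal means any root $w\ge v$ coordinatewise equals $v$. Modules are identified with representations of $(Q,I)$, and $\mathbf{dim}\,X=(\dim_k X(i))_{i\in Q_0}$. *)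

(* Defs.v *)
From HB Require Import structures.
From mathcomp Require Import all_boot all_order all_algebra.
From Stdlib Require Import ClassicalEpsilon.
Set Implicit Arguments. Unset Strict Implicit. Unset Printing Implicit Defensive.
Import Order.TTheory GRing.Theory Num.Theory.
Local Open Scope ring_scope.

(* A path of the quiver: a starting vertex together with a sequence of arrows
   (the trivial path e_i is (i, [::])).  Vertices are 'I_n, arrows 'I_m. *)
Definition qpath (n m : nat) := ('I_n * seq 'I_m)%type.

Definition pb (P : Prop) : bool := if excluded_middle_informative P then true else false.

Section Quiver.
Variables (F : fieldType) (n m : nat) (src tgt : 'I_m -> 'I_n).

Fixpoint is_walk (i : 'I_n) (s : seq 'I_m) : bool :=
  if s is a :: s' then (src a == i) && is_walk (tgt a) s' else true.
Fixpoint walk_end (i : 'I_n) (s : seq 'I_m) : 'I_n :=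
  if s is a :: s' then walk_end (tgt a) s' else i.

Definition triangular : Prop :=
  forall i s, is_walk i s -> s != [::] -> walk_end i s != i.
Definition no_double_arrows : Prop :=
  forall a b, src a = src b -> tgt a = tgt b -> a = b.

(* Path algebra kQ: an element is its coefficient function on paths,
   vanishing on non-paths (finitely supported since Q is triangular). *)
Definition kQ := qpath n m -> F.
Definition is_elem (f : kQ) : Prop := forall p, ~~ is_walk p.1 p.2 -> f p = 0.
Definition kQzero : kQ := fun _ => 0.
Definition kQadd (f g : kQ) : kQ := fun p => f p + g p.
Definition kQscale (c : F) (f : kQ) : kQ := fun p => c * f p.
(* product = bilinear extension of concatenation of paths *)
Definition kQmul (f g : kQ) : kQ := fun p =>
  \sum_(l < (size p.2).+1)
     f (p.1, take l p.2) * g (walk_end p.1 (take l p.2), drop l p.2).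

Definition is_ideal (J : kQ -> Prop) : Prop :=
  [/\ forall f, J f -> is_elem f,
      J kQzero,
      forall f g, J f -> J g -> J (kQadd f g),
      forall c f, J f -> J (kQscale c f) &
      forall f g, is_elem g -> J f -> J (kQmul g f) /\ J (kQmul f g)].

Definition in_arrow_pow (l : nat) (f : kQ) : Prop :=
  forall p, (size p.2 < l)%N -> f p = 0.

Definition admissible (J : kQ -> Prop) : Prop :=
  [/\ is_ideal J,
      forall f, J f -> in_arrow_pow 2 f &
      exists l, (2 <= l)%N /\ forall f, is_elem f -> in_arrow_pow l f -> J f].

Definition in_Iij (J : kQ -> Prop) (i j : 'I_n) (f : kQ) : Prop :=
  J f /\ forall p, f p != 0 -> p.1 = i /\ walk_end p.1 p.2 = j.

Definition gen_ideal (N : nat) (rho : 'I_N -> kQ) (S : {set 'I_N}) (f : kQ) : Prop :=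
  forall J, is_ideal J -> (forall t, t \in S -> J (rho t)) -> J f.

Definition minimal_generators (J : kQ -> Prop) (N : nat) (rho : 'I_N -> kQ) : Prop :=
  [/\ forall t, exists i j, in_Iij J i j (rho t),
      forall f, J f <-> gen_ideal rho setT f &
      forall S : {set 'I_N}, S != setT -> ~ (forall f, J f <-> gen_ideal rho S f)].

Definition rcount (J : kQ -> Prop) (N : nat) (rho : 'I_N -> kQ) (i j : 'I_n) : nat :=
  #|[set t | pb (in_Iij J i j (rho t))]|.

Definition tits_form (J : kQ -> Prop) (N : nat) (rho : 'I_N -> kQ) (x : 'I_n -> int) : int :=
  \sum_(i < n) x i ^+ 2 - \sum_(a < m) x (src a) * x (tgt a)
  + \sum_(i < n) \sum_(j < n) (rcount J rho i j)%:Z * x i * x j.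

Definition is_root (q : ('I_n -> int) -> int) (v : 'I_n -> nat) : Prop :=
  q (fun i => (v i)%:Z) = 1.

Definition maximal_omnipresent_root (q : ('I_n -> int) -> int) (v : 'I_n -> nat) : Prop :=
  [/\ is_root q v,
      forall i, (0 < v i)%N &
      forall w, is_root q w -> (forall i, v i <= w i)%N -> forall i, w i = v i].

(* Representations of Q with X(i) = F^(d i) (row vectors) and a matrix for
   each arrow. *)
Section Rep.
Variables (d : 'I_n -> nat) (M : forall a : 'I_m, 'M[F]_(d (src a), d (tgt a))).

Definition arr_mx (a : 'I_m) (i j : 'I_n) : 'M[F]_(d i, d j) :=
  if (src a == i) && (tgt a == j) then conform_mx 0 (M a) else 0.

(* X(p) : X(i) -> X(j) for the path (i,s); zero unless it is a path i ~> j *)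
Fixpoint peval (i : 'I_n) (s : seq 'I_m) (j : 'I_n) : 'M[F]_(d i, d j) :=
  match s with
  | [::] => if i == j then conform_mx 0 (1%:M : 'M[F]_(d i)) else 0
  | a :: s' => arr_mx a i (tgt a) *m peval (tgt a) s' j
  end.

(* component X(i) -> X(j) of the action of f in kQ (paths in a triangular
   quiver have length < n) *)
Definition act (f : kQ) (i j : 'I_n) : 'M[F]_(d i, d j) :=
  \sum_(l < n) \sum_(t : l.-tuple 'I_m) f (i, val t) *: peval i (val t) j.

(* X is a representation of the bound quiver (Q, I), i.e. a kQ/I-module *)
Definition satisfies (J : kQ -> Prop) : Prop :=
  forall f, J f -> forall i j, act f i j = 0.

Definition subrep (U : forall i, 'M[F]_(d i)) : Prop :=
  forall a, (U (src a) *m M a <= U (tgt a))%MS.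

Definition indecomposable : Prop :=
  (exists i, (0 < d i)%N) /\
  forall U W : forall i, 'M[F]_(d i),
    subrep U -> subrep W ->
    (forall i, (U i + W i == 1%:M)%MS && (U i :&: W i == (0 : 'M[F]_(d i)))%MS) ->
    (forall i, (U i == (0 : 'M[F]_(d i)))%MS) \/
    (forall i, (W i == (0 : 'M[F]_(d i)))%MS).

End Rep.
End Quiver.

(* Main.v *)
(* Write [q] for the Tits form and [b] for its polarization.  Maximality of [v] gives
   [b v (e_i) >= 0], and makes [q] weakly positive on the vectors orthogonal to [v].  A splitting
   [v = x + y] with [b x y >= 0] forces [q x = q y = 0]; call this a null pair.

   A representation is one matrix [X] graded by the vertices.  If [e] is an idempotent
   endomorphism of [X] and [f = 1 - e], first-order deformations of [X] supported in [e M f] exist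
   as soon as the Euler form of the dimension vectors is small, and such a deformation has fewer
   endomorphisms.  Hence a representation with the fewest endomorphisms satisfies [b x y >= 0] for
   the dimension vectors of every direct sum decomposition, and is indecomposable when there is no
   null pair.

   In general deformations are restricted to the representations on which the functional
   [t |-> sum_i theta_i tr(t_i)] vanishes on all endomorphisms, a condition which the deformation
   argument can preserve.  It forbids direct summands of dimension vector [y] when
   [theta . y <> 0].  To have one such representation to start from, [v] is written as a sum of two
   or three dimension vectors of representations with local endomorphism ring, none of whose linear
   combinations over [k] is part of a null pair; [theta] is then chosen orthogonal to them and
   to no null vector. *)

Require Import Defs.
From mathcomp Require Import all_boot all_order all_algebra.
From mathcomp Require Import zify ring lra.
From Stdlib Require Import ClassicalEpsilon Classical FunctionalExtensionality.
Set Implicit Arguments. Unset Strict Implicit. Unset Printing Implicit Defensive.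
Import Order.TTheory GRing.Theory Num.Theory.
Local Open Scope ring_scope.

(** * The integral form of a maximal omnipresent root *)

(** A null pair [y + z = v] has [b y z = 1], so the inequality [b >= 0] enjoyed by a representation
    with few endomorphisms cannot exclude it. The trace condition is a second invariant for exactly
    this case; it is evaluated in [F], so [not_span] speaks of residues in an arbitrary field, and
    characteristic 3 needs an argument of its own. Null pairs are rigid: [b v] is 1 at two vertices
    [j], [i] and 0 elsewhere, [y = e_j + p] and [z = e_i + r] with roots [p], [r] orthogonal to [v],
    and [c = b e_j e_i] lies between 0 and 3. Each value of [c] has its own decomposition of [v].
    Only [c = 1] uses more than the form: the supports of [y] and [z] might be linked by nothing but
    [b e_j e_i = 1]. A quiver without oriented cycles forbids this, because a relation between [j]
    and [i] is made of walks between them. First-order deformations are genuine ones: for [eta] in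
    [e M f] and [Y] commuting with [e], [eta Y eta = eta Y f e eta = 0] as soon as [Y] commutes with
    [f] too, so the evaluation of paths is affine in [eta]. *)

Section IntegralForm.
Variables (n : nat) (E : 'M[int]_n).
Local Notation vec := 'rV[int]_n.
Implicit Types x y z : vec.

Definition nonneg x := forall i, 0 <= x 0 i.
Definition evec (i : 'I_n) : vec := delta_mx 0 i.
Definition euler x y : int := (x *m E *m y^T) 0 0.
Definition qform x : int := euler x x.
Definition bform x y : int := euler x y + euler y x.
Definition weight x : nat := (\sum_i `|x 0%R i|)%N.

Lemma eulerDl x y z : euler (x + y) z = euler x z + euler y z.
Proof. by rewrite /euler !mulmxDl mxE. Qed.
Lemma eulerDr x y z : euler z (x + y) = euler z x + euler z y.
Proof. by rewrite /euler linearD mulmxDr mxE. Qed.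
Lemma eulerNl x z : euler (- x) z = - euler x z.
Proof. by rewrite /euler !mulNmx mxE. Qed.
Lemma eulerNr x z : euler z (- x) = - euler z x.
Proof. by rewrite /euler linearN mulmxN mxE. Qed.
Lemma euler0l z : euler 0 z = 0.
Proof. by rewrite /euler !mul0mx mxE. Qed.

Lemma bformC x y : bform x y = bform y x.
Proof. by rewrite /bform addrC. Qed.
Lemma bformDl x y z : bform (x + y) z = bform x z + bform y z.
Proof. rewrite /bform eulerDl eulerDr; ring. Qed.
Lemma bformDr x y z : bform z (x + y) = bform z x + bform z y.
Proof. by rewrite !(bformC z) bformDl. Qed.
Lemma bformNl x z : bform (- x) z = - bform x z.
Proof. rewrite /bform eulerNl eulerNr; ring. Qed.
Lemma bformNr x z : bform z (- x) = - bform z x.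
Proof. by rewrite !(bformC z) bformNl. Qed.
Lemma bform0l z : bform 0 z = 0.
Proof. by apply: (addrI (bform 0 z)); rewrite -bformDl !addr0. Qed.
Lemma bform0r z : bform z 0 = 0.
Proof. by rewrite bformC bform0l. Qed.
Lemma bform_diag x : bform x x = 2 * qform x.
Proof. rewrite /bform /qform; ring. Qed.
Lemma qformD x y : qform (x + y) = qform x + qform y + bform x y.
Proof. rewrite /qform /bform eulerDl !eulerDr; ring. Qed.
Lemma qformN x : qform (- x) = qform x.
Proof. by rewrite /qform eulerNl eulerNr opprK. Qed.
Lemma qform0 : qform 0 = 0.
Proof. exact: euler0l. Qed.
Lemma qformB x y : qform (x - y) = qform x + qform y - bform x y.
Proof. by rewrite qformD qformN bformNr. Qed.

Lemma bformZr k x z : bform z (k *: x) = k * bform z x.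
Proof.
rewrite /bform /euler linearZ /= -scalemxAr -!scalemxAl !mxE; ring.
Qed.
Lemma bformZl k x z : bform (k *: x) z = k * bform x z.
Proof. by rewrite bformC bformZr bformC. Qed.
Lemma qformZ k x : qform (k *: x) = k ^+ 2 * qform x.
Proof. rewrite /qform /euler linearZ /= -scalemxAr -!scalemxAl !mxE; ring. Qed.
Lemma bform_sum x y : bform x y = \sum_i y 0 i * bform x (evec i).
Proof.
have lin : {morph (bform x) : u w / u + w} by move=> u w; exact: bformDr.
rewrite {1}(row_sum_delta y) (big_morph (bform x) lin (bform0r x)).
apply: eq_bigr => i _; rewrite /bform /euler -/(evec i) linearZ /=.
by rewrite -!scalemxAl -scalemxAr !mxE; ring.
Qed.

Lemma evecE i j : evec i 0 j = (j == i)%:R.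
Proof. by rewrite mxE eqxx. Qed.
Lemma euler_evec i j : euler (evec i) (evec j) = E i j.
Proof.
rewrite /euler -rowE mxE (bigD1 j) //= !mxE !eqxx mulr1 big1 ?addr0 //.
by move=> k /negPf kj; rewrite !mxE kj mulr0.
Qed.
Lemma bform_evec i j : bform (evec i) (evec j) = E i j + E j i.
Proof. by rewrite /bform !euler_evec. Qed.
Lemma qform_evec i : qform (evec i) = E i i.
Proof. exact: euler_evec. Qed.

Lemma entryD x y i : (x + y) 0 i = x 0 i + y 0 i. Proof. by rewrite mxE. Qed.
Lemma entryB x y i : (x - y) 0 i = x 0 i - y 0 i. Proof. by rewrite !mxE. Qed.
Lemma entry0 i : (0 : vec) 0 i = 0. Proof. by rewrite mxE. Qed.

Lemma nonneg_evec i : nonneg (evec i).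
Proof. by move=> j; rewrite evecE ler0n. Qed.
Lemma nonnegD x y : nonneg x -> nonneg y -> nonneg (x + y).
Proof. by move=> hx hy i; rewrite entryD addr_ge0. Qed.
Lemma nonneg0 : nonneg 0.
Proof. by move=> i; rewrite entry0. Qed.
Lemma nonnegB_evec x i : nonneg x -> 0 < x 0 i -> nonneg (x - evec i).
Proof.
move=> hx xi j; have := hx j; rewrite entryB evecE.
by case: (j =P i) => [->|_]; rewrite ?mulr1n ?mulr0n; lia.
Qed.
Lemma weightD x y : nonneg x -> nonneg y -> weight (x + y) = (weight x + weight y)%N.
Proof.
move=> hx hy; rewrite /weight -big_split /=; apply: eq_bigr => i _.
by have := hx i; have := hy i; rewrite entryD; lia.
Qed.
Lemma weight_evec i : weight (evec i) = 1%N.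
Proof.
rewrite /weight (bigD1 i) //= evecE eqxx big1 ?addn0 //.
by move=> j /negPf ji; rewrite evecE ji.
Qed.
Lemma weight_gt0 x : x != 0 -> (0 < weight x)%N.
Proof.
apply: contraNT; rewrite -leqNgt leqn0 sum_nat_eq0 => /forallP h.
by apply/eqP/rowP => i; rewrite entry0; have := h i; rewrite /= absz_eq0 => /eqP.
Qed.
Lemma weight0 : weight (0 : vec) = 0%N.
Proof. by rewrite /weight big1 // => i _; rewrite entry0. Qed.
Lemma weight_neq0 x : (0 < weight x)%N -> x != 0.
Proof. by apply: contraTneq => ->; rewrite weight0. Qed.
Lemma exists_pos x : nonneg x -> x != 0 -> exists i, 0 < x 0 i.
Proof.
move=> hx; case: (boolP [exists i, 0 < x 0 i]) => [/existsP//|].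
rewrite negb_exists => /forallP nex /eqP[]; apply/rowP => i; rewrite entry0.
by apply: le_anti; rewrite hx andbT leNgt nex.
Qed.
Lemma sum_pos_term y (f : 'I_n -> int) :
  nonneg y -> 0 < \sum_i y 0 i * f i -> exists i, 0 < y 0 i /\ 0 < f i.
Proof.
move=> hy; case: (boolP [exists i, (0 < y 0 i) && (0 < f i)]).
  by case/existsP => i /andP[? ?]; exists i.
rewrite negb_exists => /forallP nex; rewrite ltNge => /negP[].
apply: sumr_le0 => i _; have := nex i; rewrite negb_and -!leNgt => /orP[yi|fi].
  by rewrite (_ : y 0 i = 0) ?mul0r //; apply: le_anti; rewrite yi hy.
exact: mulr_ge0_le0.
Qed.
End IntegralForm.

Lemma exists_max_weight n (P : 'rV[int]_n -> Prop) B :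
  (exists x, P x) -> (forall x, P x -> (weight x <= B)%N) ->
  exists x, P x /\ forall y, P y -> (weight y <= weight x)%N.
Proof.
move=> [x Px] bound; have [k] := ubnP (B - weight x)%N.
elim: k x Px => // k IH x Px hk.
have [[y [Py lt]]|nex] := classic (exists y, P y /\ (weight x < weight y)%N).
  by apply: (IH y Py); have := bound _ Py; lia.
exists x; split=> // y Py; rewrite leqNgt; apply/negP => lt; apply: nex.
by exists y.
Qed.

(** * Positivity of the form relative to a maximal root, and the structure of null pairs *)

Section MaximalRoot.
Variables (n : nat) (E : 'M[int]_n) (v : 'rV[int]_n).
Hypothesis Ediag : forall i, E i i = 1.
Hypothesis Eoff : forall i j, i != j -> -1 <= E i j + E j i.
Hypothesis vpos : forall i, 0 < v 0 i.
Hypothesis vroot : qform E v = 1.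
Hypothesis vmax : forall w, nonneg (w - v) -> qform E w = 1 -> w = v.
Local Notation q := (qform E).
Local Notation b := (bform E).
Local Notation e := (@evec n).
Implicit Types x y z : 'rV[int]_n.

Lemma q_evec i : q (e i) = 1.
Proof. by rewrite qform_evec. Qed.
Lemma b_evec_diag i : b (e i) (e i) = 2.
Proof. by rewrite bform_diag q_evec. Qed.
Lemma b_evec_ge i j : -1 <= b (e i) (e j).
Proof.
have [->|ij] := eqVneq i j; first by rewrite b_evec_diag.
by rewrite bform_evec Eoff.
Qed.

(** Since [q (v + x) = 1 + q x + b v x], a zero would make [v + x] a larger root. Every later use of
    maximality goes through this inequality. *)
Lemma max_step x : nonneg x -> x != 0 -> q x + b v x != 0.
Proof.
move=> hx; apply: contraNneq => h; apply/eqP.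
apply: (addrI v); rewrite addr0; apply: vmax.
  by rewrite addrC addKr.
by rewrite qformD vroot -addrA h addr0.
Qed.

(** If the value were negative, the reflection of [v] at [i] would be a larger root. *)
Lemma bv_evec i : 0 <= b v (e i).
Proof.
rewrite leNgt; apply/negP => lt0.
have h1 : nonneg (- b v (e i) *: e i).
  move=> j; rewrite mxE evecE; apply: mulr_ge0; last exact: ler0n.
  by rewrite oppr_ge0 ltW.
have h2 : - b v (e i) *: e i != 0.
  apply/eqP => /rowP/(_ i); rewrite mxE evecE eqxx mulr1 entry0; lia.
have := max_step h1 h2; rewrite qformZ q_evec bformZr => /eqP[]; ring.
Qed.

Lemma bv_nonneg x : nonneg x -> 0 <= b v x.
Proof. by move=> hx; rewrite bform_sum sumr_ge0 // => i _; rewrite mulr_ge0 ?bv_evec. Qed.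

Lemma bv_part x i : nonneg x -> 0 < x 0 i -> b v (e i) <= b v x.
Proof.
move=> hx xi; rewrite -[x in leRHS](subrK (e i)) bformDr lerDr.
by apply: bv_nonneg; apply: nonnegB_evec.
Qed.

Lemma weight_le x y : nonneg y -> nonneg (x - y) -> weight x = (weight y + weight (x - y))%N.
Proof. by move=> hy hxy; rewrite -weightD // addrC subrK. Qed.

Lemma q_eq0_null x : q x = 1 -> x != 0.
Proof. by move=> h; apply/eqP => x0; move: h; rewrite x0 qform0. Qed.

(* off the exceptional vertices (those with [b v (e i) > 0]) the form is weakly positive *)
Lemma q_pos x : nonneg x -> x != 0 -> b v x = 0 -> 1 <= q x.
Proof.
have [k] := ubnP (weight x); elim: k x => // k IH x; rewrite ltnS => wx hx x0 bx.
have qx0 : q x != 0 by have := max_step hx x0; rewrite bx addr0.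
(* [r] will be a root of largest weight below [x]. Either the rest [s] is a single [e i], or each
   [r + e i] with [i] in the support of [s] is still lighter than [x] and the induction applies to
   it. *)
pose P r := [/\ nonneg r, nonneg (x - r) & q r = 1].
have [|r Pr|r [[hr hs qr] rmax]] := @exists_max_weight _ P (weight x).
- have [i xi] := exists_pos hx x0; exists (e i); split; rewrite ?q_evec //.
    exact: nonneg_evec.
  exact: nonnegB_evec.
- by case: Pr => hr hs _; rewrite (weight_le hr hs) leq_addr.
set s := x - r in hs *; have xE : x = r + s by rewrite addrC subrK.
have [s0|s0] := eqVneq s 0; first by rewrite xE s0 addr0 qr.
have r0 := q_eq0_null qr.
have wE : weight x = (weight r + weight s)%N by rewrite (weight_le hr hs).
have := weight_gt0 r0; have := weight_gt0 s0 => ws wr.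
have [br bs] : b v r = 0 /\ b v s = 0.
  by have := bv_nonneg hr; have := bv_nonneg hs; move: bx; rewrite xE bformDr; lia.
have be i : 0 < s 0 i -> b v (e i) = 0.
  by move=> si; have := bv_part hs si; have := bv_evec i; lia.
have [[i [si xi]]|nex] := classic (exists i, 0 < s 0 i /\ s = e i).
  (* Exchanging [e l] for [e i] keeps the weight of [r], so the induction applies; it yields
     [b r (e i) >= -2], hence [q x >= 0], and the value 0 is already excluded. *)
  have [|l [rl bl]] := @sum_pos_term _ r (fun l => b r (e l)) hr.
    by rewrite -bform_sum bform_diag qr.
  have hrl := nonnegB_evec hr rl.
  have hy : nonneg (r - e l + e i) by apply: nonnegD => //; apply: nonneg_evec.
  have wy : (weight (r - e l + e i) = weight r)%N.
    rewrite weightD ?weight_evec //; last exact: nonneg_evec.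
    by have := weight_le (@nonneg_evec _ l) hrl; rewrite weight_evec; lia.
  have : 1 <= q (r - e l + e i).
    apply: IH => //; first by rewrite wy; lia.
      by apply: weight_neq0; rewrite wy.
    have := bv_part hr rl; have := bv_evec l.
    by rewrite bformDr (be i) // bformDr bformNr br; lia.
  rewrite qformD q_evec qformB q_evec qr bformDl bformNl => h.
  have := b_evec_ge l i; move: qx0; rewrite xE xi qformD qr q_evec; lia.
(* Maximality of [r] excludes [q (r + e i) = 1], so the value is at least 2. *)
have pos i : 0 < s 0 i -> 0 <= b r (e i).
  move=> si; have hsi := nonnegB_evec hs si.
  have si0 : s - e i != 0.
    by apply/eqP => /eqP; rewrite subr_eq0 => /eqP sE; apply: nex; exists i.
  have hri : nonneg (r + e i) by apply: nonnegD => //; apply: nonneg_evec.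
  have wri : (weight (r + e i) = (weight r).+1)%N.
    by rewrite weightD ?weight_evec ?addn1 //; apply: nonneg_evec.
  have wsi := weight_le (@nonneg_evec _ i) hsi.
  have := weight_gt0 si0 => wsi0; rewrite weight_evec in wsi.
  have q1 : 1 <= q (r + e i).
    apply: IH => //; first by rewrite wri; lia.
      by apply: weight_neq0; rewrite wri.
    by rewrite bformDr br be.
  have : q (r + e i) != 1.
    apply/eqP => q1'; have := rmax (r + e i); rewrite wri ltnn => h.
    suff : false by []; apply: h; split=> //.
    by rewrite opprD addrA -/s.
  by move: q1; rewrite qformD qr q_evec; lia.
have bs0 : 0 <= b r s.
  rewrite bform_sum sumr_ge0 // => i _; have [si|si] := ltrP 0 (s 0 i).
    by rewrite mulr_ge0 // ?pos // ltW.
  by rewrite (_ : s 0 i = 0) ?mul0r //; apply: le_anti; rewrite si hs.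
have : 1 <= q s by apply: IH => //; lia.
by rewrite xE qformD qr; lia.
Qed.
(** The induction of [q_pos] on the level [b v = 1]: maximality now excludes the value [-1], and the
    subvector [y] of largest weight may have [q y] equal to 0 or 1. *)
Lemma q_nonneg1 x : nonneg x -> b v x = 1 -> 0 <= q x.
Proof.
have [k] := ubnP (weight x); elim: k x => // k IH x; rewrite ltnS => wx hx bx.
have x0 : x != 0 by apply/eqP => x0; move: bx; rewrite x0 bform0r.
have qx1 : q x != -1 by have := max_step hx x0; rewrite bx; apply: contraNneq => ->.
pose P r := [/\ nonneg r, nonneg (x - r), b v r = 1 & 0 <= q r <= 1].
have [|r [hr hs _ _]|y [[hy hs by1 qy] ymax]] := @exists_max_weight _ P (weight x).
- have [|i [xi bi]] := @sum_pos_term _ x (fun l => b v (e l)) hx.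
    by rewrite -bform_sum bx.
  exists (e i); split; rewrite ?q_evec //; first exact: nonneg_evec.
    exact: nonnegB_evec.
  by have := bv_part hx xi; lia.
- by rewrite (weight_le hr hs) leq_addr.
set s := x - y in hs *; have xE : x = y + s by rewrite addrC subrK.
have [s0|s0] := eqVneq s 0; first by rewrite xE s0 addr0; case/andP: qy.
have y0 : y != 0 by apply/eqP => y0; move: by1; rewrite y0 bform0r.
have wE : weight x = (weight y + weight s)%N by rewrite (weight_le hy hs).
have := weight_gt0 y0; have := weight_gt0 s0 => ws wy.
have bs : b v s = 0 by move: bx; rewrite xE bformDr by1; lia.
have be i : 0 < s 0 i -> b v (e i) = 0.
  by move=> si; have := bv_part hs si; have := bv_evec i; lia.
have [[i [si xi]]|nex] := classic (exists i, 0 < s 0 i /\ s = e i).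
  (* Adding [b v (e l)] makes the sum over [y] equal to [1 + 2 q y], positive even for [q y = 0].
     The exchanged vector lies on the level [1 - b v (e l)], where the induction or [q_pos] bounds
     its value below by [b v (e l)]. *)
  have [|l [yl bl]] := @sum_pos_term _ y (fun l => b v (e l) + b y (e l)) hy.
    under eq_bigr => j _ do rewrite mulrDr.
    by rewrite big_split /= -!bform_sum by1 bform_diag; case/andP: qy; lia.
  have hyl := nonnegB_evec hy yl.
  have hz : nonneg (y - e l + e i) by apply: nonnegD => //; apply: nonneg_evec.
  have wz : (weight (y - e l + e i) = weight y)%N.
    rewrite weightD ?weight_evec //; last exact: nonneg_evec.
    by have := weight_le (@nonneg_evec _ l) hyl; rewrite weight_evec; lia.
  have bz : b v (y - e l + e i) = 1 - b v (e l).
    by rewrite bformDr (be i) // bformDr bformNr by1 addr0.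
  have qz : q (y - e l + e i) = q y + 1 - b y (e l) + 1 + b y (e i) - b (e l) (e i).
    rewrite qformD qformB !q_evec bformDl bformNl; ring.
  have bel := b_evec_ge l i.
  have bvl := bv_part hy yl; rewrite by1 in bvl.
  suff : b v (e l) <= q (y - e l + e i).
    by move: qx1; rewrite xE xi qformD q_evec; case/andP: qy; lia.
  have [bl0|bl1] : b v (e l) = 0 \/ b v (e l) = 1 by have := bv_evec l; lia.
    rewrite bl0; apply: IH => //; first by rewrite wz; lia.
    by rewrite bz bl0.
  rewrite bl1; apply: q_pos => //; last by rewrite bz bl1.
  by apply: weight_neq0; rewrite wz.
have pos i : 0 < s 0 i -> 0 <= b y (e i).
  move=> si; have hsi := nonnegB_evec hs si.
  have si0 : s - e i != 0.
    by apply/eqP => /eqP; rewrite subr_eq0 => /eqP sE; apply: nex; exists i.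
  have hyi : nonneg (y + e i) by apply: nonnegD => //; apply: nonneg_evec.
  have wyi : (weight (y + e i) = (weight y).+1)%N.
    by rewrite weightD ?weight_evec ?addn1 //; apply: nonneg_evec.
  have wsi := weight_le (@nonneg_evec _ i) hsi.
  have := weight_gt0 si0 => wsi0; rewrite weight_evec in wsi.
  have bvi : b v (y + e i) = 1 by rewrite bformDr by1 be.
  have q0 : 0 <= q (y + e i) by apply: IH => //; rewrite wyi; lia.
  rewrite leNgt; apply/negP => lt0.
  have := ymax (y + e i); rewrite wyi ltnn => h; suff : false by [].
  apply: h; split=> //; first by rewrite opprD addrA -/s.
  by move: q0; rewrite qformD q_evec; case/andP: qy; lia.
have bs0 : 0 <= b y s.
  rewrite bform_sum sumr_ge0 // => i _; have [si|si] := ltrP 0 (s 0 i).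
    by rewrite mulr_ge0 // ?pos // ltW.
  by rewrite (_ : s 0 i = 0) ?mul0r //; apply: le_anti; rewrite si hs.
have : 1 <= q s by apply: q_pos.
by rewrite xE qformD; case/andP: qy; lia.
Qed.

(** [q (y + e l) >= 0] leaves only the value [-1] to exclude. *)
Lemma b_null_ge0 y l : nonneg y -> b v y = 1 -> q y = 0 -> b v (e l) = 0 -> 0 <= b y (e l).
Proof.
move=> hy by1 qy bl.
have h1 : 0 <= q (y + e l).
  apply: q_nonneg1; first by apply: nonnegD => //; apply: nonneg_evec.
  by rewrite bformDr by1 bl.
rewrite leNgt; apply/negP => lt0.
have h2 : b y (e l) = -1 by move: h1; rewrite qformD qy q_evec; lia.
(* The coefficients are chosen to contradict [max_step]: with [b y (e l) = -1] this vector has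
   [q = 4 - 8 = -4] and [b v = 4]. *)
have h3 : nonneg (4 *: y + 2 *: e l).
  by move=> i; rewrite !mxE !addr_ge0 ?mulr_ge0.
have h4 : b v (4 *: y + 2 *: e l) = 4 by rewrite bformDr !bformZr by1 bl.
have h5 : 4 *: y + 2 *: e l != 0.
  by apply/eqP => h; move: h4; rewrite h bform0r.
have := max_step h3 h5.
by rewrite h4 qformD !qformZ qy q_evec bformZl bformZr h2.
Qed.

Lemma bvv : b v v = 2. Proof. by rewrite bform_diag vroot. Qed.

(** The nonnegative numbers [b v a] and [b v c] add up to 2. If one of them is 0, [q_pos]
    contradicts [b v a = 2 q a + b a c] or its analogue for [c]. So both are 1, and [q_nonneg1]
    together with [b a c >= 0] leaves only the value 0 for [q]. *)
Lemma split_null a c : nonneg a -> nonneg c -> a != 0 -> c != 0 -> a + c = v ->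
  0 <= b a c -> q a = 0 /\ q c = 0.
Proof.
move=> ha hc a0 c0 ac bac.
have := bvv; rewrite -{2}ac bformDr.
have : b v a = 2 * q a + b a c by rewrite -ac bformDl bform_diag (bformC E c).
have : b v c = 2 * q c + b a c by rewrite -ac bformDl bform_diag addrC.
have := bv_nonneg ha; have := bv_nonneg hc.
have := q_pos ha a0; have := q_pos hc c0.
have := q_nonneg1 ha; have := q_nonneg1 hc.
move=> h1 h2 h3 h4 h5 h6 h7 h8 h9.
have [b0|b1] := eqVneq (b v a) 0.
  by have := h4 b0; lia.
have [b0|b2] := eqVneq (b v c) 0.
  by have := h3 b0; lia.
have ba : b v a = 1 by lia.
have bc : b v c = 1 by lia.
by have := h1 bc; have := h2 ba; lia.
Qed.

Definition null_pair y z := [/\ nonneg y, nonneg z, y + z = v, q y = 0 & q z = 0].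

Lemma null_pairC y z : null_pair y z -> null_pair z y.
Proof. by case=> *; split=> //; rewrite addrC. Qed.

Lemma null_pair_bv y z : null_pair y z -> b v y = 1.
Proof.
case=> hy hz yz qy qz; have := qformB E v y.
by rewrite -{1}yz (addrC y) addrK vroot qy qz; lia.
Qed.

(** [b y] and [b z] are nonnegative at [e l] by [b_null_ge0], and their sum is 0. *)
Lemma null_pair_b0 y z l : null_pair y z -> b v (e l) = 0 -> b y (e l) = 0.
Proof.
move=> yz bl; have [hy hz yzv qy qz] := yz.
have := b_null_ge0 hy (null_pair_bv yz) qy bl.
have := b_null_ge0 hz (null_pair_bv (null_pairC yz)) qz bl.
by move: bl; rewrite -yzv bformDl; lia.
Qed.

(** [b v y = 1] is a sum of nonnegative terms, so a single vertex [j] contributes; then [0 = b y y]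
    reduces to [b y (e j)] by [null_pair_b0]. *)
Lemma null_pair_special y z : null_pair y z ->
  exists j, [/\ y 0 j = 1, b v (e j) = 1, b y (e j) = 0 &
                forall l, l != j -> 0 < y 0 l -> b v (e l) = 0].
Proof.
move=> yz; have [hy hz yzv qy qz] := yz; have by1 := null_pair_bv yz.
have [|j [yj bj]] := @sum_pos_term _ y (fun l => b v (e l)) hy.
  by rewrite -bform_sum by1.
have bj1 : b v (e j) = 1 by have := bv_part hy yj; lia.
have hu := nonnegB_evec hy yj; set u := y - e j in hu.
have bu : b v u = 0 by rewrite bformDr bformNr by1 bj1 subrr.
have bul l : 0 < u 0 l -> b v (e l) = 0.
  by move=> ul; have := bv_part hu ul; have := bv_evec l; lia.
have yE : y = e j + u by rewrite addrC subrK.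
have uj : u 0 j = y 0 j - 1 by rewrite entryB evecE eqxx.
exists j; split=> //.
- by have := bul j; rewrite bj1 uj; have [?|?] := ltrP 0 (y 0 j - 1); lia.
- have : b y y = 0 by rewrite bform_diag qy mulr0.
  rewrite {2}yE bformDr [b y u]bform_sum big1 ?addr0 // => l _.
  have [ul|ul] := ltrP 0 (u 0 l); first by rewrite (null_pair_b0 yz) ?mulr0 // bul.
  by rewrite (_ : u 0 l = 0) ?mul0r //; apply: le_anti; rewrite ul hu.
- move=> l lj yl; apply: bul; rewrite entryB evecE (negPf lj) /= ?mulr0n subr0 //.
Qed.

Lemma null_pairP y z : null_pair y z -> exists j i, [/\ j != i,
  (y 0 j = 1 /\ z 0 j = 0) /\ (z 0 i = 1 /\ y 0 i = 0),
  forall l, b y (e l) = (l == i)%:R & forall l, b z (e l) = (l == j)%:R].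
Proof.
move=> yz; have zy := null_pairC yz; have [hy hz yzv qy qz] := yz.
have [j [yj bj byj hj]] := null_pair_special yz.
have [i [zi bi bzi hi]] := null_pair_special zy.
have bvE l : b v (e l) = b y (e l) + b z (e l) by rewrite -yzv bformDl.
have ji : j != i by apply/eqP => ji; move: bj; rewrite bvE byj ji bzi.
have zj : z 0 j = 0.
  apply: le_anti; rewrite hz andbT leNgt; apply/negP => zj.
  by have := hi j ji zj; rewrite bj.
have yi : y 0 i = 0.
  apply: le_anti; rewrite hy andbT leNgt; apply/negP => yi.
  by have := hj i; rewrite eq_sym ji bi => /(_ isT yi).
have b0 l : l != j -> l != i -> b v (e l) = 0.
  move=> lj li; have h := vpos l; rewrite -yzv entryD in h.
  have [yl|yl] := ltrP 0 (y 0 l); first exact: (hj _ lj yl).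
  by apply: (hi _ li); lia.
exists j, i; split=> // l.
- have [->|li] := eqVneq l i; first by move: bi; rewrite bvE bzi addr0.
  have [->|lj] := eqVneq l j => //.
  by apply: (null_pair_b0 yz); apply: b0.
- have [->|lj] := eqVneq l j; first by move: bj; rewrite bvE byj add0r.
  have [->|li] := eqVneq l i => //.
  by apply: (null_pair_b0 zy); apply: b0.
Qed.
(** The roots orthogonal to [v]; by [q_pos] they behave like the positive roots of a weakly positive
    form. *)
Definition jroot p := [/\ nonneg p, q p = 1 & b v p = 0].

Lemma jroot_neq0 p : jroot p -> p != 0.
Proof. by case=> _ qp _; apply: q_eq0_null qp. Qed.

Lemma jroot_b_ge p r : jroot p -> jroot r -> -1 <= b p r.
Proof.
move=> Jp [hr qr br]; have [hp qp bp] := Jp.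
have : 1 <= q (p + r).
  apply: q_pos; first exact: nonnegD.
    apply: weight_neq0; rewrite weightD // addn_gt0 weight_gt0 //.
    exact: jroot_neq0 Jp.
  by rewrite bformDr bp br.
by rewrite qformD qp qr; lia.
Qed.

Lemma jroot_sum p r : jroot p -> jroot r -> b p r = -1 -> jroot (p + r).
Proof.
move=> [hp qp bp] [hr qr br] bpr; split; first exact: nonnegD.
  by rewrite qformD qp qr bpr addrK.
by rewrite bformDr bp br.
Qed.

Lemma jroot_sum_b p r : jroot p -> jroot r -> q (p + r) = 1 -> b p r = -1.
Proof. by case=> _ qp _ [_ qr _]; rewrite qformD qp qr; lia. Qed.

Lemma jroot_evec x i : nonneg x -> b v x = 0 -> 0 < x 0 i -> jroot (e i).
Proof.
move=> hx bx xi; split; [exact: nonneg_evec | exact: q_evec |].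
have := bv_part hx xi.
by have := bv_evec i; rewrite bx; lia.
Qed.

(** Passes from splittings of [p] to the vertices of its support. A simple [e t] with
    [b p (e t) > 0] splits off and leaves a root [p1]. For [a + c = p1] exactly one of [b a (e t)],
    [b c (e t)] is [-1]; adding [e t] to that part gives a splitting of [p], so the induction
    hypothesis applies to [p1]. *)
Lemma jroot_split_span (f : 'rV[int]_n -> int) p :
  {morph f : x y / x + y} -> jroot p -> f p = 0 ->
  (forall a c, jroot a -> jroot c -> a + c = p -> f a = 0) ->
  forall s, 0 < p 0 s -> f (e s) = 0.
Proof.
move=> fD; have [k] := ubnP (weight p); elim: k p => // k IH p; rewrite ltnS.
move=> wp Jp fp fsplit; have [hp qp bp] := Jp.
have [|t [pt bt]] := @sum_pos_term _ p (fun l => b p (e l)) hp.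
  by rewrite -bform_sum bform_diag qp.
have Jt := jroot_evec hp bp pt; have [ht _ bvt] := Jt.
have hp1 := nonnegB_evec hp pt; set p1 := p - e t in hp1.
have pE : p1 + e t = p by rewrite subrK.
have [p10|p10] := eqVneq p1 0.
  have {}pE : p = e t by rewrite -pE p10 add0r.
  move=> s; rewrite {1}pE evecE; case: eqP => [->|] // _.
  by rewrite -pE.
have bp1 : b v p1 = 0 by rewrite bformDr bformNr bp bvt subr0.
have qp1 : 1 <= q p1 by apply: q_pos.
have Jp1 : jroot p1.
  split=> //; move: qp1; rewrite qformB qp q_evec //; lia.
have fp1 : f p1 = 0 by apply: (fsplit _ (e t)).
have ft : f (e t) = 0 by move: fp; rewrite -pE fD fp1 add0r.
have bp1t : b p1 (e t) = -1 by apply: jroot_sum_b => //; rewrite pE.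
have step a c : jroot a -> jroot c -> a + c = p1 -> b a (e t) = -1 -> f c = 0.
  move=> Ja Jc ac bat; apply: (fsplit c (a + e t)) => //; first exact: jroot_sum.
  by rewrite -pE -ac addrCA addrA.
move=> s ps; have [->//|st] := eqVneq s t.
apply: (IH p1) => //.
- by move: wp; rewrite (weight_le ht hp1) weight_evec add1n.
- move=> a c Ja Jc ac.
  have := jroot_b_ge Ja Jt; have := jroot_b_ge Jc Jt.
  have : b a (e t) + b c (e t) = -1 by rewrite -bformDl ac.
  have [bat|bat] := eqVneq (b a (e t)) (-1) => h1 h2 h3.
    have fc := step _ _ Ja Jc ac bat.
    by move: fp1; rewrite -ac fD fc addr0.
  apply: (step c a) => //; first by rewrite addrC.
  by lia.
- by rewrite entryB evecE (negPf st) subr0.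
Qed.

(** * Decompositions of [v] at the two exceptional vertices *)

Variables (j i : 'I_n).
Hypothesis ji : j != i.
Hypothesis bvE : forall l, b v (e l) = (l == i)%:R + (l == j)%:R.

Definition null_at y := [/\ y 0 j = 1, y 0 i = 0 & forall l, b y (e l) = (l == i)%:R].

Lemma null_at_b y x : null_at y -> b y x = x 0 i.
Proof.
case=> _ _ h; rewrite bform_sum (bigD1 i) //= h eqxx mulr1 big1 ?addr0 //.
by move=> l /negPf li; rewrite h li mulr0.
Qed.

(** The two exceptional vertices are read off from [b v], so every null pair has the same two,
    possibly interchanged. *)
Lemma null_pair_at y z : null_pair y z -> null_at y \/ null_at z.
Proof.
move=> yz; have [_ _ yzv _ _] := yz.
have [j' [i' [ji' [[yj zj] [zi yi]] hy hz]]] := null_pairP yz.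
have h l : (l == i')%:R + (l == j')%:R = (l == i)%:R + (l == j)%:R :> int.
  by rewrite -bvE -yzv bformDl hy hz.
have [ii|ii] := eqVneq i i'.
  left; have jj : j = j'.
    have := h j'; rewrite eqxx -ii; rewrite -ii in ji'.
    by rewrite (negPf ji') !add0r; case: (j' =P j) => //.
  by split; rewrite ?jj ?ii.
have ij' : i = j'.
  have ij := ji; rewrite eq_sym in ij.
  have := h i; rewrite eqxx (negPf ii) (negPf ij).
  by case: (i =P j').
have jj' : j = i'.
  have := h j; rewrite eqxx (negPf ji) -ij' (negPf ji).
  by case: (j =P i').
by right; split=> [||l]; [rewrite jj' | rewrite ij' | rewrite hz ij'].
Qed.

Lemma jroot_entry p l : jroot p -> (l == i) || (l == j) -> p 0 l = 0.
Proof.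
move=> [hp _ bp] lij; apply: le_anti; rewrite hp andbT leNgt; apply/negP => pl.
have := bv_part hp pl; rewrite bp bvE.
by move: lij; case: (l == i); case: (l == j).
Qed.

Lemma null_at_jroot y : nonneg y -> q y = 0 -> null_at y -> b v y = 1 -> jroot (y - e j).
Proof.
move=> hy qy [yj yi by_] bvy; split; first by apply: nonnegB_evec => //; rewrite yj.
  by rewrite qformB qy q_evec // by_ (negPf ji).
by rewrite bformDr bformNr bvy bvE eqxx (negPf ji).
Qed.

Variables y z : 'rV[int]_n.
Hypotheses (hy : nonneg y) (hz : nonneg z) (yzv : y + z = v) (qy : q y = 0) (qz : q z = 0).
Hypothesis (ny : null_at y) .
Hypotheses (zi : z 0 i = 1) (zj : z 0 j = 0) (bz : forall l, b z (e l) = (l == j)%:R).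
Local Notation p := (y - e j).
Local Notation r := (z - e i).
Local Notation c := (b (e j) (e i)).

Let ij : i != j. Proof. by rewrite eq_sym. Qed.
Let yz : null_pair y z. Proof. by []. Qed.

Let Jp : jroot p.
Proof. exact: null_at_jroot (null_pair_bv yz). Qed.
Let Jr : jroot r.
Proof.
split; first by apply: nonnegB_evec => //; rewrite zi.
  by rewrite qformB qz q_evec bz (negPf ij).
by rewrite bformDr bformNr (null_pair_bv (null_pairC yz)) bvE eqxx (negPf ij).
Qed.

Let bzx x : b z x = x 0 j.
Proof.
rewrite bform_sum (bigD1 j) //= bz eqxx mulr1 big1 ?addr0 //.
by move=> l /negPf lj; rewrite bz lj mulr0.
Qed.
Let byx x : b y x = x 0 i. Proof. exact: null_at_b. Qed.

(** [b y] is the coordinate at [i], where roots orthogonal to [v] vanish; so pairing them with [p]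
    is pairing with [- e j], and likewise for [r] and [- e i]. All values needed below are thus
    functions of [c]. *)
Let bp x : jroot x -> b p x = - b (e j) x.
Proof. by move=> Jx; rewrite bformDl bformNl byx (jroot_entry Jx) ?eqxx // add0r. Qed.
Let br x : jroot x -> b r x = - b (e i) x.
Proof. by move=> Jx; rewrite bformDl bformNl bzx (jroot_entry Jx) ?eqxx ?orbT // add0r. Qed.

Let bpr : b p r = c - 1.
Proof.
rewrite bformDl bformNl byx (jroot_entry Jr) ?eqxx // add0r bformDr bformNr.
by rewrite (bformC E (e j) z) bz eqxx opprB.
Qed.
Let bjp : b (e j) p = - 2.
Proof. by have := bp Jp; rewrite bform_diag; case: Jp => _ -> _; lia. Qed.
Let bjr : b (e j) r = 1 - c.
Proof. by have := bp Jr; rewrite bpr; lia. Qed.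
Let bip : b (e i) p = 1 - c.
Proof. by have := br Jp; rewrite (bformC E r) bpr; lia. Qed.

Let bj_ge x : jroot x -> - 2 <= b (e j) x.
Proof.
move=> [hx qx bx]; have : 0 <= q (e j + x).
  apply: q_nonneg1; first by apply: nonnegD => //; apply: nonneg_evec.
  by rewrite bformDr bx bvE eqxx (negPf ji).
by rewrite qformD qx q_evec; lia.
Qed.
Let bi_ge x : jroot x -> - 2 <= b (e i) x.
Proof.
move=> [hx qx bx]; have : 0 <= q (e i + x).
  apply: q_nonneg1; first by apply: nonnegD => //; apply: nonneg_evec.
  by rewrite bformDr bx bvE eqxx (negPf ij).
by rewrite qformD qx q_evec; lia.
Qed.

(** [q (p + r) = c + 1] must be at least 1. With the upper bound from [bi_ge] at [p], four values of
    [c] remain. *)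
Let c_ge0 : 0 <= c.
Proof.
have [hp qp bvp] := Jp; have [hr qr bvr] := Jr.
have : 1 <= q (p + r).
  apply: q_pos; first exact: nonnegD.
    apply: weight_neq0; rewrite weightD // addn_gt0 weight_gt0 //.
    exact: jroot_neq0 Jp.
  by rewrite bformDr bvp bvr.
by rewrite qformD qp qr bpr; lia.
Qed.
Let c_le3 : c <= 3.
Proof. by have := bi_ge Jp; rewrite bip; lia. Qed.

Let Ep : y = e j + p. Proof. by rewrite addrC subrK. Qed.
Let Ev : e j + e i + (p + r) = v.
Proof. by rewrite addrACA !(addrC (e _)) !subrK. Qed.

(** [e j + x] is then a null vector below [v], hence one member of a null pair, and the one at [j].
    Both it and [y] pair as the coordinate at [i], so [x - p] lies in the radical of [b]. *)
Let null_radical x : jroot x -> nonneg (p + r - x) -> b (e j) x = - 2 ->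
  forall w, b x w = b p w.
Proof.
move=> Jx hx bjx w; have [hx0 qx bvx] := Jx.
have qu : q (e j + x) = 0 by rewrite qformD q_evec qx bjx.
have bvu : b v (e j + x) = 1 by rewrite bformDr bvx bvE eqxx (negPf ji).
have np : null_pair (e j + x) (v - (e j + x)).
  split=> //; first by apply: nonnegD => //; apply: nonneg_evec.
  - have -> : v - (e j + x) = e i + (p + r - x).
      by rewrite -Ev; apply/rowP=> l; rewrite !mxE; ring.
    by apply: nonnegD => //; apply: nonneg_evec.
  - by rewrite addrC subrK.
  - by rewrite qformB vroot qu bvu.
have [nu|[uj _ _]] := null_pair_at np; last first.
  have vj : v 0 j = 1 by rewrite -yzv entryD zj; case: ny => ->.
  by move: uj; rewrite entryB entryD vj evecE eqxx; have := hx0 j; lia.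
have := null_at_b w nu; rewrite -(byx w) {1}Ep !bformDl => /addrI ->.
by [].
Qed.

Let null_radical_i x : jroot x -> nonneg (p + r - x) -> b (e i) x = - 2 ->
  forall w, b x w = b r w.
Proof.
move=> Jx hx bix w; have [hx0 qx bvx] := Jx.
have qu : q (e i + x) = 0 by rewrite qformD q_evec qx bix.
have bvu : b v (e i + x) = 1 by rewrite bformDr bvx bvE eqxx (negPf ij).
have np : null_pair (e i + x) (v - (e i + x)).
  split=> //; first by apply: nonnegD => //; apply: nonneg_evec.
  - have -> : v - (e i + x) = e j + (p + r - x).
      by rewrite -Ev; apply/rowP=> l; rewrite !mxE; ring.
    by apply: nonnegD => //; apply: nonneg_evec.
  - by rewrite addrC subrK.
  - by rewrite qformB vroot qu bvu.
have [[uj _ _]|nu] := null_pair_at np.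
  by move: uj; rewrite entryD evecE (negPf ji) (jroot_entry Jx) ?eqxx ?orbT.
have := null_at_b w nu; rewrite bformDl bformNl -{1}yzv bformDl byx bformDl => h.
by rewrite bformDl bformNl; lia.
Qed.

(** The dimension vector of a simple at an exceptional vertex glued to an indecomposable of
    dimension vector [C]; [block_rep] realizes it with local endomorphism ring. [b v (e k) > 0]
    keeps [k] out of the support of [C]. *)
Definition block d := exists k C, [/\ d = e k + C, 0 < b v (e k) &
  C = 0 \/ jroot C /\ b (e k) C = -1].

Let bvj : 0 < b v (e j). Proof. by rewrite bvE eqxx (negPf ji). Qed.
Let bvi : 0 < b v (e i). Proof. by rewrite bvE eqxx (negPf ij). Qed.

Let block_j C : jroot C -> b (e j) C = -1 -> block (e j + C).
Proof. by move=> JC h; exists j, C; split=> //; right. Qed.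
Let block_i C : jroot C -> b (e i) C = -1 -> block (e i + C).
Proof. by move=> JC h; exists i, C; split=> //; right. Qed.

(** Here [b p r = 2]. Removing a simple [e t] with [b p (e t) = 1] cuts [p] into two roots pairing
    to 1 with [p]. Neither can pair to 2 with [r]: it would agree with [r] modulo the radical and so
    pair to 2 with [p]. Hence both pair to 1 with [r]. *)
Let c3_split : c = 3 -> exists a s, [/\ jroot a, jroot s, a + s = p &
  [/\ b (e j) a = -1, b (e j) s = -1, b (e i) a = -1, b (e i) s = -1 & b a s = -1]].
Proof.
move=> c3; have [hp qp bvp] := Jp.
have [|t [pt bt]] := @sum_pos_term _ p (fun l => b p (e l)) hp.
  by rewrite -bform_sum bform_diag qp.
have Jt := jroot_evec hp bvp pt; have [ht qt bvt] := Jt.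
have ha := nonnegB_evec hp pt; set a := p - e t in ha.
have pE : a + e t = p by rewrite subrK.
have a0 : a != 0.
  apply/eqP => a0; have := b_evec_ge j t.
  by move: bjp; rewrite -pE a0 add0r; lia.
have bva : b v a = 0 by rewrite bformDr bformNr bvp bvt subr0.
have qa : 1 <= q a by apply: q_pos.
have qaE : q a = 2 - b p (e t) by rewrite qformB qp qt.
have Ja : jroot a by split=> //; lia.
have bat : b a (e t) = -1 by apply: jroot_sum_b; rewrite ?pE.
have bpt : b p (e t) = 1 by rewrite -pE bformDl bat b_evec_diag.
have bpa : b p a = 1 by rewrite -pE bformDl bform_diag (bformC E (e t)) bat; lia.
have [hr _ _] := Jr; have bpr2 : b p r = 2 by rewrite bpr c3.
have br1 x : jroot x -> nonneg (p - x) -> b p x = 1 -> b r x <= 1.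
  move=> Jx hx bpx; have := bi_ge Jx; have := br Jx.
  have [bix|] := eqVneq (b (e i) x) (-2); last by lia.
  have hx' : nonneg (p + r - x) by rewrite addrAC; apply: nonnegD.
  by have := null_radical_i Jx hx' bix p; rewrite (bformC E x) (bformC E r) bpx bpr2.
have bra : b r a <= 1 by apply: br1; rewrite // -{1}pE addrC addKr.
have brt : b r (e t) <= 1 by apply: br1.
have : b r a + b r (e t) = 2 by rewrite -bformDr pE bformC.
have := bp Ja; have := bp Jt; have := br Ja; have := br Jt.
by exists a, (e t); split=> //; split=> //; lia.
Qed.

(** Without such a splitting, every splitting of [p + r] has a part congruent to [p] modulo the
    radical. This makes the parts of splittings of [p] orthogonal to those of [r], and then the
    simples in the two supports; [b (e j) (e i) = 1] would be the only link between the support of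
    [y] and its complement. *)
Let c1_split :
  (forall A : 'I_n -> Prop, A j -> ~ A i -> exists s t,
     [/\ A s, ~ A t & b (e s) (e t) != ((s == j) && (t == i))%:R]) ->
  c = 1 -> exists C D, [/\ jroot C, jroot D, C + D = p + r & b (e j) C = -1].
Proof.
move=> Hconn c1; apply: NNPP => NB.
have [hp qp bvp] := Jp; have [hr qr bvr] := Jr.
have bpr0 : b p r = 0 by rewrite bpr c1.
have rad C D : jroot C -> jroot D -> C + D = p + r ->
    (forall w, b C w = b p w) \/ (forall w, b D w = b p w).
  move=> JC JD CD; have [hC _ _] := JC; have [hD _ _] := JD.
  have : b (e j) C + b (e j) D = -2 by rewrite -bformDr CD bformDr bjp bjr c1.
  have := bj_ge JC; have := bj_ge JD.
  have : b (e j) C != -1 by apply/eqP => h; apply: NB; exists C, D.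
  have [h|h] := eqVneq (b (e j) C) (-2).
    by left; apply: null_radical => //; rewrite -CD addrC addKr.
  have [h'|h'] := eqVneq (b (e j) D) (-2); last by lia.
  by right; apply: null_radical => //; rewrite -CD addrK.
have q2 x : jroot x -> b x x = 2 by case=> _ qx _; rewrite bform_diag qx.
(* A negative value would make [a + r] and [s] roots with sum [p + r], and both alternatives of
   [rad] contradict a computed value of [b]. *)
have F1 a s : jroot a -> jroot s -> a + s = p -> 0 <= b a r.
  move=> Ja Js as_; rewrite leNgt; apply/negP => lt0; have := jroot_b_ge Ja Jr => ge.
  have bar : b a r = -1 by lia.
  have bsr : b s r = 1 by move: bpr0; rewrite -as_ bformDl bar; lia.
  have Jar := jroot_sum Ja Jr bar.
  have [|h|h] := rad _ _ Jar Js.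
  - by rewrite addrAC as_.
  - by have := h s; rewrite -as_ 2!(bformDl E a) (q2 _ Js) (bformC E r) bsr; lia.
  - by have := h a; rewrite -as_ !bformDl (q2 _ Ja); lia.
have F1' a s : jroot a -> jroot s -> a + s = p -> b a r = 0.
  move=> Ja Js as_; have := F1 _ _ Ja Js as_; have := F1 _ _ Js Ja.
  by rewrite addrC => /(_ as_); move: bpr0; rewrite -as_ bformDl; lia.
have G1 a s : jroot a -> jroot s -> a + s = r -> 0 <= b p a.
  move=> Ja Js as_; rewrite leNgt; apply/negP => lt0; have := jroot_b_ge Jp Ja => ge.
  have bpa : b p a = -1 by lia.
  have bps : b p s = 1 by move: bpr0; rewrite -as_ bformDr bpa; lia.
  have Jpa := jroot_sum Jp Ja bpa.
  have [|h|h] := rad _ _ Jpa Js.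
  - by rewrite -addrA as_.
  - by have := h a; rewrite (bformDl E p) (q2 _ Ja); lia.
  - by have := h s; rewrite (q2 _ Js) bps.
have G1' a s : jroot a -> jroot s -> a + s = r -> b p a = 0.
  move=> Ja Js as_; have := G1 _ _ Ja Js as_; have := G1 _ _ Js Ja.
  by rewrite addrC => /(_ as_); move: bpr0; rewrite -as_ bformDr; lia.
have F2 a s g d : jroot a -> jroot s -> a + s = p -> jroot g -> jroot d -> g + d = r ->
    0 <= b a g.
  move=> Ja Js as_ Jg Jd gd; rewrite leNgt; apply/negP => lt0.
  have ge := jroot_b_ge Ja Jg.
  have bag : b a g = -1 by lia.
  have bad : b a d = 1 by have := F1' _ _ Ja Js as_; rewrite -gd bformDr; lia.
  have bsg : b s g = 1 by have := G1' _ _ Jg Jd gd; rewrite -as_ bformDl; lia.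
  have bsd : b s d = -1.
    by have := F1' _ _ Js Ja; rewrite addrC -gd bformDr => /(_ as_); lia.
  have J1 := jroot_sum Ja Jg bag; have J2 := jroot_sum Js Jd bsd.
  have [|h|h] := rad _ _ J1 J2.
  - by rewrite addrACA as_ gd.
  - by have := h s; rewrite -as_ !bformDl (q2 _ Js) (bformC E g) bsg; lia.
  - by have := h a; rewrite -as_ !bformDl (q2 _ Ja) (bformC E d) bad; lia.
have F2' a s g d : jroot a -> jroot s -> a + s = p -> jroot g -> jroot d -> g + d = r ->
    b a g = 0.
  move=> Ja Js as_ Jg Jd gd; have := F2 _ _ _ _ Ja Js as_ Jg Jd gd.
  have := F2 _ _ _ _ Ja Js as_ Jd Jg; rewrite addrC => /(_ gd).
  by have := F1' _ _ Ja Js as_; rewrite -gd bformDr; lia.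
(* [jroot_split_span] in each of the two arguments of [b] descends from splittings to vertices. *)
have Fst s t : 0 < p 0 s -> 0 < r 0 t -> b (e s) (e t) = 0.
  move=> ps; apply: (jroot_split_span (f := b (e s))) => //.
  - by move=> x w; exact: bformDr.
  - apply: (jroot_split_span (f := fun x => b x r) _ Jp) => //.
      by move=> x w; exact: bformDl.
  - move=> g d Jg Jd gd.
    apply: (jroot_split_span (f := fun x => b x g) _ Jp) => //.
    + by move=> x w; exact: bformDl.
    + exact: G1' gd.
    + by move=> a s' Ja Js' as_; apply: F2' as_ Jg Jd gd.
have Fjt t : 0 < r 0 t -> b (e j) (e t) = 0.
  move=> rt; have Jt := jroot_evec hr bvr rt; have := bp Jt.
  rewrite (bformC E p) bform_sum big1 ?oppr0 => [|s _]; first by lia.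
  have [ps|ps] := ltrP 0 (p 0 s); first by rewrite bformC Fst // mulr0.
  by rewrite (_ : p 0 s = 0) ?mul0r //; apply: le_anti; rewrite ps hp.
have Fsi s : 0 < p 0 s -> b (e s) (e i) = 0.
  move=> ps; have Js := jroot_evec hp bvp ps; have := br Js.
  rewrite (bformC E r) bform_sum big1 => [|t _]; first by rewrite bformC; lia.
  have [rt|rt] := ltrP 0 (r 0 t); first by rewrite Fst // mulr0.
  by rewrite (_ : r 0 t = 0) ?mul0r //; apply: le_anti; rewrite rt hr.
have [yj yi _] := ny.
(* The set is the support of [y]; by omnipresence its complement lies in the support of [z]. *)
have [||s [t [ys yt]]] := Hconn (fun l => 0 < y 0 l); rewrite ?yj ?yi //.
have {}yt : y 0 t = 0 by have := hy t; lia.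
have zt : 0 < z 0 t by have := vpos t; rewrite -yzv entryD yt; lia.
have ri : r 0 i = 0 by rewrite (jroot_entry Jr) ?eqxx.
have pr l x k : x 0 l - (l == k)%:R = (x - e k) 0 l by rewrite entryB evecE.
move/eqP; have [->|sj] := eqVneq s j; have [->|ti] := eqVneq t i.
- by rewrite c1.
- by rewrite Fjt // -pr (negPf ti) subr0.
- by rewrite Fsi // -pr (negPf sj) subr0.
- by rewrite Fst // -pr ?(negPf ti) ?(negPf sj) subr0.
Qed.

Let lin_b (F : fieldType) (x x' : 'rV[int]_n) (g : F) :
  (forall l, (x 0 l)%:~R = g * (x' 0 l)%:~R) ->
  forall w, (b w x)%:~R = g * (b w x')%:~R.
Proof.
move=> h w; rewrite !bform_sum !rmorph_sum /= mulr_sumr; apply: eq_bigr => l _.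
by rewrite !intrM h mulrA.
Qed.

(** Integral independence would not do: [theta] is later chosen over the ground field, whose
    characteristic is arbitrary. *)
Definition not_span (u w r0 : 'rV[int]_n) := forall (F : fieldType) y' z' (g1 g2 g3 : F),
  null_pair y' z' -> ~ forall l, (y' 0 l)%:~R =
    g1 * (u 0 l)%:~R + g2 * (w 0 l)%:~R + g3 * (r0 0 l)%:~R.

(** For a null vector at [j] the coordinates at [j] and [i] force [g1 = 1] and [g2 = 0]. If the null
    vector at [j] is the other member [v - y'] of the pair, it is a combination with coefficients
    [1 - g]. *)
Let not_spanP u w r0 : u + w + r0 = v -> u 0 j = 1 -> u 0 i = 0 -> w 0 j = 0 -> w 0 i = 1 ->
  (forall l, (l == i) || (l == j) -> r0 0 l = 0) ->
  (forall (F : fieldType) y' z' (g : F), null_pair y' z' -> null_at y' ->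
     ~ forall l, ((y' - u) 0 l)%:~R = g * (r0 0 l)%:~R) ->
  not_span u w r0.
Proof.
move=> uwr uj ui wj wi r00 H F.
have H1 y' z' (g1 g2 g3 : F) : null_pair y' z' -> null_at y' ->
   ~ forall l, (y' 0 l)%:~R = g1 * (u 0 l)%:~R + g2 * (w 0 l)%:~R + g3 * (r0 0 l)%:~R.
  move=> yz' ny' h; have [yj yi _] := ny'.
  have := h j; rewrite yj uj wj r00 ?eqxx ?orbT // !mulr0 !addr0 mulr1 => g1E.
  have := h i; rewrite yi ui wi r00 ?eqxx // !mulr0 add0r addr0 mulr1 => g2E.
  apply: (H F _ _ g3 yz' ny') => l; rewrite entryB intrB h -g1E -g2E.
  by rewrite mul0r addr0 mul1r addrC addKr.
move=> y' z' g1 g2 g3 yz'; have [ny'|nz'] := null_pair_at yz'; first exact: H1 yz' ny'.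
move=> h; apply: (H1 _ _ (1 - g1) (1 - g2) (1 - g3) (null_pairC yz') nz') => l.
have -> : z' 0 l = u 0 l + w 0 l + r0 0 l - y' 0 l.
  by rewrite -!entryD uwr; case: yz' => _ _ <- _ _; rewrite entryD addrC addKr.
by rewrite intrB !intrD h; ring.
Qed.

(** With [r0 = 0], a null vector at [j] in the span would equal [u] in [F]; pairing with [e j] gives
    0 on one side and 1 on the other, in every characteristic. *)
Let block_not_span u w : u + w = v -> u 0 j = 1 -> u 0 i = 0 -> b (e j) u = 1 ->
  not_span u w 0.
Proof.
move=> uw uj ui bju; have vE l : v 0 l = y 0 l + z 0 l by rewrite -yzv entryD.
have [yj yi _] := ny.
apply: not_spanP; rewrite ?addr0 //.
- by have := vE j; rewrite -uw entryD uj yj zj => /addrI.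
- by have := vE i; rewrite -uw entryD ui yi zi => /addrI.
- by move=> l _; rewrite entry0.
move=> F y' z' g yz' ny' h; have := lin_b h (e j).
rewrite bform0r mulr0 bformDr bformNr bju (bformC E) (null_at_b _ ny').
by rewrite evecE (negPf ij) sub0r => /eqP; rewrite intrN oppr_eq0 oner_eq0.
Qed.

Let jroot0 x : jroot x -> x 0 j = 0 /\ x 0 i = 0.
Proof. by move=> Jx; rewrite !(jroot_entry Jx) ?eqxx ?orbT. Qed.

(** The values of [b (e j)] on [p] and [r] are [-2] and [1 - c], and [e j] needs a companion with
    value [-1]: [p + r] for [c = 0], the root of [c1_split] for [c = 1], [r] for [c = 2]. For
    [c = 3] both values are [-2], so [p] is cut by [c3_split] and [r] stays as a third summand. *)
Lemma not_span_exists :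
  (forall A : 'I_n -> Prop, A j -> ~ A i -> exists s t,
     [/\ A s, ~ A t & b (e s) (e t) != ((s == j) && (t == i))%:R]) ->
  exists u w r0, [/\ block u, block w, r0 = 0 \/ jroot r0, u + w + r0 = v & not_span u w r0].
Proof.
move=> Hconn.
have [c0|[c1|[c2|c3]]] : c = 0 \/ (c = 1 \/ (c = 2 \/ c = 3)).
- by have := c_ge0; have := c_le3; lia.
- have Jpr : jroot (p + r) by apply: jroot_sum => //; rewrite bpr c0.
  have bju : b (e j) (p + r) = -1 by rewrite bformDr bjp bjr c0.
  have [xj xi] := jroot0 Jpr.
  exists (e j + (p + r)), (e i), 0; split=> //.
  + exact: block_j.
  + by exists i, 0; split; [rewrite addr0 | | left].
  + by left.
  + by rewrite addr0 -Ev addrAC.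
  + apply: block_not_span; first by rewrite -Ev addrAC.
    * by rewrite entryD evecE eqxx xj.
    * by rewrite entryD evecE (negPf ij) xi.
    * by rewrite bformDr b_evec_diag bju.
- have [C [D [JC JD CD bjC]]] := c1_split Hconn c1.
  have [xj xi] := jroot0 JC; have [[_ qC _] [_ qD _]] := (JC, JD).
  have bCD : b C D = 0.
    have : q (C + D) = 2.
      by rewrite CD qformD bpr c1; have [[_ -> _] [_ -> _]] := (Jp, Jr).
    by rewrite qformD qC qD; lia.
  have bjD : b (e j) D = -1.
    have : b (e j) (C + D) = -2 by rewrite CD bformDr bjp bjr c1.
    by rewrite bformDr bjC; lia.
  have biD : b (e i) D = -1.
    have : b (C + D) D = 2 by rewrite bformDl bCD bform_diag qD.
    by rewrite CD bformDl (bp JD) (br JD) bjD; lia.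
  exists (e j + C), (e i + D), 0; split=> //.
  + exact: block_j.
  + exact: block_i.
  + by left.
  + by rewrite addr0 addrACA CD Ev.
  + apply: block_not_span; first by rewrite addrACA CD Ev.
    * by rewrite entryD evecE eqxx xj.
    * by rewrite entryD evecE (negPf ij) xi.
    * by rewrite bformDr b_evec_diag bjC.
- have bju : b (e j) r = -1 by rewrite bjr c2.
  have biu : b (e i) p = -1 by rewrite bip c2.
  have [xj xi] := jroot0 Jr.
  have uw : e j + r + (e i + p) = v by rewrite addrACA (addrC r) Ev.
  exists (e j + r), (e i + p), 0; split=> //.
  + exact: block_j.
  + exact: block_i.
  + by left.
  + by rewrite addr0.
  + apply: block_not_span => //.
    * by rewrite entryD evecE eqxx xj.
    * by rewrite entryD evecE (negPf ij) xi.
    * by rewrite bformDr b_evec_diag bju.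
- have [a [s [Ja Js as_ [bja bjs bia bis bas]]]] := c3_split c3.
  have [[aj ai] [sj si]] := (jroot0 Ja, jroot0 Js); have [rj ri] := jroot0 Jr.
  have uwr : e j + a + (e i + s) + r = v by rewrite [e j + a + _]addrACA as_ -(addrA (e j + e i)) Ev.
  exists (e j + a), (e i + s), r; split=> //.
  + exact: block_j.
  + exact: block_i.
  + by right.
  apply: not_spanP => //; rewrite ?entryD ?evecE ?eqxx ?(negPf ij) ?(negPf ji) ?aj ?ai ?sj ?si //.
    by move=> l; exact: jroot_entry Jr.
  move=> F y' z' g yz' ny' h; set x := y' - (e j + a) in h.
  have bj1 : b (e j) x = -1.
    by rewrite bformDr bformNr (bformC E) (null_at_b _ ny') evecE (negPf ij) bformDr
      b_evec_diag bja.
  have bs2 : b s x = 2.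
    rewrite bformDr bformNr (bformC E) (null_at_b _ ny') si bformDr.
    by rewrite (bformC E s a) bas (bformC E) bjs.
  have bsr : b s r = 1 by have := br Js; rewrite bis bformC opprK.
  have g2 : g = 2 by have := lin_b h s; rewrite bs2 bsr mulr1 => <-.
  (* With [g = 2], pairing [x = g r] with [e j] reads [-1 = 2 * (-2)]. *)
  have g3 : 3 = 0 :> F.
    have := lin_b h (e j); rewrite bj1 bjr c3 g2 (_ : 1 - 3 = - 2%:Z) // !intrN => h'.
    have -> : 3 = - 1%:~R - 2 * - 2%:~R :> F by ring.
    by rewrite h' subrr.
  (* In characteristic 3 the equation [x = 2 r] says that [x + r] is 3 times an integral vector, so
     [q (x + r)] would be divisible by 9; its value is 3. *)
  have dv l : (3 %| (x + r)%R 0%R l)%Z.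
    have : ((x + r) 0 l)%:~R = 0 :> F.
      have -> : ((x + r) 0 l)%:~R = 3 * (r 0 l)%:~R :> F by rewrite entryD intrD h g2; ring.
      by rewrite g3 mul0r.
    rewrite {1}(divz_eq ((x + r) 0 l) 3) intrD intrM (_ : 3%:~R = 0 :> F) // mulr0 add0r => h'.
    apply/dvdz_mod0P; have := modz_ge0 ((x + r) 0 l) (isT : 3 != 0 :> int).
    have := ltz_mod ((x + r) 0 l) (isT : 3 != 0 :> int).
    move: h'; case: (modz _ _) => // [[|[|[|]]]] //.
      by move/eqP; rewrite oner_eq0.
    move=> h2 _ _; have : 3 - 2%:~R = 0 :> F by rewrite h2 g3 subrr.
    by move/eqP; rewrite (_ : 3 - _ = 1) ?oner_eq0 //; ring.
  have [x3 x3E] : exists x3, x + r = 3 *: x3.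
    exists (\row_l ((x + r)%R 0%R l %/ 3)%Z); apply/rowP => l.
    by rewrite [RHS]mxE [X in 3 * X]mxE mulrC divzK.
  have : q (x + r) = 3.
    have [hy' _ _ qy' _] := yz'; have [[_ qr _] [_ qa _]] := (Jr, Ja).
    have -> : q (x + r) = q x + q r + b x r by exact: qformD.
    have -> : q x = 1.
      rewrite qformB qy' qformD q_evec qa bja (null_at_b _ ny') entryD evecE.
      by rewrite (negPf ij) ai.
    have -> : b x r = b y' r - (b (e j) r + b a r) by rewrite bformDl bformNl bformDl.
    by rewrite qr (null_at_b _ ny') ri bjr c3 (bformC E a) (br Ja) bia.
  by rewrite x3E qformZ; lia.
Qed.
End MaximalRoot.

Section NullPairBlocks.
Variables (n : nat) (E : 'M[int]_n) (v : 'rV[int]_n).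
Hypothesis Ediag : forall i, E i i = 1.
Hypothesis Eoff : forall i j, i != j -> -1 <= E i j + E j i.
Hypothesis vpos : forall i, 0 < v 0 i.
Hypothesis vroot : qform E v = 1.
Hypothesis vmax : forall w, nonneg (w - v) -> qform E w = 1 -> w = v.

(** Both parts are orthogonal to [v], so [q a] and [q c] are at least 1 while [q p = 1]. By
    [adapted_generic], a representation of dimension vector [p] with fewest endomorphisms is then
    indecomposable. *)
Lemma jroot_split_neg p a c : jroot E v p -> nonneg a -> nonneg c -> a != 0 -> c != 0 ->
  a + c = p -> bform E a c < 0.
Proof.
move=> [_ qp bp] ha hc a0 c0 ac.
have := bv_nonneg Ediag vroot vmax ha; have := bv_nonneg Ediag vroot vmax hc.
have := bp; rewrite -ac bformDr => h1 h2 h3.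
have := q_pos Ediag Eoff vroot vmax ha a0; have := q_pos Ediag Eoff vroot vmax hc c0.
move=> h4 h5; have := qp; rewrite -ac qformD.
by have := h4 ltac:(lia); have := h5 ltac:(lia); lia.
Qed.

Lemma jroot_entry0 C k : jroot E v C -> 0 < bform E v (evec k) -> C 0 k = 0.
Proof.
move=> [hC _ bC] bk; apply: le_anti; rewrite hC andbT leNgt; apply/negP => Ck.
by have := bv_part Ediag vroot vmax hC Ck; rewrite bC; lia.
Qed.

Lemma null_pair_blocks :
  (forall j i (A : 'I_n -> Prop), j != i -> A j -> ~ A i -> exists s t,
     [/\ A s, ~ A t & bform E (evec s) (evec t) != ((s == j) && (t == i))%:R]) ->
  (forall y z, ~ null_pair E v y z) \/
  exists u w r, [/\ block E v u, block E v w, r = 0 \/ jroot E v r, u + w + r = v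
                  & not_span E v u w r].
Proof.
move=> Hconn; have [[y [z yz]]|nex] := classic (exists y z, null_pair E v y z); last first.
  by left=> y z yz; apply: nex; exists y, z.
right; have [j [i [ji [[yj zj] [zi yi]] hy hz]]] := null_pairP Ediag Eoff vpos vroot vmax yz.
have [ny nz yzv qy qz] := yz.
apply: (not_span_exists Ediag Eoff vpos vroot vmax ji _ ny nz yzv qy qz _ zi zj hz) => //.
  by move=> l; rewrite -yzv bformDl hy hz.
by move=> A Aj Ai; apply: Hconn.
Qed.
End NullPairBlocks.

(** * Linear algebra *)

Section MatrixSpaces.
Variables (F : fieldType) (N : nat).
Local Notation mat := 'M[F]_N.
Implicit Types A B Y e f : mat.

Definition sandwich A B : 'End(mat) := linfun (mulmxr B \o mulmx A).

Lemma sandwichE A B Y : sandwich A B Y = A *m Y *m B.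
Proof. by rewrite lfunE. Qed.

(** Rank factorizations of [A] and [B] produce the same image from an injective map on matrices of
    size [\rank A] by [\rank B]. *)
Lemma dim_sandwich A B : \dim (limg (sandwich A B)) = (\rank A * \rank B)%N.
Proof.
pose h : 'Hom('M[F]_(\rank A, \rank B), mat) :=
  linfun (mulmxr (row_base B) \o mulmx (col_base A)).
have hE Z : h Z = col_base A *m Z *m row_base B by rewrite lfunE.
have [L LK] := row_freeP (row_base_free B).
have [K KK] := row_fullP (col_base_full A).
have -> : limg (sandwich A B) = limg h.
  apply/eqP; rewrite eqEsubv; apply/andP; split; apply/subvP => _ /memv_imgP[Z _ ->].
    rewrite sandwichE -{1}(mulmx_base A) -{1}(mulmx_base B).
    have -> : col_base A *m row_base A *m Z *m (col_base B *m row_base B) =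
              h (row_base A *m Z *m col_base B) by rewrite hE !mulmxA.
    by rewrite memv_img ?memvf.
  rewrite hE.
  have [L' LK'] := row_freeP (row_base_free A).
  have [K' KK'] := row_fullP (col_base_full B).
  have hA : A *m L' = col_base A.
    transitivity (col_base A *m row_base A *m L'); first by rewrite mulmx_base.
    by rewrite -mulmxA LK' mulmx1.
  have hB : K' *m B = row_base B.
    transitivity (K' *m (col_base B *m row_base B)); first by rewrite mulmx_base.
    by rewrite mulmxA KK' mul1mx.
  have -> : col_base A *m Z *m row_base B = sandwich A B (L' *m Z *m K').
    by rewrite sandwichE -hA -hB !mulmxA.
  by rewrite memv_img ?memvf.
rewrite limg_dim_eq ?dimvf ?dim_matrix //.
apply/eqP; rewrite -subv0; apply/subvP => Z; rewrite memv_cap memv_ker hE => /andP[_ /eqP h0].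
rewrite memv0; apply/eqP.
have -> : Z = K *m (col_base A *m Z *m row_base B) *m L.
  by rewrite 2!(mulmxA K) KK mul1mx -(mulmxA Z) LK mulmx1.
by rewrite h0 mulmx0 mul0mx.
Qed.

Lemma rank_orthogonal_idempotents e f : e *m e = e -> f *m f = f -> e *m f = 0 ->
  f *m e = 0 -> \rank (e + f)%R = (\rank e + \rank f)%N.
Proof.
move=> ee ff ef fe.
have ex : e = e *m (e + f) by rewrite mulmxDr ee ef addr0.
have fx : f = f *m (e + f) by rewrite mulmxDr fe ff add0r.
have E : ((e + f)%R == (e + f)%MS)%MS.
  apply/andP; split; first by rewrite addmx_sub_adds.
  by rewrite addsmx_sub; apply/andP; split; [rewrite {1}ex | rewrite {1}fx]; exact: submxMl.
rewrite (eqmx_rank E) mxrank_disjoint_sum //.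
apply/eqP; rewrite -submx0; apply/row_subP => i.
set x := row i _.
have : (x <= e :&: f)%MS by apply: row_sub.
rewrite sub_capmx => /andP[/submxP[y xy] /submxP[z xz]].
have h : x = x *m e by rewrite xy -mulmxA ee.
by rewrite h xz -mulmxA fe mulmx0 sub0mx.
Qed.

(** For a rank factorization [e = C R], idempotency cancels to [R C = 1], and [e] has the trace of
    [R C]. *)
Lemma mxtrace_idempotent e : e *m e = e -> \tr e = (\rank e)%:R.
Proof.
move=> ee; have [L LK] := row_freeP (row_base_free e).
have [K KK] := row_fullP (col_base_full e).
rewrite -{1}(mulmx_base e) mxtrace_mulC.
suff -> : row_base e *m col_base e = 1%:M by rewrite mxtrace1.
have h : col_base e *m (row_base e *m col_base e) *m row_base e = col_base e *m row_base e.
  by rewrite (mulmxA (col_base e)) -(mulmxA _ _ (row_base e)) mulmx_base ee.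
move: (row_base e *m col_base e) h => Y h.
have -> : Y = K *m (col_base e *m Y *m row_base e) *m L.
  by rewrite 2!(mulmxA K) KK mul1mx -(mulmxA Y) LK mulmx1.
by rewrite h (mulmxA K) KK mul1mx LK.
Qed.
End MatrixSpaces.

Section VectorSpaces.
Variables (F : fieldType) (vT : vectType F).
Implicit Types (U V : {vspace vT}).

Lemma dim_common_ker (wT : vectType F) (I : Type) (r : seq I) (D : I -> 'Hom(vT, wT)) V :
  exists2 U, (\dim V <= \dim U + \sum_(i <- r) \dim (D i @: V))%N &
    (U <= V)%VS /\ forall x, x \in U -> all (fun i => D i x == 0) r.
Proof.
elim: r => [|i r [U hU [UV Uk]]].
  by exists V; [rewrite big_nil addn0 | split].
exists (U :&: lker (D i))%VS.
  rewrite big_cons; have := limg_ker_dim (D i) U.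
  by have := dimvS (limgS (D i) UV); lia.
split; first exact: subv_trans (capvSl _ _) UV.
by move=> x; rewrite memv_cap memv_ker => /andP[xU dx] /=; rewrite dx Uk.
Qed.

(** Applied to [ad X]: it turns the trace condition on endomorphisms into one functional [Lam] on
    the image of [ad X]. *)
Lemma functional_factor (D : 'End(vT)) (tau : 'Hom(vT, F^o)) V :
  (forall x, x \in V -> D x = 0 -> tau x = 0) ->
  exists L : 'Hom(vT, F^o), forall x, x \in V -> L (D x) = tau x.
Proof.
move=> h; pose D' := (D \o projv V)%VF.
exists ((tau \o projv V) \o D'^-1)%VF => x xV; rewrite !lfunE /= !lfunE /=.
have Dx : D x = D' x by rewrite lfunE /= projv_id.
have : D' (D'^-1%VF (D x)) = D x by rewrite limg_lfunVK // Dx memv_img ?memvf.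
set w := D'^-1%VF _; rewrite lfunE /= => Dw.
have : tau (projv V w - x) = 0.
  by apply: h; rewrite ?rpredB ?memv_proj // linearB /= Dw subrr.
by rewrite linearB /= => /eqP; rewrite subr_eq0 => /eqP.
Qed.
End VectorSpaces.

Section ClosedField.
Variables (F : closedFieldType).

Lemma exists_eigenvector N (A : 'M[F]_N) : (0 < N)%N ->
  exists lam, exists2 x : 'rV[F]_N, x != 0 & x *m A = lam *: x.
Proof.
move=> N0; have /closed_rootP[lam] : size (char_poly A) != 1 by rewrite size_char_poly; lia.
rewrite -eigenvalue_root_char => /eigenvalueP[x xA x0].
by exists lam, x.
Qed.

Lemma iter_mulmx_eigen N (A : 'M[F]_N) lam (x : 'rV[F]_N) (Z : 'M[F]_N) k :
  x *m A = lam *: x -> x *m iter k (mulmx A) Z = lam ^+ k *: (x *m Z).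
Proof.
move=> xA; elim: k => [|k IH] /=; first by rewrite scale1r.
by rewrite mulmxA xA -scalemxAl IH scalerA exprS.
Qed.

(** Nilpotency is relative to [eps], the unit of a corner ring. A row eigenvector shows that every
    eigenvalue has a vanishing power, so the characteristic polynomial is a power of the
    variable. *)
Lemma mxtrace_nilpotent N (eps A : 'M[F]_N) k :
  eps *m A = A -> iter k (mulmx A) eps = 0 -> \tr A = 0.
Proof.
case: N eps A => [|N] eps A eA nA; first by rewrite /mxtrace big_ord0.
have [r pE] := closed_field_poly_normal (char_poly A).
have lc : lead_coef (char_poly A) = 1 by apply/eqP; exact: char_poly_monic.
rewrite lc scale1r in pE.
have r0 z : z \in r -> z = 0.
  move=> zr; have : eigenvalue A z by rewrite eigenvalue_root_char pE root_prod_XsubC.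
  case/eigenvalueP => x xA x0.
  have : x *m iter k (mulmx A) eps *m A = 0 by rewrite nA mulmx0 mul0mx.
  rewrite (iter_mulmx_eigen eps k xA) -scalemxAl -mulmxA eA xA scalerA => /eqP.
  by rewrite scaler_eq0 (negPf x0) orbF -exprSr expf_eq0 => /andP[_ /eqP].
have pX : char_poly A = 'X^(size r).
  rewrite pE -(size_map id r) map_id; elim: r r0 {pE} => [|z r IH] h; first by rewrite big_nil.
  rewrite big_cons (h z) ?mem_head // subr0 IH ?exprS // => y yr.
  by apply: h; rewrite inE yr orbT.
have sr : size r = N.+1.
  by have := size_char_poly A; rewrite pX size_polyXn => -[].
have := char_poly_trace A isT; rewrite pX sr coefXn /= => /eqP.
by rewrite (ltn_eqF (ltnSn N)) eq_sym oppr_eq0 => /eqP.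
Qed.

(* Fitting decomposition with respect to one eigenvalue, via Bezout in the polynomial ring *)
Lemma eigen_split N (eps t : 'M[F]_N) : eps != 0 -> eps *m eps = eps -> eps *m t = t ->
  t *m eps = t ->
  (exists lam k, iter k (mulmx (t - lam *: eps)) eps = 0) \/
  exists e, [/\ e *m e = e, e != 0, e != eps, eps *m e = e & e *m eps = e] /\
    forall Y, Y *m eps = eps *m Y -> Y *m t = t *m Y -> Y *m e = e *m Y.
Proof.
case: N eps t => [|N] eps t; first by rewrite [eps]flatmx0 eqxx.
move=> eps0 epsK et te.
(* The eigenvector is taken in the row space of [eps], so that the idempotent built for [lam] fixes
   it and is nonzero. *)
have [lam [x x0 [xe xt]]] : exists lam, exists2 x : 'rV[F]_N.+1, x != 0 &
    x *m eps = x /\ x *m t = lam *: x.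
  pose B := row_base eps.
  have r0 : (0 < \rank eps)%N by rewrite lt0n mxrank_eq0.
  have Be : B *m eps = B.
    have /submxP[D ->] : (B <= eps)%MS by rewrite eq_row_base.
    by rewrite -mulmxA epsK.
  have /submxP[T BT] : (B *m t <= B)%MS by rewrite eq_row_base -te mulmxA submxMl.
  have [lam [y y0 yT]] := exists_eigenvector T r0.
  exists lam, (y *m B).
    apply: contraNneq y0 => yB; have [L LK] := row_freeP (row_base_free eps).
    by rewrite -[y]mulmx1 -LK mulmxA yB mul0mx.
  by split; rewrite -(mulmxA y) ?Be // BT mulmxA yT -scalemxAl.
have chp0 : char_poly t != 0 by rewrite monic_neq0 // char_poly_monic.
have rt : root (char_poly t) lam.
  by rewrite -eigenvalue_root_char; apply/eigenvalueP; exists x.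
have [k [h hlam pE]] : exists k, exists2 h, ~~ root h lam & char_poly t = h * ('X - lam%:P) ^+ k.
  have [k [h hr pE]] := multiplicity_XsubC (char_poly t) lam.
  by exists k, h => //; move: hr; rewrite chp0.
have cop : coprimep (('X - lam%:P) ^+ k) h.
  by apply: coprimep_expl; rewrite coprimep_sym coprimep_XsubC.
have k0 : (0 < k)%N.
  by rewrite lt0n; apply: contraTneq rt => k0; rewrite pE k0 mulr1.
have [[u w] /= uw] : exists uw, uw.1 * ('X - lam%:P) ^+ k + uw.2 * h = 1.
  by have /Bezout_eq1_coprimepP[[u w] /=] := cop; exists (u, w).
have commY Y p : Y *m t = t *m Y -> Y * horner_mx t p = horner_mx t p * Y.
  move=> Yt; elim/poly_ind: p => [|p c IH]; first by rewrite rmorph0 mulr0 mul0r.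
  rewrite rmorphD rmorphM /= horner_mx_X horner_mx_C mulrDl mulrDr mulrA IH -!mulrA.
  have -> : Y * c%:M = c%:M * Y by exact: scalar_mxC.
  by rewrite -[Y * t]/(Y *m t) Yt.
have xH p : x *m horner_mx t p = p.[lam] *: x.
  elim/poly_ind: p => [|p c IH]; first by rewrite rmorph0 mulmx0 horner0 scale0r.
  rewrite rmorphD rmorphM /= horner_mx_X horner_mx_C hornerMXaddC mulmxDr mul_mx_scalar.
  by rewrite mulmxA IH -scalemxAl xt scalerA scalerDl.
have comme p : eps * horner_mx t p = horner_mx t p * eps by apply: commY; rewrite et te.
set q := ('X - lam%:P) ^+ k in pE cop uw.
have CH : horner_mx t (h * q) = 0 by rewrite -pE Cayley_Hamilton.
have wh2 : horner_mx t (w * h) * horner_mx t (w * h) = horner_mx t (w * h).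
  apply/eqP; rewrite -subr_eq0 -{3}[w * h]mulr1 -uw mulrDr rmorphD opprD.
  rewrite -rmorphM [X in X - _]/= addrCA subrr addr0 oppr_eq0.
  have -> : w * h * (u * q) = w * u * (h * q) by ring.
  by rewrite rmorphM /= CH mulr0.
(* [w * h] is 1 modulo [q] and 0 modulo [h]: its value at [t] is the projection to the generalized
   eigenspace of [lam]. *)
pose e := horner_mx t (w * h) * eps.
have ee : e * e = e by rewrite /e mulrA -(mulrA _ eps) comme mulrA wh2 -mulrA; congr (_ * _).
have xe1 : x *m e = x.
  rewrite mulmxA xH; have -> : w * h = 1 - u * q by rewrite -uw addrC addKr.
  rewrite hornerD hornerN hornerM hornerC /q horner_exp hornerXsubC subrr expr0n.
  by rewrite (gtn_eqF k0) mulr0 subr0 scale1r xe.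
(* If [e = eps], then [q(t) eps = q(t) (w h)(t) eps] is 0 by Cayley-Hamilton, so [t - lam eps] is
   nilpotent in the corner. *)
have [eeps|ne] := eqVneq e eps.
  left; exists lam, k.
  have iterE j : iter j (mulmx (t - lam *: eps)) eps = horner_mx t (('X - lam%:P) ^+ j) * eps.
    elim: j => [|j IH]; first by rewrite expr0 rmorph1 mul1r.
    rewrite iterS IH exprS rmorphM rmorphB /= horner_mx_X horner_mx_C mulmxBl.
    rewrite -!mulrA mulrBl; congr (_ - _).
    rewrite -scalemxAl -comme mulmxA epsK -[LHS]mul_scalar_mx.
    by [].
  rewrite iterE.
  have -> : forall Z : 'M[F]_N.+1, Z * eps = Z * horner_mx t (w * h) * eps.
    by move=> Z; rewrite -[in LHS]eeps mulrA.
  rewrite -rmorphM /=.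
  have -> : ('X - lam%:P) ^+ k * (w * h) = w * (h * q) by rewrite /q; ring.
  by rewrite rmorphM /= CH mulr0 mul0r.
right; exists e; split.
  split=> //.
  - by apply: contraNneq x0 => e0; rewrite -xe1 e0 mulmx0.
  - by rewrite /e -mulmxE mulmxA mulmxE comme -mulrA; congr (_ * _).
  - by rewrite /e -mulmxE -mulmxA epsK.
move=> Y Ye Yt; rewrite /e -mulmxE mulmxA mulmxE (commY Y _ Yt) -!mulrA; congr (_ * _).
by rewrite -mulmxE Ye.
Qed.
End ClosedField.

(** * Representations as graded matrices *)

Section Graded.
Variables (F : fieldType) (n N : nat) (g : 'I_N -> 'I_n).
Local Notation mat := 'M[F]_N.
Implicit Types e f y Y : mat.

(** The spaces at all vertices form one space of row vectors, and [g] gives the vertex of each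
    coordinate. This keeps matrix sizes independent of the vertices. *)
Definition fiber_proj i : mat := diag_mx (\row_k (g k == i)%:R).
Local Notation P := fiber_proj.

Lemma fiber_projM i j : P i *m P j = if i == j then P i else 0.
Proof.
rewrite mulmx_diag; case: eqP => [<-|ij].
  by congr diag_mx; apply/rowP=> k; rewrite !mxE -natrM mulnb andbb.
apply/matrixP => k l; rewrite !mxE -natrM mulnb.
case: (g k =P i) => [gi|_]; last by rewrite mul0rn.
case: (g k =P j) => [gj|_]; last by rewrite mul0rn.
by case: ij; rewrite -gi -gj.
Qed.

Lemma fiber_projK i : P i *m P i = P i.
Proof. by rewrite fiber_projM eqxx. Qed.

Lemma sum_fiber_proj : \sum_i P i = 1%:M.
Proof.
apply/matrixP => k l; rewrite summxE !mxE (bigD1 (g k)) //= !mxE eqxx big1 ?addr0 //.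
by move=> i ik; rewrite !mxE eq_sym (negPf ik) mul0rn.
Qed.

Definition graded y := forall i, P i *m y = y *m P i.

Lemma graded_mul y Y : graded y -> graded Y -> graded (y *m Y).
Proof. by move=> h h' i; rewrite mulmxA h -mulmxA h' mulmxA. Qed.
Lemma gradedD y Y : graded y -> graded Y -> graded (y + Y).
Proof. by move=> h h' i; rewrite mulmxDr mulmxDl h h'. Qed.
Lemma gradedN y : graded y -> graded (- y).
Proof. by move=> h i; rewrite mulmxN mulNmx h. Qed.
Lemma graded0 : graded 0.
Proof. by move=> i; rewrite mulmx0 mul0mx. Qed.

Definition fiber_rank e : 'rV[int]_n := \row_i (\rank (P i *m e))%:Z.

Lemma fiber_rankE e i : fiber_rank e 0 i = (\rank (P i *m e))%:Z.
Proof. by rewrite mxE. Qed.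

Lemma fiber_rank_ge0 e : nonneg (fiber_rank e).
Proof. by move=> i; rewrite fiber_rankE. Qed.

Lemma fiber_rank_eq0 e : fiber_rank e = 0 -> e = 0.
Proof.
move=> h; rewrite -[e]mul1mx -sum_fiber_proj mulmx_suml big1 // => i _.
by apply/eqP; rewrite -mxrank_eq0; move: h => /rowP/(_ i); rewrite !mxE => -[->].
Qed.

Lemma fiber_rankD e f : graded e -> graded f -> e *m e = e -> f *m f = f -> e *m f = 0 ->
  f *m e = 0 -> fiber_rank (e + f) = fiber_rank e + fiber_rank f.
Proof.
move=> ge gf ee ff ef fe; apply/rowP => i.
rewrite entryD !fiber_rankE mulmxDr -PoszD; congr Posz.
have h x y : graded x -> P i *m x *m (P i *m y) = P i *m (x *m y).
  by move=> gx; rewrite gx mulmxA -(mulmxA x) fiber_projK -gx mulmxA.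
by apply: rank_orthogonal_idempotents; rewrite h ?ee ?ff ?ef ?fe ?mulmx0.
Qed.

Lemma fiber_rank_delta k : fiber_rank (delta_mx k k) = evec (g k).
Proof.
apply/rowP => i; rewrite fiber_rankE evecE.
have -> : P i *m delta_mx k k = (g k == i)%:R *: delta_mx k k.
  apply/matrixP => a c; rewrite mul_diag_mx !mxE.
  by case: (a =P k) => [->//|_]; rewrite !mulr0.
by rewrite (eq_sym i); case: (g k == i); rewrite ?scale1r ?scale0r ?mxrank_delta ?mxrank0.
Qed.

Variables (K : finType) (k1 k2 : K -> 'I_n).
Hypothesis kinj : forall a c, k1 a = k1 c -> k2 a = k2 c -> a = c.

(** For [src], [tgt] these are the families of matrices on the arrows; for [id], [id] they are the
    graded matrices ([gradedP]). Injectivity of the pair [k1], [k2], that is, absence of double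
    arrows, makes the sum of blocks direct. *)
Definition supported Y := Y = \sum_a P (k1 a) *m Y *m P (k2 a).
Definition block_space e f : {vspace mat} :=
  (\sum_a limg (sandwich (P (k1 a) *m e) (f *m P (k2 a))))%VS.

Lemma supportedD Y Y' : supported Y -> supported Y' -> supported (Y + Y').
Proof.
move=> h h'; rewrite /supported {1}h {1}h' -big_split; apply: eq_bigr => a _.
by rewrite mulmxDr mulmxDl.
Qed.

Lemma supported0 : supported 0.
Proof. by rewrite /supported big1 // => a _; rewrite mulmx0 mul0mx. Qed.

Let blockM a c (Y : mat) : P (k1 c) *m (P (k1 a) *m Y *m P (k2 a)) *m P (k2 c) =
  if a == c then P (k1 a) *m Y *m P (k2 a) else 0.
Proof.
rewrite !mulmxA fiber_projM -!mulmxA fiber_projM.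
have [->|ac] := eqVneq a c; first by rewrite !eqxx.
case: eqP => [h1|]; last by rewrite !mul0mx.
case: eqP => [h2|]; last by rewrite !mulmx0.
by move: ac; rewrite (kinj (esym h1) h2) eqxx.
Qed.

Lemma mem_block_space e f Y : graded e -> graded f -> e *m e = e -> f *m f = f ->
  reflect [/\ supported Y, e *m Y = Y & Y *m f = Y] (Y \in block_space e f).
Proof.
move=> ge gf ee ff; apply: (iffP memv_sumP) => [[Z hZ ->]|[sY eY Yf]].
  have h a : exists W, Z a = P (k1 a) *m (e *m W *m f) *m P (k2 a).
    have /memv_imgP[W _ ->] := hZ a isT.
    by exists W; rewrite sandwichE !mulmxA.
  split.
  - rewrite /supported; apply: eq_bigr => c _; rewrite mulmx_sumr mulmx_suml.
    rewrite (bigD1 c) //= big1 => [|a ac].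
      by have [W ->] := h c; rewrite blockM eqxx addr0.
    by have [W ->] := h a; rewrite blockM (negPf ac).
  - rewrite mulmx_sumr; apply: eq_bigr => a _; have [W ->] := h a.
    by rewrite !mulmxA -ge -(mulmxA (P _)) ee.
  - rewrite mulmx_suml; apply: eq_bigr => a _; have [W ->] := h a.
    by rewrite -!mulmxA gf (mulmxA f f) ff.
exists (fun a => P (k1 a) *m Y *m P (k2 a)) => [a _|]; last exact: sY.
have -> : P (k1 a) *m Y *m P (k2 a) = sandwich (P (k1 a) *m e) (f *m P (k2 a)) Y.
  by rewrite sandwichE -[in LHS]eY -[in LHS]Yf !mulmxA.
by rewrite memv_img ?memvf.
Qed.

Lemma dim_block_space e f : graded f ->
  \dim (block_space e f) = (\sum_a \rank (P (k1 a) *m e) * \rank (P (k2 a) *m f))%N.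
Proof.
move=> gf; rewrite (directvP _) /=.
  by apply: eq_bigr => a _; rewrite dim_sandwich gf.
apply/directv_sum_independent => Z hZ s0 c _.
have h a : exists W, Z a = P (k1 a) *m (e *m W *m f) *m P (k2 a).
  have /memv_imgP[W _ ->] := hZ a isT.
  by exists W; rewrite sandwichE !mulmxA.
have : P (k1 c) *m (\sum_a Z a) *m P (k2 c) = 0 by rewrite s0 mulmx0 mul0mx.
rewrite mulmx_sumr mulmx_suml (bigD1 c) //= big1 ?addr0 => [|a ac].
  by have [W ->] := h c; rewrite blockM eqxx.
by have [W ->] := h a; rewrite blockM (negPf ac).
Qed.
End Graded.

Lemma gradedP (F : fieldType) n N (g : 'I_N -> 'I_n) (y : 'M[F]_N) :
  graded g y <-> supported g id id y.
Proof.
split=> [gy|->].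
  rewrite /supported -[LHS]mul1mx -(sum_fiber_proj F g) mulmx_suml.
  by apply: eq_bigr => i _; rewrite -mulmxA -gy mulmxA fiber_projK.
move=> j; rewrite mulmx_sumr mulmx_suml; apply: eq_bigr => i _.
by rewrite !mulmxA fiber_projM -!mulmxA fiber_projM eq_sym; case: eqP => [->|] //;
  rewrite mul0mx !mulmx0.
Qed.

Definition word_sum m (V : zmodType) K (f : seq 'I_m -> V) : V :=
  \sum_(l < K) \sum_(t : l.-tuple 'I_m) f (val t).

Section WordSum.
Variables (m : nat) (V : zmodType).
Implicit Types (f : seq 'I_m -> V) (K : nat).

Lemma eq_word_sum K f f' : f =1 f' -> word_sum K f = word_sum K f'.
Proof. by move=> h; apply: eq_bigr => l _; apply: eq_bigr => t _. Qed.

Lemma word_sum0 K f : (forall s, (size s < K)%N -> f s = 0) -> word_sum K f = 0.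
Proof.
by move=> h; rewrite /word_sum big1 // => l _; rewrite big1 // => t _; rewrite h ?size_tuple.
Qed.

Lemma word_sumD K f f' : word_sum K (fun s => f s + f' s) = word_sum K f + word_sum K f'.
Proof. by rewrite /word_sum -big_split; apply: eq_bigr => l _; rewrite -big_split. Qed.

Lemma word_sum_morph (W : zmodType) (h : {additive V -> W}) K f :
  h (word_sum K f) = word_sum K (h \o f).
Proof. by rewrite raddf_sum; apply: eq_bigr => l _; rewrite raddf_sum. Qed.
End WordSum.

(** * Representations of the bound quiver and their deformations *)

Section Representations.
Variables (F : fieldType) (n m N R L : nat) (src tgt : 'I_m -> 'I_n) (g : 'I_N -> 'I_n).
Variables (rho : 'I_R -> seq 'I_m -> F) (rs re : 'I_R -> 'I_n).
Hypothesis nodouble : no_double_arrows src tgt.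
Hypothesis rho_walk : forall t s, rho t s != 0 ->
  [/\ is_walk src tgt (rs t) s, walk_end tgt (rs t) s = re t & (0 < size s)%N].
Local Notation mat := 'M[F]_N.
Local Notation P := (fiber_proj F g).
Local Notation graded := (graded g).
Local Notation fiber_rank := (fiber_rank g).
Local Notation C0 := (block_space g id id).
Local Notation C1 := (block_space g src tgt).
Implicit Types X Y y e f eta : mat.

(** A bilinear form whose quadratic form is the Tits form ([tits_formE]). On dimension vectors of
    idempotents it is the dimension of [C0], minus that of [C1], plus the number of equations
    imposed by the relations. *)
Definition euler_mx : 'M[int]_n := \matrix_(i, j)
  ((i == j)%:R - \sum_a ((src a == i) && (tgt a == j))%:R
   + \sum_t ((rs t == i) && (re t == j))%:R).

Lemma euler_mxE (x y : 'rV[int]_n) : euler euler_mx x y =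
  \sum_i x 0 i * y 0 i - \sum_a x 0 (src a) * y 0 (tgt a) + \sum_t x 0 (rs t) * y 0 (re t).
Proof.
have pt (i j : 'I_n) : \sum_k \sum_l x 0 k * ((i == k) && (j == l))%:R * y 0 l = x 0 i * y 0 j.
  rewrite (bigD1 i) //= [X in _ + X]big1 => [|k ki]; last first.
    by rewrite big1 // => l _; rewrite eq_sym (negPf ki) mulr0 mul0r.
  rewrite addr0 (bigD1 j) //= big1 => [|l lj]; last first.
    by rewrite (eq_sym j) (negPf lj) andbF mulr0 mul0r.
  by rewrite !eqxx mulr1 addr0.
transitivity (\sum_k \sum_l x 0 k * euler_mx k l * y 0 l).
  rewrite /euler mxE [RHS]exchange_big /=; apply: eq_bigr => l _.
  by rewrite [(x *m _) 0 l]mxE [y^T l 0]mxE mulr_suml.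
under eq_bigr => k _ do under eq_bigr => l _ do rewrite mxE mulrDr mulrDl mulrBr mulrBl.
under eq_bigr => k _ do rewrite big_split /= sumrB.
rewrite big_split /= sumrB; congr (_ - _ + _).
- apply: eq_bigr => k _; rewrite (bigD1 k) //= big1 ?eqxx ?mulr1 ?addr0 // => l lk.
  by rewrite eq_sym (negPf lk) mulr0 mul0r.
- under [RHS]eq_bigr => a _ do rewrite -pt.
  rewrite [RHS]exchange_big; apply: eq_bigr => k _.
  rewrite exchange_big; apply: eq_bigr => l _.
  by rewrite mulr_sumr mulr_suml.
- under [RHS]eq_bigr => a _ do rewrite -pt.
  rewrite [RHS]exchange_big; apply: eq_bigr => k _.
  rewrite exchange_big; apply: eq_bigr => l _.
  by rewrite mulr_sumr mulr_suml.
Qed.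

Fixpoint path_mx X i (s : seq 'I_m) : mat :=
  if s is a :: s' then if src a == i then P i *m X *m path_mx X (tgt a) s' else 0
  else P i.

(** The derivative of [path_mx] at [X], by the Leibniz rule, as a linear map of the direction. *)
Fixpoint dpath X i (s : seq 'I_m) : 'End(mat) :=
  if s is a :: s' then
    if src a == i then (sandwich (P i) (path_mx X (tgt a) s')
                        + (sandwich (P i *m X) 1%:M \o dpath X (tgt a) s'))%VF else 0
  else 0.

Lemma dpath_cons X i a s eta : dpath X i (a :: s) eta =
  if src a == i then P i *m (eta *m path_mx X (tgt a) s + X *m dpath X (tgt a) s eta) else 0.
Proof.
rewrite /=; case: ifP => _; last by rewrite lfunE.
by rewrite add_lfunE comp_lfunE !sandwichE mulmx1 mulmxDr !mulmxA.
Qed.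

Definition rel_eval X t : mat := word_sum L (fun s => rho t s *: path_mx X (rs t) s).
Definition drel X t : 'End(mat) := word_sum L (fun s => rho t s *: dpath X (rs t) s).

Lemma drelE X t eta : drel X t eta = word_sum L (fun s => rho t s *: dpath X (rs t) s eta).
Proof.
rewrite /drel /word_sum sum_lfunE; apply: eq_bigr => l _.
by rewrite sum_lfunE; apply: eq_bigr => s _; rewrite scale_lfunE.
Qed.

Lemma path_mx_comm X e i s : graded e -> e *m X = X *m e ->
  e *m path_mx X i s = path_mx X i s *m e.
Proof.
move=> ge eX; elim: s i => [|a s IH] i /=; first by rewrite ge.
case: ifP => _; last by rewrite mulmx0 mul0mx.
by rewrite !mulmxA -ge -!(mulmxA (P i)) eX -!mulmxA IH.
Qed.

Lemma path_mx_start X i s : P i *m path_mx X i s = path_mx X i s.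
Proof.
case: s => [|a s] /=; first exact: fiber_projK.
by case: ifP => _; rewrite ?mulmx0 // !mulmxA fiber_projK.
Qed.

Lemma path_mx_end X i s : path_mx X i s *m P (walk_end tgt i s) = path_mx X i s.
Proof.
elim: s i => [|a s IH] i /=; first exact: fiber_projK.
by case: ifP => _; rewrite ?mul0mx // -mulmxA IH.
Qed.

Lemma dpath_start X i s eta : P i *m dpath X i s eta = dpath X i s eta.
Proof.
case: s => [|a s]; first by rewrite /= lfunE mulmx0.
by rewrite dpath_cons; case: ifP => _; rewrite ?mulmx0 // mulmxA fiber_projK.
Qed.

Lemma dpath_end X i s eta : dpath X i s eta *m P (walk_end tgt i s) = dpath X i s eta.
Proof.
elim: s i => [|a s IH] i; first by rewrite /= lfunE mul0mx.
rewrite dpath_cons; case: ifP => _; rewrite ?mul0mx //=.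
by rewrite -mulmxA mulmxDl -!mulmxA IH path_mx_end.
Qed.

Section Deform.
Variables (X e f eta : mat).
Hypotheses (ge : graded e) (gf : graded f) (eX : e *m X = X *m e) (fX : f *m X = X *m f).
Hypotheses (e_eta : e *m eta = eta) (eta_f : eta *m f = eta).

Lemma dpath_left i s : e *m dpath X i s eta = dpath X i s eta.
Proof.
elim: s i => [|a s IH] i; first by rewrite /= lfunE mulmx0.
rewrite dpath_cons; case: ifP => _; rewrite ?mulmx0 //.
rewrite mulmxA -ge -mulmxA mulmxDr mulmxA e_eta (mulmxA e) eX -mulmxA IH.
by [].
Qed.

Lemma dpath_right i s : dpath X i s eta *m f = dpath X i s eta.
Proof.
elim: s i => [|a s IH] i; first by rewrite /= lfunE mul0mx.
rewrite dpath_cons; case: ifP => _; rewrite ?mul0mx //.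
by rewrite -mulmxA mulmxDl -!mulmxA IH -path_mx_comm // (mulmxA eta) eta_f.
Qed.

(** The terms beyond first order contain [eta *m dpath X _ _ eta], which is 0 because [eta] ends in
    [f], the derivative starts with [e], and [f *m e = 0]. *)
Lemma path_mx_deform i s : f *m e = 0 ->
  path_mx (X + eta) i s = path_mx X i s + dpath X i s eta.
Proof.
move=> fe; elim: s i => [|a s IH] i; first by rewrite /= lfunE addr0.
rewrite dpath_cons /=; case: ifP => _; last by rewrite addr0.
have h : eta *m dpath X (tgt a) s eta = 0.
  by rewrite -dpath_left -eta_f mulmxA -(mulmxA eta) fe mulmx0 mul0mx.
rewrite IH -!mulmxA -mulmxDr; congr (_ *m _).
by rewrite mulmxDr !mulmxDl h addr0 addrA.
Qed.

Lemma rel_eval_deform t : f *m e = 0 -> rel_eval (X + eta) t = rel_eval X t + drel X t eta.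
Proof.
move=> fe; rewrite drelE /rel_eval -word_sumD; apply: eq_word_sum => s.
by rewrite path_mx_deform // scalerDr.
Qed.

Lemma drel_mem t : drel X t eta \in limg (sandwich (P (rs t) *m e) (f *m P (re t))).
Proof.
rewrite drelE; suff -> : word_sum L (fun s => rho t s *: dpath X (rs t) s eta) =
    sandwich (P (rs t) *m e) (f *m P (re t)) (word_sum L (fun s => rho t s *: dpath X (rs t) s eta)).
  by rewrite memv_img ?memvf.
rewrite [RHS]word_sum_morph; apply: eq_word_sum => s /=; rewrite linearZ /=.
have [->|/rho_walk[_ we _]] := eqVneq (rho t s) 0; first by rewrite !scale0r.
rewrite sandwichE; congr (_ *: _).
by rewrite mulmxA -(mulmxA _ e) dpath_left dpath_start dpath_right -we dpath_end.
Qed.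
End Deform.

Lemma mem_C1 e f Y : graded e -> graded f -> e *m e = e -> f *m f = f ->
  reflect [/\ supported g src tgt Y, e *m Y = Y & Y *m f = Y] (Y \in C1 e f).
Proof. by apply: mem_block_space => a c; apply: nodouble. Qed.

Lemma mem_C0 e f Y : graded e -> graded f -> e *m e = e -> f *m f = f ->
  reflect [/\ graded Y, e *m Y = Y & Y *m f = Y] (Y \in C0 e f).
Proof.
move=> ge gf ee ff; apply: (iffP (mem_block_space _ _ ge gf ee ff)) => //.
  by case=> /gradedP.
by case=> /gradedP.
Qed.

Lemma dim_C0 e f : graded f ->
  (\dim (C0 e f))%:Z = \sum_i fiber_rank e 0 i * fiber_rank f 0 i.
Proof.
move=> gf; rewrite dim_block_space // (big_morph Posz PoszD (erefl _)); apply: eq_bigr => i _.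
by rewrite !fiber_rankE PoszM.
Qed.

Definition ad X : 'End(mat) := (sandwich 1%:M X - sandwich X 1%:M)%VF.
Lemma adE X y : ad X y = y *m X - X *m y.
Proof. by rewrite add_lfunE opp_lfunE !sandwichE mul1mx mulmx1. Qed.

(** When [e] and [f] are idempotent endomorphisms, these are the homomorphisms from the summand [e]
    to the summand [f], acting on row vectors from the right. *)
Definition homs e f X : {vspace mat} := (C0 e f :&: lker (ad X))%VS.

Lemma mem_homs e f X y : graded e -> graded f -> e *m e = e -> f *m f = f ->
  reflect [/\ graded y, e *m y = y, y *m f = y & y *m X = X *m y] (y \in homs e f X).
Proof.
move=> ge gf ee ff; rewrite memv_cap memv_ker adE subr_eq0.
by apply: (iffP andP) => [[/(mem_C0 _ ge gf ee ff)[h1 h2 h3] /eqP h4]|[h1 h2 h3 h4]];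
  split=> //; [apply/(mem_C0 _ ge gf ee ff) | apply/eqP].
Qed.

(** By [drel_mem], the relation [t] costs at most the product of the ranks of [e] at [rs t] and of
    [f] at [re t]; subtracting these from the dimension of [C1 e f] gives the bound. *)
Lemma exists_cocycles X e f : graded e -> graded f -> e *m e = e -> f *m f = f ->
  e *m X = X *m e -> f *m X = X *m f ->
  exists2 Z : {vspace mat},
    \sum_i fiber_rank e 0 i * fiber_rank f 0 i - euler euler_mx (fiber_rank e) (fiber_rank f)
      <= (\dim Z)%:Z &
    (Z <= C1 e f)%VS /\ forall eta, eta \in Z -> forall t, drel X t eta = 0.
Proof.
move=> ge gf ee ff eX fX.
have [Z hZ [ZC Zd]] := dim_common_ker (enum 'I_R) (drel X) (C1 e f).
have Zd' eta : eta \in Z -> forall t, drel X t eta = 0.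
  by move=> etaZ t; have /allP h := Zd _ etaZ; apply/eqP/h; rewrite mem_enum.
exists Z => //.
have hle t : (\dim (drel X t @: C1 e f) <=
    \rank (P (rs t) *m e) * \rank (P (re t) *m f))%N.
  rewrite (gf (re t)) -dim_sandwich; apply: dimvS; apply/subvP => _ /memv_imgP[eta hC ->].
  have [_ h1 h2] := mem_C1 _ ge gf ee ff hC.
  exact: drel_mem.
have {hZ} : (\dim (C1 e f) <= \dim Z + \sum_t \rank (P (rs t) *m e) * \rank (P (re t) *m f))%N.
  by apply: leq_trans hZ _; rewrite leq_add2l big_enum /= leq_sum.
have dC : \dim (C1 e f) = (\sum_a \rank (P (src a) *m e) * \rank (P (tgt a) *m f))%N.
  by apply: dim_block_space => // a c; apply: nodouble.
rewrite dC {dC}.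
rewrite euler_mxE -lez_nat PoszD !(big_morph Posz PoszD (erefl _)).
under eq_bigr => a _ do rewrite PoszM -!fiber_rankE.
under [X in _ <= _ + X]eq_bigr => t _ do rewrite PoszM -!fiber_rankE.
set s1 := \sum_i _; set s2 := \sum_i _; set s3 := \sum_i _ => h.
have -> : s3 - (s3 - s1 + s2) = s1 - s2 by ring.
by rewrite lerBlDr.
Qed.

Definition rep eps X := [/\ supported g src tgt X, eps *m X = X, X *m eps = X &
  forall t, rel_eval X t = 0].

Lemma rep_deform eps X e f eta : rep eps X -> graded e -> graded f -> e *m e = e ->
  f *m f = f -> f *m e = 0 -> e *m X = X *m e -> f *m X = X *m f ->
  eps *m e = e -> f *m eps = f -> eta \in C1 e f -> (forall t, drel X t eta = 0) ->
  rep eps (X + eta).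
Proof.
move=> [sX eX Xe evX] ge gf ee ff fe eX' fX' epse feps hC hd.
have [sE e_eta eta_f] := mem_C1 _ ge gf ee ff hC.
split; first exact: supportedD.
- by rewrite mulmxDr eX -e_eta mulmxA epse.
- by rewrite mulmxDl Xe -eta_f -mulmxA feps.
- by move=> t; rewrite (rel_eval_deform ge eX' e_eta eta_f) // evX hd addr0.
Qed.

Definition weighted_trace (theta : 'cV[F]_n) y : F := \tr (\sum_i theta i 0 *: (P i *m y)).

Definition adapted theta eps X := rep eps X /\
  forall y, y \in homs eps eps X -> weighted_trace theta y = 0.

Lemma weighted_traceE theta y : weighted_trace theta y = \sum_i theta i 0 * \tr (P i *m y).
Proof. by rewrite /weighted_trace raddf_sum; apply: eq_bigr => i _; rewrite /= mxtraceZ. Qed.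

Definition wtr (theta : 'cV[F]_n) : 'Hom(mat, F^o) :=
  linfun (mxtrace \o mulmx (\sum_i theta i 0 *: P i) : mat -> F^o).
Lemma wtrE theta y : wtr theta y = weighted_trace theta y.
Proof.
rewrite lfunE /= /weighted_trace mulmx_suml; congr mxtrace.
by apply: eq_bigr => i _; rewrite scalemxAl.
Qed.

Lemma weighted_traceD theta y Y : weighted_trace theta (y + Y) = weighted_trace theta y + weighted_trace theta Y.
Proof. by rewrite -!wtrE linearD. Qed.

Lemma weighted_trace_peirce theta e f y : graded f -> f *m e = 0 ->
  weighted_trace theta (e *m y *m f) = 0.
Proof.
move=> gf fe; rewrite weighted_traceE big1 // => i _.
by rewrite !mulmxA mxtrace_mulC !mulmxA -gf -(mulmxA _ f) fe mulmx0 mul0mx mxtrace0 mulr0.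
Qed.

Lemma rank_F_le1 (D : 'Hom(mat, F^o)) V : (\dim (D @: V) <= 1)%N.
Proof. by rewrite (leq_trans (dimvS (subvf _))) // dimvf. Qed.

(** * A deformation that lowers the number of endomorphisms *)

Section Step.
Variables (theta : 'cV[F]_n) (eps X e : mat).
Hypotheses (geps : graded eps) (epsK : eps *m eps = eps).
Hypotheses (KX : adapted theta eps X) (eE : e \in homs eps eps X) (ee : e *m e = e).
Variable f : mat.
Hypothesis fE : f = eps - e.
Local Notation wt := (weighted_trace theta).

Let e_facts : [/\ graded e, eps *m e = e, e *m eps = e & e *m X = X *m e].
Proof. exact/mem_homs. Qed.
Let ge : graded e. Proof. by case: e_facts. Qed.
Let epse : eps *m e = e. Proof. by case: e_facts. Qed.
Let eeps : e *m eps = e. Proof. by case: e_facts. Qed.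
Let eX : e *m X = X *m e. Proof. by case: e_facts. Qed.
Let gf : graded f. Proof. by rewrite fE; apply: gradedD => //; apply: gradedN. Qed.
Let fe : f *m e = 0. Proof. by rewrite fE mulmxBl epse ee subrr. Qed.
Let ef : e *m f = 0. Proof. by rewrite fE mulmxBr eeps ee subrr. Qed.
Let epsf : eps *m f = f. Proof. by rewrite fE mulmxBr epsK epse. Qed.
Let feps : f *m eps = f. Proof. by rewrite fE mulmxBl epsK eeps. Qed.
Let ff : f *m f = f. Proof. by rewrite {1}fE mulmxBl ef subr0 epsf. Qed.
Let fX : f *m X = X *m f.
Proof. by have [[_ h1 h2 _] _] := KX; rewrite fE mulmxBl mulmxBr h1 h2 eX. Qed.
Let ef_eps : e + f = eps. Proof. by rewrite fE addrC subrK. Qed.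

(** The inequality leaves room for a cocycle [eta] orthogonal under [Lam] to [homs f e X] but not a
    coboundary. Orthogonality preserves the trace condition; not being a coboundary makes
    endomorphisms disappear. *)
Lemma adapted_step :
  euler euler_mx (fiber_rank e) (fiber_rank f) < (\dim (homs e f X))%:Z - (\dim (homs f e X))%:Z ->
  exists2 X', adapted theta eps X' & (\dim (homs eps eps X') < \dim (homs eps eps X))%N.
Proof.
move=> lt0; have [rX tX] := KX.
have [|Lam LamE] := @functional_factor _ _ (ad X) (wtr theta) (C0 eps eps).
  move=> y yC /eqP ady; rewrite wtrE; apply: tX.
  by rewrite memv_cap yC memv_ker.
have {}LamE y : graded y -> eps *m y = y -> y *m eps = y -> Lam (y *m X - X *m y) = wt y.
  by move=> h1 h2 h3; rewrite -adE LamE ?wtrE //; apply/mem_C0.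
have [Z hZ [ZC Zd]] := exists_cocycles ge gf ee ff eX fX.
pose D (phi : mat) : 'Hom(mat, F^o) := (Lam \o (sandwich 1%:M phi - sandwich phi 1%:M))%VF.
have DE phi eta : D phi eta = Lam (eta *m phi - phi *m eta).
  by rewrite comp_lfunE add_lfunE opp_lfunE !sandwichE mul1mx mulmx1.
(* One linear condition on [eta] for each basis element [phi] of [homs f e X]. *)
have [U hU [UZ Ud]] := dim_common_ker (vbasis (homs f e X)) D Z.
have {}hU : (\dim Z <= \dim U + \dim (homs f e X))%N.
  apply: leq_trans hU _; rewrite leq_add2l.
  apply: (@leq_trans (\sum_(i <- vbasis (homs f e X)) 1)%N).
    by apply: leq_sum => i _; exact: rank_F_le1.
  by rewrite sum1_size size_tuple.
have dC0 : (\dim (homs e f X) + \dim (ad X @: C0 e f))%N = \dim (C0 e f).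
  exact: limg_ker_dim.
have dC0' := dim_C0 e gf.
(* The dimension of [U] is at least that of [C0 e f] minus the Euler form and minus that of
   [homs f e X]; coboundaries fill only the dimension of [C0 e f] minus that of [homs e f X]. *)
have : ~~ (U <= ad X @: C0 e f)%VS.
  apply/negP => /dimvS h; move: hZ lt0 hU h; rewrite -dC0' -dC0 PoszD.
  move: (\dim (homs e f X)) (\dim (homs f e X)) (\dim Z) (\dim U) (\dim _) (euler _ _ _).
  by move=> *; lia.
case/subvPn => eta etaU etaB.
have etaZ := subvP UZ _ etaU; have hd := Zd _ etaZ.
have etaC := subvP ZC _ etaZ; have [_ e_eta eta_f] := mem_C1 _ ge gf ee ff etaC.
have f_eta : f *m eta = 0 by rewrite -e_eta mulmxA fe mul0mx.
have eta_e : eta *m e = 0 by rewrite -eta_f -mulmxA fe mulmx0.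
have Lphi phi : phi \in homs f e X -> Lam (eta *m phi - phi *m eta) = 0.
  move=> hphi; rewrite (coord_vbasis hphi) mulmx_sumr mulmx_suml -sumrB linear_sum big1 // => i _.
  rewrite -scalemxAr -scalemxAl -scalerBr linearZ /= -DE.
  have bi : (vbasis (homs f e X))`_i \in vbasis (homs f e X).
    by apply: mem_nth; rewrite size_tuple.
  by have /eqP -> := allP (Ud _ etaU) _ bi; rewrite scaler0.
have rX' : rep eps (X + eta) by apply: rep_deform rX ge gf ee ff fe eX fX epse feps etaC hd.
have endo' y : y \in homs eps eps (X + eta) ->
    [/\ graded y, eps *m y = y, y *m eps = y & y *m X - X *m y = eta *m y - y *m eta].
  case/(mem_homs _ _ geps geps epsK epsK) => h1 h2 h3 h4; split=> //.
  apply/eqP; rewrite subr_eq addrAC eq_sym subr_eq addrC; move: h4.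
  by rewrite mulmxDr mulmxDl addrC => /eqP; rewrite eq_sym [X in _ == X]addrC.
have comm (a c y : mat) : y \in homs eps eps (X + eta) -> a *m X = X *m a -> c *m X = X *m c ->
    a *m y *m c *m X - X *m (a *m y *m c) = a *m (eta *m y) *m c - a *m (y *m eta) *m c.
  case/endo' => _ _ _ h aX cX.
  rewrite -mulmxBl -mulmxBr -h mulmxBr mulmxBl -[a *m y *m c *m X]mulmxA cX.
  by rewrite !mulmxA aX.
have comm_fe y : y \in homs eps eps (X + eta) ->
    f *m y *m e *m X = X *m (f *m y *m e).
  move=> hy; apply/eqP; rewrite -subr_eq0 comm //.
  by rewrite !mulmxA f_eta !mul0mx -!mulmxA eta_e !mulmx0 subr0.
have comm_ef y : y \in homs eps eps (X + eta) ->
    e *m y *m f *m X - X *m (e *m y *m f) = eta *m y *m f - e *m y *m eta.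
  by move=> hy; rewrite comm // !mulmxA e_eta -!mulmxA eta_f.
have eta_y y : y \in homs eps eps (X + eta) -> eta *m y = eta *m (f *m y *m e) + eta *m y *m f.
  case/endo' => _ _ yeps _; rewrite -{1}yeps -{1}ef_eps !mulmxDr !mulmxA.
  by rewrite eta_f.
have y_eta y : y \in homs eps eps (X + eta) -> y *m eta = f *m y *m e *m eta + e *m y *m eta.
  case/endo' => _ epsy _ _; rewrite -{1}epsy -{1}ef_eps !mulmxDl addrC.
  by rewrite -[f *m y *m e *m eta]mulmxA e_eta.
have homs_fe y : y \in homs eps eps (X + eta) -> f *m y *m e \in homs f e X.
  move=> hy; have [gy _ _ _] := endo' y hy; apply/mem_homs => //; split.
  - by apply: graded_mul => //; apply: graded_mul.
  - by rewrite !mulmxA ff.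
  - by rewrite -!mulmxA ee.
  - exact: comm_fe.
(* For an endomorphism [y] of [X + eta], the commutator [y X - X y] is that of [eta] with [f y e],
   killed by [Lam], plus the coboundary of [e y f], on which [Lam] is an off-diagonal trace, hence
   0. *)
exists (X + eta).
  split=> // y hy; have [gy epsy yeps h4] := endo' y hy.
  rewrite -LamE // h4 (eta_y y hy) (y_eta y hy) opprD addrACA -(comm_ef y hy).
  rewrite linearD /= Lphi ?homs_fe // add0r LamE ?weighted_trace_peirce //.
  - by apply: graded_mul => //; apply: graded_mul.
  - by rewrite !mulmxA epse.
  - by rewrite -!mulmxA feps.
(* [H'] is filtered by Peirce components: first the [f, e] component, then the diagonal one where
   the first vanishes, then the [e, f] one. The three pieces [V1], [V2], [K2] lie in [H] and are
   independent. *)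
set H' := homs eps eps (X + eta); set H := homs eps eps X.
pose p1 := sandwich f e; pose p2 := (sandwich e e + sandwich f f)%VF.
have p2E y : p2 y = e *m y *m e + f *m y *m f by rewrite add_lfunE !sandwichE.
pose K1 := (H' :&: lker p1)%VS; pose V1 := (p1 @: H')%VS.
pose V2 := (p2 @: K1)%VS; pose K2 := (K1 :&: lker p2)%VS.
have K1P y : y \in K1 -> y \in H' /\ f *m y *m e = 0.
  by rewrite memv_cap memv_ker sandwichE => /andP[-> /eqP].
have peirce y : eps *m y = y -> y *m eps = y ->
    y = e *m y *m e + f *m y *m f + (e *m y *m f + f *m y *m e).
  by move=> h1 h2; rewrite addrACA -!mulmxDr (addrC f e) ef_eps -!mulmxDl ef_eps h1 h2.
have dimH' : \dim H' = (\dim V1 + \dim V2 + \dim K2)%N.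
  have d1 : (\dim K1 + \dim V1)%N = \dim H' by exact: limg_ker_dim.
  have d2 : (\dim K2 + \dim V2)%N = \dim K1 by exact: limg_ker_dim.
  by rewrite -d1 -d2 addnC (addnC (\dim K2)) addnA.
have V1P u : u \in V1 -> u \in H /\ u = f *m u *m e.
  case/memv_imgP=> y hy ->; rewrite sandwichE; have [gy _ _ _] := endo' y hy.
  split; last by rewrite !mulmxA ff -!mulmxA ee.
  apply/mem_homs => //; split; last exact: comm_fe.
  - by apply: graded_mul => //; apply: graded_mul.
  - by rewrite !mulmxA epsf.
  - by rewrite -!mulmxA eeps.
have K1comm a y : y \in K1 -> a = e \/ a = f -> a *m y *m a *m X = X *m (a *m y *m a).
  move=> /K1P[hy fye] ha; apply/eqP; rewrite -subr_eq0 comm //; try by case: ha => ->.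
  case: ha => ->.
    rewrite !mulmxA e_eta -[e *m y *m eta *m e]mulmxA eta_e mulmx0 subr0.
    by rewrite eta_y // fye mulmx0 add0r -(mulmxA _ f) fe mulmx0.
  rewrite !mulmxA f_eta !mul0mx -[f *m y *m eta *m f]mulmxA eta_f sub0r -(mulmxA f y).
  by rewrite y_eta // fye mul0mx add0r !mulmxA fe !mul0mx oppr0.
have pe (y a c : mat) : a *m (e *m y *m e + f *m y *m f) *m c =
    a *m e *m y *m (e *m c) + a *m f *m y *m (f *m c).
  by rewrite mulmxDr mulmxDl !mulmxA.
have V2P u : u \in V2 -> u \in H /\ u = e *m u *m e + f *m u *m f.
  case/memv_imgP=> y hy ->; rewrite p2E; have [/endo'[gy _ _ _] _] := K1P y hy.
  split; last by rewrite !pe ee ff ef fe !mulmx0 addr0 add0r.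
  apply/mem_homs => //; split.
  - by apply: gradedD; apply: graded_mul => //; apply: graded_mul.
  - by rewrite mulmxDr !mulmxA epse epsf.
  - by rewrite mulmxDl -!mulmxA eeps feps.
  - by rewrite mulmxDl mulmxDr !K1comm //; [right | left].
have K2P u : u \in K2 -> u \in H /\ u = e *m u *m f.
  rewrite memv_cap memv_ker => /andP[/K1P[hu fue] /eqP p2u].
  have [gu epsu ueps h4] := endo' u hu.
  have uE : u = e *m u *m f by rewrite {1}(peirce u epsu ueps) -p2E p2u add0r fue addr0.
  split=> //; apply/mem_homs => //; split=> //; apply/eqP; rewrite -subr_eq0 h4 uE.
  by rewrite !mulmxA eta_e !mul0mx sub0r -!mulmxA f_eta !mulmx0 oppr0.
have cap0 (V W : {vspace mat}) : (forall u, u \in V -> u \in W -> u = 0) -> (V :&: W = 0)%VS.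
  move=> h; apply/eqP; rewrite -subv0; apply/subvP => u; rewrite memv_cap => /andP[uV uW].
  by rewrite (h u) ?mem0v.
have dimS : \dim (V1 + V2 + K2) = (\dim V1 + \dim V2 + \dim K2)%N.
  rewrite dimv_disjoint_sum ?dimv_disjoint_sum //; apply: cap0 => u.
    move=> /V1P[_ h1] /V2P[_ ->]; rewrite h1 !mulmxA ef -!mulmxA ef.
    by rewrite !mul0mx !mulmx0 addr0.
  case/memv_addP => a /V1P[_ aE] [c /V2P[_ cE] ->] /K2P[_ ->].
  by rewrite mulmxDr mulmxDl aE cE pe ef !mulmxA ef !mul0mx !mulmx0 !addr0.
(* Equal dimensions would place [e] in [V2]: some [y] in [H'] has [f y e = 0], [e y e = e] and
   [f y f = 0], and then [eta] is the coboundary of [- e y f]. *)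
rewrite dimH' -dimS ltnNge; apply/negP => leH.
have : (V1 + V2 + K2 == H)%VS.
  rewrite eqEdim leH andbT !subv_add; apply/andP; split; last by apply/subvP => u /K2P[].
  by apply/andP; split; apply/subvP => u; [case/V1P | case/V2P].
move=> /eqP SH; move: eE; rewrite -/H -SH => /memv_addP[ac /memv_addP[a a1 [c c2 ->]] [k kK2 eE']].
have cE : c = e.
  have [[[_ aE] [_ cE]] [_ kE]] := (V1P a a1, V2P c c2, K2P k kK2).
  have p2a : p2 a = 0.
    rewrite p2E aE !mulmxA ef !mul0mx add0r -(mulmxA _ e f) ef mulmx0.
    by [].
  have p2k : p2 k = 0.
    by rewrite p2E kE !mulmxA fe !mul0mx addr0 -(mulmxA _ f e) fe mulmx0.
  have := congr1 p2 eE'; rewrite !linearD /= p2a p2k add0r addr0 !p2E -cE => <-.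
  by rewrite !ee fe mul0mx addr0.
move: c2; rewrite cE => /memv_imgP[y hy]; rewrite p2E => ey.
have [hyH fye] := K1P y hy; have [gy _ _ _] := endo' y hyH.
have eye : e *m y *m e = e.
  have := pe y e e; rewrite -ey !ee ef fe !mulmx0 addr0 => <-.
  by [].
have fyf : f *m y *m f = 0 by move: ey; rewrite eye => /eqP; rewrite -subr_eq0 opprD addNKr oppr_eq0 => /eqP.
case/negP: etaB; apply/memv_imgP; exists (- (e *m y *m f)).
  rewrite rpredN; apply/mem_C0 => //; split.
  - by apply: graded_mul => //; apply: graded_mul.
  - by rewrite !mulmxA ee.
  - by rewrite -!mulmxA ff.
have h1 : eta *m y *m f = 0 by rewrite -eta_f -!mulmxA (mulmxA f) fyf mulmx0.
have h2 : e *m y *m eta = eta by rewrite -{1}e_eta mulmxA eye e_eta.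
by rewrite linearN /= adE comm_ef // h1 h2 sub0r opprK.
Qed.
End Step.

(** At the minimum [adapted_step] fails for [e, f] and for [f, e]. The two lower bounds for the
    Euler form that result are opposite numbers, so the sum is nonnegative. *)
Lemma adapted_generic theta eps X : graded eps -> eps *m eps = eps -> adapted theta eps X ->
  exists2 X', adapted theta eps X' & forall e, e \in homs eps eps X' -> e *m e = e ->
    0 <= bform euler_mx (fiber_rank e) (fiber_rank (eps - e)).
Proof.
move=> geps epsK; have [k] := ubnP (\dim (homs eps eps X)); elim: k X => // k IH X.
rewrite ltnS => dk KX; have [[X' KX' lt]|nex] := classic (exists2 X', adapted theta eps X' &
    (\dim (homs eps eps X') < \dim (homs eps eps X))%N).
  by apply: (IH X') => //; apply: leq_trans lt dk.
exists X => // e eE ee; rewrite leNgt; apply/negP; set f := eps - e => lt0.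
have [ge epse eeps eX] := mem_homs _ _ geps geps epsK epsK eE.
have [_ h1 h2 _] := KX.1.
have fH : f \in homs eps eps X.
  apply/mem_homs => //; split.
  - by apply: gradedD => //; apply: gradedN.
  - by rewrite mulmxBr epsK epse.
  - by rewrite mulmxBl epsK eeps.
  - by rewrite mulmxBl mulmxBr h1 h2 eX.
have ff : f *m f = f by rewrite mulmxBl !mulmxBr epsK epse eeps ee subrr subr0.
have [lt1|] := ltrP (euler euler_mx (fiber_rank e) (fiber_rank f))
    ((\dim (homs e f X))%:Z - (\dim (homs f e X))%:Z).
  by case: nex; exact: (adapted_step geps epsK KX eE ee erefl lt1).
have [lt2|] := ltrP (euler euler_mx (fiber_rank f) (fiber_rank e))
    ((\dim (homs f e X))%:Z - (\dim (homs e f X))%:Z).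
  have ef : e = eps - f by rewrite opprB addrC subrK.
  by case: nex; exact: (adapted_step geps epsK KX fH ff ef lt2).
by move: lt0; rewrite /bform; lia.
Qed.

Lemma path_mx_cut X e i s : graded e -> e *m e = e -> e *m X = X *m e ->
  path_mx X i s *m e = path_mx (X *m e) i s *m e.
Proof.
move=> ge ee eX; elim: s i => [|a s IH] i //=; case: ifP => // _.
rewrite -!mulmxA IH; congr (_ *m (_ *m _)).
have eXe : e *m (X *m e) = X *m e *m e by rewrite mulmxA eX -!mulmxA.
by rewrite mulmxA (path_mx_comm _ _ ge eXe) -mulmxA ee.
Qed.

(** Relations contain no trivial path; that one evaluates to [P i] and would not be absorbed by
    [eps]. *)
Lemma rel_eval_cut X eps t : graded eps -> eps *m X = X -> X *m eps = X ->
  rel_eval X t = rel_eval X t *m eps.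
Proof.
move=> geps h1 h2; rewrite [RHS](word_sum_morph (mulmxr eps)) /=; apply: eq_word_sum => s /=.
have [->|/rho_walk[_ _]] := eqVneq (rho t s) 0; first by rewrite !scale0r mul0mx.
case: s => // a s _; rewrite -scalemxAl; congr (_ *: _) => /=.
case: ifP => _; last by rewrite mul0mx.
by rewrite -{1}h2 -!mulmxA path_mx_comm ?h1.
Qed.

Lemma rel_eval_split X e t : graded e -> e *m e = e -> e *m X = X *m e ->
  rel_eval X t *m e = rel_eval (X *m e) t *m e.
Proof.
move=> ge ee eX; rewrite [LHS](word_sum_morph (mulmxr e)) [RHS](word_sum_morph (mulmxr e)); apply: eq_word_sum => s /=.
by rewrite -!scalemxAl path_mx_cut.
Qed.

Lemma rep0 eps : rep eps 0.
Proof.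
split; rewrite ?mulmx0 ?mul0mx //; first exact: supported0.
move=> t; rewrite /rel_eval (@eq_word_sum _ _ L _ (fun=> 0)) => [|s]; first exact: word_sum0.
have [->|/rho_walk[_ _]] := eqVneq (rho t s) 0; first by rewrite scale0r.
by case: s => // a s _ /=; case: ifP => _; rewrite ?mulmx0 ?mul0mx scaler0.
Qed.

Section Orthogonal.
Variables (e1 e2 X1 X2 : mat).
Hypotheses (g1 : graded e1) (g2 : graded e2) (e11 : e1 *m e1 = e1) (e22 : e2 *m e2 = e2).
Hypotheses (e12 : e1 *m e2 = 0) (e21 : e2 *m e1 = 0).
Hypotheses (r1 : rep e1 X1) (r2 : rep e2 X2).

Lemma graded_orth : graded (e1 + e2) /\ (e1 + e2) *m (e1 + e2) = e1 + e2.
Proof.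
split; first exact: gradedD.
by rewrite mulmxDl !mulmxDr e11 e12 e21 e22 addr0 add0r.
Qed.

Lemma orth_mul : [/\ e1 *m X2 = 0, X2 *m e1 = 0, e2 *m X1 = 0 & X1 *m e2 = 0].
Proof.
have [[_ h1 h2 _] [_ h3 h4 _]] := (r1, r2); split.
- by rewrite -h3 mulmxA e12 mul0mx.
- by rewrite -h4 -mulmxA e21 mulmx0.
- by rewrite -h1 mulmxA e21 mul0mx.
- by rewrite -h2 -mulmxA e12 mulmx0.
Qed.

Lemma rep_sum : rep (e1 + e2) (X1 + X2).
Proof.
have [[s1 h1 h2 v1] [s2 h3 h4 v2]] := (r1, r2); have [z1 z2 z3 z4] := orth_mul.
have hl : (e1 + e2) *m (X1 + X2) = X1 + X2.
  by rewrite mulmxDl !mulmxDr h1 h3 z1 z3 addr0 add0r.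
have hr : (X1 + X2) *m (e1 + e2) = X1 + X2.
  by rewrite mulmxDl !mulmxDr h2 h4 z2 z4 addr0 add0r.
have [ge _] := graded_orth.
split=> //; first exact: supportedD.
have c1 : e1 *m (X1 + X2) = (X1 + X2) *m e1 by rewrite mulmxDl mulmxDr h1 h2 z1 z2.
have c2 : e2 *m (X1 + X2) = (X1 + X2) *m e2 by rewrite mulmxDl mulmxDr h3 h4 z3 z4.
move=> t; rewrite (rel_eval_cut t ge hl hr) mulmxDr.
rewrite (rel_eval_split t g1 e11 c1) (rel_eval_split t g2 e22 c2).
by rewrite !mulmxDl h2 z2 z4 h4 addr0 add0r v1 v2 !mul0mx addr0.
Qed.

Lemma homs_diag1 t : t \in homs (e1 + e2) (e1 + e2) (X1 + X2) -> e1 *m t *m e1 \in homs e1 e1 X1.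
Proof.
have [[_ h1 h2 _] [_ h3 h4 _]] := (r1, r2); have [z1 z2 z3 z4] := orth_mul.
have [ge gg] := graded_orth.
case/(mem_homs _ _ ge ge gg gg) => gt _ _ tX; apply/mem_homs => //; split.
- by apply: graded_mul => //; apply: graded_mul.
- by rewrite !mulmxA e11.
- by rewrite -!mulmxA e11.
- have lhs : e1 *m (t *m (X1 + X2)) *m e1 = e1 *m t *m X1.
    by rewrite !mulmxDr mulmxDl -!mulmxA z2 h2 !mulmx0 addr0.
  have rhs : e1 *m ((X1 + X2) *m t) *m e1 = X1 *m t *m e1.
    by rewrite mulmxDl mulmxDr mulmxDl !mulmxA z1 h1 !mul0mx addr0.
  by rewrite -[e1 *m t *m e1 *m X1]mulmxA h1 -lhs tX rhs !mulmxA h2.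
Qed.
End Orthogonal.

Lemma adapted_sum theta e1 e2 X1 X2 : graded e1 -> graded e2 -> e1 *m e1 = e1 ->
  e2 *m e2 = e2 -> e1 *m e2 = 0 -> e2 *m e1 = 0 -> adapted theta e1 X1 ->
  adapted theta e2 X2 -> adapted theta (e1 + e2) (X1 + X2).
Proof.
move=> g1 g2 e11 e22 e12 e21 [r1 t1] [r2 t2]; split; first exact: rep_sum.
have [ge gg] := graded_orth g1 g2 e11 e22 e12 e21.
move=> t tH; have [gt et te _] := mem_homs _ _ ge ge gg gg tH.
have -> : t = e1 *m t *m e1 + e2 *m t *m e2 + (e1 *m t *m e2 + e2 *m t *m e1).
  by rewrite addrACA -!mulmxDr (addrC e2 e1) -!mulmxDl et te.
rewrite !weighted_traceD t1 ?(homs_diag1 _ _ _ _ _ _ r1 r2) //.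
rewrite t2 ?weighted_trace_peirce ?addr0 //.
by apply: (homs_diag1 _ _ _ _ _ _ r2 r1); rewrite // addrC (addrC X2).
Qed.

(* Over [F] algebraically closed this says that the endomorphism ring is local. *)
Definition local_rep eps X := forall t, t \in homs eps eps X ->
  exists lam k, iter k (mulmx (t - lam *: eps)) eps = 0.

(** * Gluing a simple to a local representation *)

Section Glue.
Variables (k0 : 'I_N) (e2 X : mat).
Local Notation e1 := (delta_mx k0 k0 : mat).
Hypotheses (g2 : graded e2) (e22 : e2 *m e2 = e2) (e12 : e1 *m e2 = 0) (e21 : e2 *m e1 = 0).
Hypotheses (rX : rep e2 X) (lX : local_rep e2 X) (r0 : fiber_rank e2 0 (g k0) = 0).
Hypothesis neg : bform euler_mx (fiber_rank e1) (fiber_rank e2) < 0.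

Lemma delta_graded k : graded (delta_mx k k : mat).
Proof.
move=> i; apply/matrixP => a c; rewrite mul_diag_mx mul_mx_diag !mxE.
by case: (a =P k) => [->|_]; case: (c =P k) => [->|_]; rewrite ?mulr0 ?mul0r ?mulr1 ?mul1r.
Qed.

Lemma delta_idem k : delta_mx k k *m delta_mx k k = delta_mx k k :> mat.
Proof. by rewrite mul_delta_mx. Qed.

Lemma delta_sandwich k t : exists lam, delta_mx k k *m t *m delta_mx k k = lam *: delta_mx k k :> mat.
Proof.
exists (t k k); rewrite -[delta_mx k k in LHS](mul_delta_mx (0 : 'I_1)).
rewrite -!mulmxA (mulmxA (delta_mx 0 k)) (mulmxA (_ *m t)).
have -> : delta_mx (0 : 'I_1) k *m t *m delta_mx k (0 : 'I_1) = (t k k)%:M.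
  by rewrite -rowE -colE; apply/matrixP => a c; rewrite !ord1 !mxE.
by rewrite mul_scalar_mx -scalemxAr mul_delta_mx.
Qed.

Let g1 := delta_graded k0.
Let e11 := delta_idem k0.

Let e1X : e1 *m X = 0.
Proof. by have [_ <- _ _] := rX; rewrite mulmxA e12 mul0mx. Qed.
Let Xe1 : X *m e1 = 0.
Proof. by have [_ _ <- _] := rX; rewrite -mulmxA e21 mulmx0. Qed.
Let e2X : e2 *m X = X. Proof. by case: rX. Qed.
Let Xe2 : X *m e2 = X. Proof. by case: rX. Qed.

Let Pe2 : P (g k0) *m e2 = 0.
Proof. by apply/eqP; rewrite -mxrank_eq0; move: r0; rewrite fiber_rankE => -[->]. Qed.
Let e1P : e1 *m P (g k0) = e1.
Proof.
apply/matrixP => a c; rewrite mul_mx_diag !mxE.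
by case: (c =P k0) => [->|_]; rewrite ?eqxx ?mulr1 // andbF mul0r.
Qed.
Let off12 t : graded t -> e1 *m t *m e2 = 0.
Proof. by move=> gt; rewrite -e1P -!mulmxA (mulmxA _ t) gt -mulmxA Pe2 !mulmx0. Qed.
Let off21 t : graded t -> e2 *m t *m e1 = 0.
Proof.
move=> gt; have Pe1 : P (g k0) *m e1 = e1 by rewrite g1 e1P.
by rewrite -Pe1 !mulmxA -(mulmxA e2) -gt mulmxA -g2 Pe2 !mul0mx.
Qed.

Let orient : exists e f, [/\ (e = e1 /\ f = e2) \/ (e = e2 /\ f = e1) &
  euler euler_mx (fiber_rank e) (fiber_rank f) < 0].
Proof.
have [lt|ge] := ltrP (euler euler_mx (fiber_rank e1) (fiber_rank e2)) 0.
  by exists e1, e2; split=> //; left.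
by exists e2, e1; split; [right | move: neg; rewrite /bform; lia].
Qed.

(** One of the two Euler forms is negative, and [C0] vanishes because the supports are disjoint, so
    a nonzero cocycle [eta] exists. An endomorphism of the extension is [lam e1 + t2] with [t2]
    equal to [mu e2] plus a nilpotent; commuting with [eta] gives [(lam - mu)^k eta = 0], so
    [lam = mu]. *)
Lemma local_glue : exists2 X', rep (e1 + e2) X' & local_rep (e1 + e2) X'.
Proof.
have [gs ss] := graded_orth g1 g2 e11 e22 e12 e21.
have rXs : rep (e1 + e2) X by rewrite -[X]add0r; apply: rep_sum => //; exact: rep0.
have [e [f [hef lt0]]] := orient.
have [ge gf ee ff] : [/\ graded e, graded f, e *m e = e & f *m f = f].
  by case: hef => -[-> ->]; split.
have fe : f *m e = 0 by case: hef => -[-> ->].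
have ef : e *m f = 0 by case: hef => -[-> ->].
have eX : e *m X = X *m e by case: hef => -[-> _]; rewrite ?e1X ?Xe1 ?e2X ?Xe2.
have fX : f *m X = X *m f by case: hef => -[_ ->]; rewrite ?e1X ?Xe1 ?e2X ?Xe2.
have [Z hZ [ZC Zd]] := exists_cocycles ge gf ee ff eX fX.
have {hZ} Z0 : (0 < \dim Z)%N.
  move: hZ; rewrite big1 => [|i _]; first by move: lt0; lia.
  have h12 : fiber_rank e1 0 i * fiber_rank e2 0 i = 0.
    rewrite fiber_rank_delta evecE; case: eqP => [->|_]; last by rewrite mul0r.
    by rewrite r0 mulr0.
  by case: hef => -[-> ->]; rewrite // mulrC.
have etaZ := memv_pick Z; set eta := vpick Z in etaZ.
have eta0 : eta != 0 by rewrite vpick0 -dimv_eq0 -lt0n.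
have etaC := subvP ZC _ etaZ; have [_ e_eta eta_f] := mem_C1 _ ge gf ee ff etaC.
have f_eta : f *m eta = 0 by rewrite -e_eta mulmxA fe mul0mx.
have eta_e : eta *m e = 0 by rewrite -eta_f -mulmxA fe mulmx0.
have ses : (e1 + e2) *m e = e by case: hef => -[-> _]; rewrite mulmxDl ?e11 ?e12 ?e21 ?e22 ?addr0 ?add0r.
have sfs : f *m (e1 + e2) = f by case: hef => -[_ ->]; rewrite mulmxDr ?e11 ?e12 ?e21 ?e22 ?addr0 ?add0r.
exists (X + eta).
  by apply: (rep_deform rXs ge gf ee ff fe eX fX ses sfs etaC); exact: Zd.
move=> t /(mem_homs _ _ gs gs ss ss)[gt st ts tX].
have [lam lamE] := delta_sandwich k0 t.
pose t2 := e2 *m t *m e2.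
have tE : t = lam *: e1 + t2.
  rewrite -[LHS]ts -{1}st !mulmxDl !mulmxDr -?mulmxA -/t2.
  by rewrite !mulmxA lamE off12 // off21 // add0r addr0.
have [e1t2 t2e1] : e1 *m t2 = 0 /\ t2 *m e1 = 0.
  by rewrite /t2 -!mulmxA e21 !mulmx0 mulmxA e12 mul0mx.
have [e2t2 t2e2] : e2 *m t2 = t2 /\ t2 *m e2 = t2.
  by rewrite /t2 -!mulmxA e22 !mulmxA e22.
have gt2 : graded t2 by apply: graded_mul => //; apply: graded_mul.
clearbody t2.
have e1t : e1 *m t = lam *: e1 by rewrite tE mulmxDr -scalemxAr e11 e1t2 addr0.
have te1 : t *m e1 = lam *: e1 by rewrite tE mulmxDl -scalemxAl e11 t2e1 addr0.
have e2t : e2 *m t = t2 by rewrite tE mulmxDr -scalemxAr e21 scaler0 add0r.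
have te2 : t *m e2 = t2 by rewrite tE mulmxDl -scalemxAl e12 scaler0 add0r.
have ge1 : e2 *m (eta *m e2) = 0.
  by case: hef => -[h1 h2]; rewrite -?h1 -?h2 ?eta_e ?mulmx0 // mulmxA f_eta mul0mx.
have t2H : t2 \in homs e2 e2 X.
  apply/mem_homs => //; split=> //.
  have lhs : e2 *m (t *m (X + eta)) *m e2 = t2 *m X + t2 *m (e2 *m (eta *m e2)).
    by rewrite (mulmxA e2 t) e2t mulmxDr mulmxDl -!mulmxA Xe2 (mulmxA t2 e2) t2e2.
  have rhs : e2 *m ((X + eta) *m t) *m e2 = X *m t2 + e2 *m (eta *m e2) *m t2.
    by rewrite -!mulmxA te2 mulmxDl mulmxDr (mulmxA e2 X) e2X (mulmxA eta e2) -(mulmxA eta e2) e2t2.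
  by move: lhs; rewrite tX rhs ge1 mulmx0 !mul0mx !addr0.
have [mu [k nil]] := lX t2H; set s2 := t2 - mu *: e2 in nil.
have lm : lam = mu.
  suff : (lam - mu) ^+ k *: eta = 0.
    move/eqP; rewrite scaler_eq0 (negPf eta0) orbF expf_eq0 => /andP[_].
    by rewrite subr_eq0 => /eqP.
  have hef2 : e *m t *m (X + eta) *m f = e *m (X + eta) *m (t *m f).
    by rewrite -!mulmxA (mulmxA t) tX !mulmxA.
  case: hef => -[eE fE]; rewrite eE fE in e_eta eta_f hef2 f_eta eta_e.
    have h0 : lam *: eta = eta *m t2.
      move: hef2; rewrite e1t te2 -!scalemxAl !mulmxDr mulmxDl e1X mul0mx !add0r.
      by rewrite e_eta eta_f.
    have h : eta *m s2 = (lam - mu) *: eta.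
      by rewrite /s2 mulmxBr -scalemxAr eta_f scalerBl h0.
    have it j : eta *m iter j (mulmx s2) e2 = (lam - mu) ^+ j *: eta.
      elim: j => [|j IH] /=; first by rewrite eta_f scale1r.
      by rewrite mulmxA h -scalemxAl IH scalerA exprS.
    by rewrite -it nil mulmx0.
  have h0 : lam *: eta = t2 *m eta.
    move: hef2; rewrite e2t te1 -!scalemxAr !mulmxDr !mulmxDl -!mulmxA Xe1 !mulmx0 !add0r.
    by rewrite eta_f e_eta.
  have h : s2 *m eta = (lam - mu) *: eta.
    by rewrite /s2 mulmxBl -scalemxAl e_eta scalerBl h0.
  have it j : iter j (mulmx s2) e2 *m eta = (lam - mu) ^+ j *: eta.
    elim: j => [|j IH] /=; first by rewrite e_eta scale1r.
    by rewrite -mulmxA IH -scalemxAr h scalerA exprSr.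
  by rewrite -it nil mul0mx.
(* The extra step kills [e1], on which [s2] is 0. *)
exists lam, k.+1; have -> : t - lam *: (e1 + e2) = s2.
  by rewrite tE scalerDr opprD addrACA subrr add0r lm.
have s2e1 : s2 *m e1 = 0.
  by rewrite /s2 mulmxBl -scalemxAl e21 t2e1 scaler0 subr0.
have it j : iter j (mulmx s2) (e1 + e2) = iter j (mulmx s2) e1 + iter j (mulmx s2) e2.
  by elim: j => [|j IH] //=; rewrite IH mulmxDr.
rewrite it [iter k.+1 _ e2]/= nil mulmx0 addr0 iterSr s2e1.
by elim: (k) => //= j ->; rewrite mulmx0.
Qed.
End Glue.
End Representations.

(** * Existence of an indecomposable representation *)

Section Avoidance.
Variable F : closedFieldType.

Lemma exists_notin (s : seq F) : exists c, c \notin s.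
Proof.
(* Its value on [s] is 1; the additional factor keeps the degree positive when [s] is empty. *)
pose p := \prod_(a <- s) ('X - a%:P) * 'X + 1%:P.
have /closed_rootP[c rc] : size p != 1%N.
  by rewrite size_MXaddC oner_eq0 andbF /= size_prod_XsubC.
exists c; apply/negP => cs; move: rc; rewrite /root hornerD hornerM hornerC.
have -> : (\prod_(a <- s) ('X - a%:P)).[c] = 0 by apply/eqP; rewrite -/(root _ _) root_prod_XsubC.
by rewrite mul0r add0r oner_eq0.
Qed.

(** On the line [th + c ph] each vector excludes at most one value of [c], and an algebraically
    closed field has a value outside any finite list. *)
Lemma exists_nonvanishing n (ys : seq 'rV[F]_n) : (forall y, y \in ys -> y != 0) ->
  exists th : 'cV[F]_n, forall y, y \in ys -> y *m th != 0.
Proof.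
elim: ys => [|y0 ys IH] h; first by exists 0.
have [|th hth] := IH; first by move=> y yin; apply: h; rewrite inE yin orbT.
have [ph hph] : exists ph : 'cV[F]_n, y0 *m ph != 0.
  apply: NNPP => nex; have /eqP[] := h y0 (mem_head _ _).
  apply/rowP => i; apply/eqP; rewrite mxE -[_ == _]negbK; apply/negP => yi; apply: nex.
  exists (delta_mx i 0); rewrite -colE; apply: contraNneq yi => /matrixP/(_ 0 0).
  by rewrite !mxE => ->.
pose f (y : 'rV[F]_n) := - ((y *m th) 0 0) / ((y *m ph) 0 0).
have [c hc] := exists_notin (map f (y0 :: ys)).
have nz (x : 'M[F]_1) : (x != 0) = (x 0 0 != 0).
  congr (~~ _); apply/eqP/eqP => [->|h0]; first by rewrite mxE.
  by apply/matrixP => a b; rewrite !ord1 h0 mxE.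
exists (th + c *: ph) => y yin; rewrite nz mulmxDr -scalemxAr !mxE.
have [ph0|ph0] := eqVneq ((y *m ph) 0 0) 0.
  rewrite mxE in ph0; rewrite ph0 mulr0 addr0.
  move: yin; rewrite inE => /orP[/eqP yE|yin].
    by move: hph; rewrite -yE nz mxE ph0 eqxx.
  by have := hth y yin; rewrite nz mxE.
apply: contra hc => /eqP hc; apply/mapP; exists y => //.
rewrite /f !mxE; apply: (canRL (mulfK _)); first by rewrite mxE in ph0.
by apply/eqP; rewrite -subr_eq0 opprK addrC hc.
Qed.

Lemma exists_avoiding n r (D : 'M[F]_(r, n)) (ys : seq 'rV[F]_n) :
  (forall y, y \in ys -> ~~ (y <= D)%MS) ->
  exists th : 'cV[F]_n, D *m th = 0 /\ forall y, y \in ys -> y *m th != 0.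
Proof.
move=> h; have [|th hth] := @exists_nonvanishing n [seq y *m cokermx D | y <- ys].
  by move=> _ /mapP[y yin ->]; have := h y yin; rewrite submxE.
exists (cokermx D *m th); split; first by rewrite mulmxA mulmx_coker mul0mx.
by move=> y yin; rewrite mulmxA; apply/hth/map_f.
Qed.
End Avoidance.

Section Existence.
Variables (F : closedFieldType) (n m N R L : nat) (src tgt : 'I_m -> 'I_n) (g : 'I_N -> 'I_n).
Variables (rho : 'I_R -> seq 'I_m -> F) (rs re : 'I_R -> 'I_n).
Hypothesis nodouble : no_double_arrows src tgt.
Hypothesis rho_walk : forall t s, rho t s != 0 ->
  [/\ is_walk src tgt (rs t) s, walk_end tgt (rs t) s = re t & (0 < size s)%N].
Local Notation mat := 'M[F]_N.
Local Notation P := (fiber_proj F g).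
Local Notation E := (euler_mx src tgt rs re).
Local Notation rep := (rep L src tgt g rho rs).
Local Notation adapted := (adapted L src tgt g rho rs).
Local Notation homs := (homs g).
Local Notation local_rep := (local_rep g).
Local Notation fr := (fiber_rank g).
Implicit Types (X Y e t eps : mat) (theta : 'cV[F]_n) (v x : 'rV[int]_n) (S T : {set 'I_N}).

Let rep_zero eps : rep eps 0.
Proof. by apply: rep0; exact: rho_walk. Qed.

(** The idempotent from [eigen_split] commutes with whatever commutes with [eps] and [t], so it is
    graded and an endomorphism of [X]. *)
Lemma indec_local eps X : graded g eps -> eps *m eps = eps -> eps != 0 -> rep eps X ->
  (forall e, e \in homs eps eps X -> e *m e = e -> e = 0 \/ e = eps) -> local_rep eps X.
Proof.
move=> geps epsK eps0 [_ h1 h2 _] ind t /(mem_homs _ _ geps geps epsK epsK)[gt et te tX].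
have [//|[e [[ee e0 ne epse eeps] comm]]] := eigen_split eps0 epsK et te.
have eH : e \in homs eps eps X.
  apply/mem_homs => //; split=> //; last by rewrite comm ?h1 ?h2 ?tX.
  by move=> i; apply: comm.
by case: (ind e eH ee) => eE; [rewrite eE eqxx in e0 | rewrite eE eqxx in ne].
Qed.

Lemma tr_fiber e i : graded g e -> e *m e = e -> \tr (P i *m e) = (fr e 0 i)%:~R.
Proof.
move=> ge ee; rewrite fiber_rankE mxtrace_idempotent //.
by rewrite -mulmxA (mulmxA e) -ge -(mulmxA _ e e) ee mulmxA fiber_projK.
Qed.

Lemma wt_idem theta e : graded g e -> e *m e = e ->
  weighted_trace g theta e = \sum_i (fr e 0 i)%:~R * theta i 0.
Proof.
move=> ge ee; rewrite weighted_traceE; apply: eq_bigr => i _.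
by rewrite tr_fiber // mulrC.
Qed.

(** An endomorphism is [lam eps] plus a part nilpotent on every fiber, so its weighted trace is
    [lam] times [theta . fr eps]. *)
Lemma local_adapted theta eps X : graded g eps -> eps *m eps = eps -> rep eps X ->
  local_rep eps X -> \sum_i (fr eps 0 i)%:~R * theta i 0 = 0 -> adapted theta eps X.
Proof.
move=> geps epsK rX lX th0; split=> // t tH.
have [gt et te tX] := mem_homs _ _ geps geps epsK epsK tH.
have [lam [k nil]] := lX t tH; set s := t - lam *: eps in nil.
have gs : graded g s.
  by apply: gradedD => //; apply: gradedN => i; rewrite -scalemxAr geps scalemxAl.
have es : eps *m s = s by rewrite /s mulmxBr et -scalemxAr epsK.
have trs i : \tr (P i *m s) = 0.
  apply: (@mxtrace_nilpotent _ _ eps _ k.+1).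
    by rewrite mulmxA -geps -mulmxA es.
  have it j : P i *m iter j (mulmx (P i *m s)) eps = P i *m iter j (mulmx s) eps.
    elim: j => [|j] //=.
    move: (iter j (mulmx (P i *m s)) eps) (iter j (mulmx s) eps) => Z Z' IH.
    by rewrite !mulmxA fiber_projK gs -!mulmxA IH.
  by have := it k; rewrite nil mulmx0 /= => hk; rewrite [X in X *m _]gs -mulmxA hk mulmx0.
have -> : t = s + lam *: eps by rewrite subrK.
rewrite weighted_traceD -[X in X + _]wtrE -[X in _ + X]wtrE linearZ /= !wtrE.
rewrite [X in X + _]weighted_traceE big1 => [|i _]; last by rewrite trs mulr0.
by rewrite wt_idem // th0 scaler0 addr0.
Qed.

Definition eps_of (S : {set 'I_N}) : mat := diag_mx (\row_k (k \in S)%:R).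
Definition dim_of (S : {set 'I_N}) : 'rV[int]_n := \sum_(k in S) evec (g k).

Lemma eps_ofM S T : eps_of S *m eps_of T = eps_of (S :&: T).
Proof.
rewrite mulmx_diag; congr diag_mx; apply/rowP => k.
by rewrite !mxE -natrM mulnb in_setI.
Qed.
Lemma eps_of0 : eps_of set0 = 0.
Proof. by apply/matrixP => a c; rewrite !mxE in_set0 mul0rn. Qed.
Lemma eps_ofK S : eps_of S *m eps_of S = eps_of S.
Proof. by rewrite eps_ofM setIid. Qed.
Lemma eps_of_disjoint S T : [disjoint S & T] -> eps_of S *m eps_of T = 0.
Proof. by move=> d; rewrite eps_ofM (disjoint_setI0 d) eps_of0. Qed.
Lemma eps_ofU S T : [disjoint S & T] -> eps_of (S :|: T) = eps_of S + eps_of T.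
Proof.
move=> d; apply/matrixP => a c; rewrite !mxE -mulrnDl in_setU -natrD; congr (_%:R *+ _).
by have := @disjointFr _ _ _ a d; case: (a \in S) => [/(_ isT) ->|_] //=; case: (a \in T).
Qed.
Lemma eps_ofT : eps_of setT = 1%:M.
Proof. by apply/matrixP => a c; rewrite !mxE in_setT. Qed.
Lemma graded_eps_of S : graded g (eps_of S).
Proof. by move=> i; rewrite diag_mxC. Qed.
Lemma eps_of1 k : eps_of [set k] = delta_mx k k.
Proof.
apply/matrixP => a c; rewrite !mxE in_set1.
by case: (a =P c) => [->|ac]; case: (c =P k) => [ck|] //=; rewrite ?andbF ?andbT //;
  case: (a =P k) => // ak; rewrite ak ck in ac.
Qed.

Lemma dim_ofD1 S k : k \in S -> dim_of S = evec (g k) + dim_of (S :\ k).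
Proof. by move=> kS; rewrite /dim_of (big_setD1 k). Qed.

Lemma dim_of_mem S i : 0 < dim_of S 0 i -> exists2 k, k \in S & g k = i.
Proof.
move=> h; apply: NNPP => nex; move: h; rewrite /dim_of summxE big1 ?ltxx // => k kS.
by rewrite evecE; case: eqP => // ik; case: nex; exists k.
Qed.

Lemma fiber_rank_eps_of S : fr (eps_of S) = dim_of S.
Proof.
have [j] := ubnP #|S|; elim: j S => // j IH S; rewrite ltnS => cS.
have [->|[k kS]] := set_0Vmem S.
  by rewrite eps_of0 /dim_of big_set0; apply/rowP => i; rewrite !mxE mulmx0 mxrank0.
have d : [disjoint [set k] & S :\ k].
  by rewrite disjoints1 in_setD1 eqxx.
have d' : [disjoint S :\ k & [set k]] by rewrite disjoint_sym.
have h := fiber_rankD (graded_eps_of [set k]) (graded_eps_of (S :\ k)) (eps_ofK _) (eps_ofK _)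
  (eps_of_disjoint d) (eps_of_disjoint d').
rewrite -(setD1K kS) eps_ofU // h (setD1K kS) (dim_ofD1 kS) eps_of1 fiber_rank_delta IH //.
by rewrite (leq_trans _ cS) // (cardsD1 k S) kS.
Qed.

Lemma select_dim S x : nonneg x -> nonneg (dim_of S - x) ->
  exists T, [/\ T \subset S, dim_of T = x & dim_of (S :\: T) = dim_of S - x].
Proof.
have [j] := ubnP (weight x); elim: j S x => // j IH S x; rewrite ltnS => wx hx hSx.
have [->|x0] := eqVneq x 0.
  by exists set0; rewrite sub0set setD0 subr0 /dim_of big_set0.
have [i xi] := exists_pos hx x0.
have [|k kS gk] := @dim_of_mem S i.
  by apply: lt_le_trans xi _; have := hSx i; rewrite entryB subr_ge0.
have SE := dim_ofD1 kS; rewrite gk in SE.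
have h1 : nonneg (x - evec i) by apply: nonnegB_evec.
have h2 : dim_of (S :\ k) - (x - evec i) = dim_of S - x by rewrite SE; apply/rowP=> l; rewrite !mxE; ring.
have [|||T [TS dT dST]] := IH (S :\ k) (x - evec i).
- by move: wx; rewrite (weight_le (@nonneg_evec _ i) h1) weight_evec; lia.
- exact: h1.
- by rewrite h2.
have kT : k \notin T by apply/negP => /(subsetP TS); rewrite in_setD1 eqxx.
exists (k |: T); split.
- by rewrite subUset sub1set kS (subset_trans TS (subsetDl _ _)).
- by rewrite (@dim_ofD1 _ k) ?setU11 // setU1K // gk dT addrC subrK.
- by rewrite setDUr -h2 -dST; congr dim_of; apply/setP => a; rewrite !inE; case: (a == k); case: (a \in T); case: (a \in S).
Qed.

(** For [theta = 0] the trace condition is void and the zero representation is a starting point; a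
    decomposition of the generic one contradicts [jroot_split_neg]. *)
Lemma jroot_rep v p S : (forall i, E i i = 1) -> (forall i j, i != j -> -1 <= E i j + E j i) ->
  qform E v = 1 -> (forall w, nonneg (w - v) -> qform E w = 1 -> w = v) ->
  jroot E v p -> dim_of S = p -> exists2 X, rep (eps_of S) X & local_rep (eps_of S) X.
Proof.
move=> Ediag Eoff vroot vmax Jp dS; set eps := eps_of S.
have geps : graded g eps := graded_eps_of S; have epsK : eps *m eps = eps := eps_ofK S.
have K0 : adapted 0 eps 0.
  split; first exact: rep_zero.
  by move=> y _; rewrite weighted_traceE big1 // => i _; rewrite mxE mul0r.
have [X [rX _] gen] := adapted_generic nodouble rho_walk geps epsK K0.
have eps0 : eps != 0.
  apply/eqP => e0; have := jroot_neq0 Jp; rewrite -dS -fiber_rank_eps_of -/eps e0.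
  by rewrite -eps_of0 fiber_rank_eps_of /dim_of big_set0 eqxx.
exists X => //; apply: indec_local => // e eH ee.
have [ge epse eeps eX] := mem_homs _ _ geps geps epsK epsK eH.
have gf : graded g (eps - e) by apply: gradedD => //; apply: gradedN.
have ac : fr e + fr (eps - e) = p.
  rewrite -fiber_rankD //.
  - by rewrite addrC subrK fiber_rank_eps_of.
  - by rewrite mulmxBl !mulmxBr epsK epse eeps ee subrr subr0.
  - by rewrite mulmxBr eeps ee subrr.
  - by rewrite mulmxBl epse ee subrr.
have [/fiber_rank_eq0|a0] := eqVneq (fr e) 0; first by left.
have [/fiber_rank_eq0/eqP|c0] := eqVneq (fr (eps - e)) 0.
  by rewrite subr_eq0 eq_sym => /eqP; right.
have := jroot_split_neg Ediag Eoff vroot vmax Jp (fiber_rank_ge0 _ _) (fiber_rank_ge0 _ _) a0 c0 ac.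
by rewrite ltNge gen.
Qed.

Lemma block_rep v d S : (forall i, E i i = 1) -> (forall i j, i != j -> -1 <= E i j + E j i) ->
  qform E v = 1 -> (forall w, nonneg (w - v) -> qform E w = 1 -> w = v) ->
  block E v d -> dim_of S = d -> exists2 X, rep (eps_of S) X & local_rep (eps_of S) X.
Proof.
move=> Ediag Eoff vroot vmax [k [C [dE bk hC]]] dS.
have hCn : nonneg C by case: hC => [->|[[]]] //; exact: nonneg0.
have [|k0 k0S gk] := @dim_of_mem S k.
  by rewrite dS dE entryD evecE eqxx ltr_wpDr.
have dj : [disjoint [set k0] & S :\ k0] by rewrite disjoints1 in_setD1 eqxx.
have dC : dim_of (S :\ k0) = C.
  by apply: (addrI (evec k)); rewrite -{1}gk -dim_ofD1 // dS dE.
have eS : eps_of S = delta_mx k0 k0 + eps_of (S :\ k0).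
  by rewrite -{1}(setD1K k0S) eps_ofU // eps_of1.
have e12 : delta_mx k0 k0 *m eps_of (S :\ k0) = 0 by rewrite -eps_of1 eps_of_disjoint.
have e21 : eps_of (S :\ k0) *m delta_mx k0 k0 = 0.
  by rewrite -eps_of1 eps_of_disjoint // disjoint_sym.
rewrite eS; case: hC => [C0|[JC bC]].
  have -> : eps_of (S :\ k0) = 0.
    by apply: (@fiber_rank_eq0 _ _ _ g); rewrite fiber_rank_eps_of dC.
  rewrite addr0; exists 0; first exact: rep_zero.
  have gd := @delta_graded F n N g k0; have dd := @delta_idem F N k0.
  move=> t /(mem_homs _ _ gd gd dd dd)[_ et te _].
  have [lam lamE] := delta_sandwich k0 t; exists lam, 1%N => /=.
  have tE : t = lam *: delta_mx k0 k0 by rewrite -lamE et te.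
  by rewrite tE subrr mul0mx.
have [X rX lX] := jroot_rep Ediag Eoff vroot vmax JC dC.
apply: (local_glue nodouble rho_walk (graded_eps_of _) (eps_ofK _) e12 e21 rX lX).
- by rewrite fiber_rank_eps_of dC gk; apply: jroot_entry0 JC bk.
- by rewrite fiber_rank_delta fiber_rank_eps_of dC gk bC.
Qed.

Lemma trivial_adapted theta : adapted theta 0 0.
Proof.
split; first exact: rep_zero.
move=> y /(mem_homs _ _ (@graded0 _ _ _ _) (@graded0 _ _ _ _) (mul0mx _ _) (mul0mx _ _))[_ h _ _].
by rewrite -h mul0mx weighted_traceE big1 // => i _; rewrite mulmx0 mxtrace0 mulr0.
Qed.

Lemma bounded_vectors (v : 'rV[int]_n) : exists ys : seq 'rV[int]_n,
  forall y, nonneg y -> nonneg (v - y) -> y \in ys.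
Proof.
pose B := (\max_i `|v 0%R i|)%N.
exists [seq (\row_i (f i)%:Z) | f : {ffun 'I_n -> 'I_B.+1}] => y hy hvy.
apply/mapP; exists [ffun i => inord `|y 0%R i|%N]; first by rewrite mem_enum.
apply/rowP => i; rewrite mxE ffunE inordK; first by rewrite gez0_abs.
rewrite ltnS; apply: (@leq_trans `|v 0%R i|%N); last exact: (leq_bigmax i).
by have := hy i; have := hvy i; rewrite entryB; lia.
Qed.

Lemma exists_brick v : dim_of setT = v -> (forall i, E i i = 1) ->
  (forall i j, i != j -> -1 <= E i j + E j i) -> (forall i, 0 < v 0 i) -> qform E v = 1 ->
  (forall w, nonneg (w - v) -> qform E w = 1 -> w = v) ->
  (forall (j i : 'I_n) (A : 'I_n -> Prop), j != i -> A j -> ~ A i -> exists s t : 'I_n,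
     [/\ A s, ~ A t & bform E (evec s) (evec t) != ((s == j) && (t == i))%:R]) ->
  exists2 X, rep 1%:M X & forall e, graded g e -> e *m X = X *m e -> e *m e = e ->
    e = 0 \/ e = 1%:M.
Proof.
move=> dT Ediag Eoff vpos vroot vmax Hconn.
have g1 : graded g (1%:M : mat) by move=> i; rewrite mulmx1 mul1mx.
have K1 : 1%:M *m 1%:M = 1%:M :> mat by rewrite mul1mx.
(* By [split_null] a decomposition of the generic representation has a null pair as dimension
   vectors, and [theta] separates it from 0 while the trace of its idempotent vanishes. *)
suff [theta [X KX hth]] : exists theta, exists2 X, adapted theta 1%:M X &
    forall y z, null_pair E v y z -> \sum_i (y 0 i)%:~R * theta i 0 != 0.
  have [X' [rX' tX'] gen] := adapted_generic nodouble rho_walk g1 K1 KX.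
  exists X' => // e ge eX ee.
  have eH : e \in homs 1%:M 1%:M X' by apply/mem_homs => //; rewrite mul1mx mulmx1.
  have gf : graded g (1%:M - e) by apply: gradedD => //; apply: gradedN.
  have ac : fr e + fr (1%:M - e) = v.
    rewrite -fiber_rankD //.
    - by rewrite addrC subrK -eps_ofT fiber_rank_eps_of.
    - by rewrite mulmxBl !mulmxBr !mul1mx mulmx1 ee subrr subr0.
    - by rewrite mulmxBr mulmx1 ee subrr.
    - by rewrite mulmxBl mul1mx ee subrr.
  have [/fiber_rank_eq0|a0] := eqVneq (fr e) 0; first by left.
  have [/fiber_rank_eq0/eqP|c0] := eqVneq (fr (1%:M - e)) 0.
    by rewrite subr_eq0 eq_sym => /eqP; right.
  have b0 := gen e eH ee.
  have ha := fiber_rank_ge0 g e; have hc := fiber_rank_ge0 g (1%:M - e).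
  have [qa qc] := split_null Ediag Eoff vroot vmax ha hc a0 c0 ac b0.
  have := hth _ _ (And5 ha hc ac qa qc); rewrite -wt_idem // tX' //.
  by rewrite eqxx.
have [nonull|[u [w [r [bu bw br uwr nspan]]]]] := null_pair_blocks Ediag Eoff vpos vroot vmax Hconn.
  exists 0; exists 0; last by move=> y z yz; case: (nonull y z).
  split; first exact: rep_zero.
  by move=> y _; rewrite weighted_traceE big1 // => i _; rewrite mxE mul0r.
(* [theta] must be orthogonal to the rows of [D] and nonzero on the null vectors, finitely many
   since they lie below [v]. By [not_span] none of them is in the row space of [D]. *)
pose D : 'M[F]_(3, n) := \matrix_(a, i)
  (if val a is 0%N then u 0 i else if val a is 1%N then w 0 i else r 0 i)%:~R.
have [ys ysP] := bounded_vectors v.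
pose toF (y : 'rV[int]_n) : 'rV[F]_n := \row_i (y 0 i)%:~R.
pose isnull y := pb (exists z, null_pair E v y z).
have pbP (Q : Prop) : reflect Q (pb Q).
  by rewrite /pb; case: excluded_middle_informative => h; constructor.
have [|th [Dth hth]] := @exists_avoiding F n 3 D [seq toF y | y <- ys & isnull y].
  move=> _ /mapP[y + ->]; rewrite mem_filter => /andP[/pbP[z yz] _].
  apply/negP => /submxP[c yc].
  apply: (nspan F y z (c 0 0) (c 0 1) (c 0 2%:R) yz) => l.
  have := congr1 (fun M : 'rV[F]_n => M 0 l) yc; rewrite mxE => ->.
  by rewrite mxE !big_ord_recl big_ord0 !mxE addr0 /= addrA;
    congr (c 0 _ * _ + c 0 _ * _ + c 0 _ * _); apply: val_inj.
exists th.
have Dth' a : \sum_i D a i * th i 0 = 0.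
  by have := congr1 (fun M : 'cV[F]_3 => M a 0) Dth; rewrite !mxE.
have thu : \sum_i (u 0 i)%:~R * th i 0 = 0.
  by rewrite -[RHS](Dth' (@Ordinal 3 0 isT)); apply: eq_bigr => i _; rewrite mxE.
have thw : \sum_i (w 0 i)%:~R * th i 0 = 0.
  by rewrite -[RHS](Dth' (@Ordinal 3 1 isT)); apply: eq_bigr => i _; rewrite mxE.
have thr : \sum_i (r 0 i)%:~R * th i 0 = 0.
  by rewrite -[RHS](Dth' (@Ordinal 3 2 isT)); apply: eq_bigr => i _; rewrite mxE.
have hblock x : block E v x -> nonneg x.
  case=> k [C [-> _ hC]]; apply: nonnegD; first exact: nonneg_evec.
  by case: hC => [->|[[]]] //; exact: nonneg0.
have hr : nonneg r by case: br => [->|[]] //; exact: nonneg0.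
have hu := hblock u bu; have hw := hblock w bw.
have dwr : v - u = w + r by rewrite -uwr; apply/rowP => l; rewrite !mxE; ring.
have [|Tu [_ dTu dTu']] := @select_dim setT u hu; first by rewrite dT dwr; apply: nonnegD.
rewrite dT dwr in dTu'; have wrw : w + r - w = r by apply/rowP => l; rewrite !mxE; ring.
have [|Tw [sTw dTw dTr]] := @select_dim (setT :\: Tu) w hw; first by rewrite dTu' wrw.
rewrite dTu' wrw in dTr; set Tr := _ :\: Tw in dTr.
have dj1 : [disjoint Tu & Tw] by move: sTw; rewrite setTD disjoint_sym subsets_disjoint setCK.
have dj2 : [disjoint Tu :|: Tw & Tr].
  by rewrite -setI_eq0; apply/eqP/setP => a; rewrite !inE; case: (a \in Tu); case: (a \in Tw).
have e1 : eps_of Tu + eps_of Tw + eps_of Tr = 1%:M.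
  rewrite -!eps_ofU // -eps_ofT; congr eps_of; apply/setP => a.
  by rewrite !inE; case: (a \in Tu); case: (a \in Tw).
have [Xu rXu lXu] := block_rep Ediag Eoff vroot vmax bu dTu.
have [Xw rXw lXw] := block_rep Ediag Eoff vroot vmax bw dTw.
have adapt S x X : dim_of S = x -> \sum_i (x 0 i)%:~R * th i 0 = 0 ->
    rep (eps_of S) X -> local_rep (eps_of S) X -> adapted th (eps_of S) X.
  move=> dS sx rX lX; apply: local_adapted => //; rewrite ?eps_ofK ?fiber_rank_eps_of ?dS //.
  exact: graded_eps_of.
have [Xr KXr] : exists X, adapted th (eps_of Tr) X.
  case: br => [r0|Jr].
    exists 0; have -> : eps_of Tr = 0; last exact: trivial_adapted.
    by apply: (@fiber_rank_eq0 _ _ _ g); rewrite fiber_rank_eps_of dTr.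
  have [X rX lX] := jroot_rep Ediag Eoff vroot vmax Jr dTr.
  by exists X; apply: adapt dTr thr rX lX.
have dj1' : [disjoint Tw & Tu] by rewrite disjoint_sym.
have dj2' : [disjoint Tr & Tu :|: Tw] by rewrite disjoint_sym.
have sum S T X Y : [disjoint S & T] -> [disjoint T & S] -> adapted th (eps_of S) X ->
    adapted th (eps_of T) Y -> adapted th (eps_of (S :|: T)) (X + Y).
  move=> d d' KX KY; rewrite eps_ofU //.
  by apply: adapted_sum KX KY; try exact: rho_walk; try exact: graded_eps_of;
    try exact: eps_ofK; try by apply: eps_of_disjoint.
exists (Xu + Xw + Xr).
  rewrite -e1 -!eps_ofU //; apply: (sum _ _ _ _ dj2 dj2' _ KXr).
  apply: (sum _ _ _ _ dj1 dj1'); first exact: adapt dTu thu rXu lXu.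
  exact: adapt dTw thw rXw lXw.
move=> y z yz; have [hy hz yzv _ _] := yz.
have yin : toF y \in [seq toF y | y <- ys & isnull y].
  apply: map_f; rewrite mem_filter ysP ?andbT //; first by apply/pbP; exists z.
  by have -> : v - y = z by rewrite -yzv; apply/rowP => l; rewrite !mxE; ring.
apply: contraNneq (hth _ yin) => s0; apply/eqP/matrixP => a c.
rewrite !ord1 !mxE -[RHS]s0; apply: eq_bigr => i _; by rewrite mxE.
Qed.
End Existence.

(** * Quivers, path algebras and the Tits form *)

Lemma pbP (Q : Prop) : reflect Q (pb Q).
Proof. by rewrite /pb; case: excluded_middle_informative => h; constructor. Qed.

Section Walks.
Variables (n m : nat) (src tgt : 'I_m -> 'I_n).
Hypothesis acyclic : triangular src tgt.
Local Notation is_walk := (is_walk src tgt).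
Local Notation walk_end := (walk_end tgt).

Lemma is_walk_cat i u w : is_walk i (u ++ w) = is_walk i u && is_walk (walk_end i u) w.
Proof. by elim: u i => [|a u IH] i //=; rewrite IH andbA. Qed.

Lemma walk_end_cat i u w : walk_end i (u ++ w) = walk_end (walk_end i u) w.
Proof. by elim: u i => [|a u IH] i //=; rewrite IH. Qed.

Lemma walk_visit i s x : is_walk i s -> x \in map tgt s ->
  exists2 r, is_walk i r && (r != [::]) & walk_end i r = x.
Proof.
elim: s i => [|a s IH] i //= /andP[ai ws]; rewrite inE => /orP[/eqP->|xs].
  by exists [:: a] => //=; rewrite ai.
have [r /andP[wr _] er] := IH _ ws xs.
by exists (a :: r) => //=; rewrite ai wr.
Qed.

(** The start and the targets along a walk are pairwise distinct, since a repetition would close an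
    oriented cycle. *)
Lemma size_walk i s : is_walk i s -> (size s < n)%N.
Proof.
have un j r : is_walk j r -> uniq (j :: map tgt r).
  elim: r j => [|a r IH] j // wr; have /= /andP[_ wr'] := wr.
  rewrite [map _ _]/= [uniq _]/= -/(uniq (tgt a :: map tgt r)) (IH _ wr') andbT.
  apply/negP => jr; have [u /andP[wu u0] eu] := walk_visit wr jr.
  by have := acyclic wu u0; rewrite eu eqxx.
move/un => /card_uniqP; rewrite /= size_map => <-.
by apply: leq_trans (max_card _) _; rewrite card_ord.
Qed.

Lemma walk_cross (al : pred 'I_n) x s : is_walk x s -> al x != al (walk_end x s) ->
  has (fun a => al (src a) != al (tgt a)) s.
Proof.
elim: s x => [|a s IH] x /=; first by rewrite eqxx.
move=> /andP[/eqP<- ws] h; case: eqP => //= E1; apply: IH ws _.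
by rewrite -E1.
Qed.

(* Walks have bounded length, and replacing a crossing arrow by the walk [r] lengthens a walk. *)
Lemma no_crossing (al : pred 'I_n) :
  (forall a, al (src a) != al (tgt a) -> exists r, [/\ is_walk (src a) r,
     walk_end (src a) r = tgt a & (2 <= size r)%N]) ->
  forall i s, is_walk i s -> ~~ has (fun a => al (src a) != al (tgt a)) s.
Proof.
move=> H i s; have [k] := ubnP (n - size s)%N; elim: k s => // k IH s; rewrite ltnS => hk ws.
apply/negP => /hasP[a /splitPr sE ca]; case: sE ws hk => u w.
rewrite is_walk_cat => /and3P[wu /eqP sa ww] hk.
have [r [wr er sr]] := H a ca.
have wn : is_walk i (u ++ r ++ w).
  by rewrite !is_walk_cat wu -sa wr er.
have := IH (u ++ r ++ w); rewrite !has_cat.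
rewrite (@walk_cross al (src a) r) ?er // orbT => h.
have lt : (n - size (u ++ r ++ w) < k)%N.
  by have := size_walk wn; move: hk; rewrite !size_cat /=; lia.
by have := h lt wn.
Qed.
End Walks.

Lemma sum_delta2 n (i j : 'I_n) (f : 'I_n -> 'I_n -> int) :
  \sum_k \sum_l ((i == k) && (j == l))%:R * f k l = f i j.
Proof.
rewrite (bigD1 i) //= [X in _ + X]big1 => [|k ki]; last first.
  by rewrite big1 // => l _; rewrite eq_sym (negPf ki) mul0r.
rewrite addr0 (bigD1 j) //= big1 => [|l lj]; last first.
  by rewrite (eq_sym j) (negPf lj) andbF mul0r.
by rewrite !eqxx mul1r addr0.
Qed.

Section QuiverForm.
Variables (n m R : nat) (src tgt : 'I_m -> 'I_n) (rs re : 'I_R -> 'I_n).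
Hypothesis acyclic : triangular src tgt.
Hypothesis nodouble : no_double_arrows src tgt.
Hypothesis rel_walk : forall t, exists s, [/\ is_walk src tgt (rs t) s,
  walk_end tgt (rs t) s = re t & (2 <= size s)%N].
Local Notation E := (euler_mx src tgt rs re).

Definition arrow_count i j : int := \sum_a ((src a == i) && (tgt a == j))%:R.
Definition rel_count i j : int := \sum_t ((rs t == i) && (re t == j))%:R.

Lemma euler_mx_entry i j : E i j = (i == j)%:R - arrow_count i j + rel_count i j.
Proof. by rewrite mxE. Qed.

Lemma rel_count_ge0 i j : 0 <= rel_count i j.
Proof. by rewrite sumr_ge0. Qed.

Lemma arrow_count_ge0 i j : 0 <= arrow_count i j.
Proof. by rewrite sumr_ge0. Qed.

Lemma rel_count_gt0 i j : 0 < rel_count i j -> exists2 t, rs t = i & re t = j.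
Proof.
move=> h; apply: NNPP => nex; move: h; rewrite /rel_count big1 ?ltxx // => t _.
by case: eqP => [ri|] //; case: eqP => [rj|] //; case: nex; exists t.
Qed.

Lemma arrow_count1 a : arrow_count (src a) (tgt a) = 1.
Proof.
rewrite /arrow_count (bigD1 a) //= !eqxx big1 ?addr0 // => c ca.
case: eqP => [h1|] //; case: eqP => [h2|] //.
by move: ca; rewrite (nodouble h1 h2) eqxx.
Qed.

Lemma arrow_countP i j : arrow_count i j = 0 \/ exists2 a, src a = i & tgt a = j.
Proof.
have [h|nex] := classic (exists2 a, src a = i & tgt a = j); first by right.
left; rewrite /arrow_count big1 // => a _.
by case: eqP => [ri|] //; case: eqP => [rj|] //; case: nex; exists a.
Qed.

Lemma arrow_count_le1 i j : arrow_count i j <= 1.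
Proof. by case: (arrow_countP i j) => [->|[a <- <-]] //; rewrite arrow_count1. Qed.

Lemma no_two_cycle x r y w : is_walk src tgt x r -> walk_end tgt x r = y -> r != [::] ->
  is_walk src tgt y w -> walk_end tgt y w = x -> False.
Proof.
move=> wr er r0 ww ew; have := @acyclic x (r ++ w).
rewrite is_walk_cat wr er ww walk_end_cat er ew eqxx => h.
by have := h isT; case: r r0 {wr er h} => // a r _ /(_ isT).
Qed.

Lemma rel_count_opposite a : rel_count (tgt a) (src a) = 0.
Proof.
apply: le_anti; rewrite rel_count_ge0 andbT leNgt; apply/negP => /rel_count_gt0[t ht hs].
have [s [ws es _]] := rel_walk t; rewrite ht hs in ws es.
by apply: (@no_two_cycle (src a) [:: a] (tgt a) s) => //=; rewrite eqxx.
Qed.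

Lemma euler_mx_diag i : E i i = 1.
Proof.
rewrite euler_mx_entry eqxx.
have -> : arrow_count i i = 0.
  case: (arrow_countP i i) => // -[a sa ta].
  by have := @acyclic i [:: a]; rewrite /= sa ta eqxx => /(_ isT isT).
suff -> : rel_count i i = 0 by rewrite subr0 addr0.
apply: le_anti; rewrite rel_count_ge0 andbT leNgt; apply/negP => /rel_count_gt0[t ht hs].
have [s [ws es ss]] := rel_walk t; rewrite ht in ws es.
by have := acyclic ws; rewrite es hs eqxx; case: s ss {ws es} => // a s _ /(_ isT).
Qed.

Lemma euler_mx_sym i j : i != j ->
  E i j + E j i = rel_count i j + rel_count j i - (arrow_count i j + arrow_count j i).
Proof. by move=> ij; rewrite !euler_mx_entry (eq_sym j) (negPf ij) /=; ring. Qed.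

Lemma arrow_count_sym_le1 i j : arrow_count i j + arrow_count j i <= 1.
Proof.
case: (arrow_countP i j) => [->|[a sa ta]]; first by rewrite add0r arrow_count_le1.
case: (arrow_countP j i) => [->|[c sc tc]]; first by rewrite addr0 arrow_count_le1.
exfalso; apply: (@no_two_cycle i [:: a] j [:: c]) => //=; rewrite ?sa ?sc ?eqxx //.
Qed.

Lemma euler_mx_off i j : i != j -> -1 <= E i j + E j i.
Proof.
move=> ij; rewrite euler_mx_sym //.
have := arrow_count_sym_le1 i j; have := rel_count_ge0 i j; have := rel_count_ge0 j i; lia.
Qed.

(** Otherwise all values across the cut are nonnegative, so a crossing arrow is accompanied by a
    relation and hence by a parallel walk of length at least 2. [no_crossing] then excludes crossing
    walks, and with them crossing relations; but the value 1 at [j], [i] requires one. *)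
Lemma euler_mx_connected (j i : 'I_n) (A : 'I_n -> Prop) : j != i -> A j -> ~ A i ->
  exists s t : 'I_n, [/\ A s, ~ A t & bform E (evec s) (evec t) != ((s == j) && (t == i))%:R].
Proof.
move=> ji Aj Ai; apply: NNPP => nex.
have H s t : A s -> ~ A t -> E s t + E t s = ((s == j) && (t == i))%:R.
  move=> As At; apply/eqP; rewrite -bform_evec -[_ == _]negbK; apply/negP => h.
  by apply: nex; exists s, t.
pose al x := pb (A x).
have alP x y : al x != al y -> 0 <= E x y + E y x.
  by rewrite /al; case: pbP => Ax; case: pbP => Ay //= _; [rewrite H | rewrite addrC H].
have noc : forall x s, is_walk src tgt x s -> ~~ has (fun a => al (src a) != al (tgt a)) s.
  apply: no_crossing => // a ca.
  have st : src a != tgt a by apply: contraNneq ca => ->.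
  have := alP _ _ ca; rewrite euler_mx_sym // rel_count_opposite arrow_count1 addr0 => h.
  have [|t <- <-] := @rel_count_gt0 (src a) (tgt a).
    by have := arrow_count_ge0 (tgt a) (src a); lia.
  by have [r [wr er sr]] := rel_walk t; exists r.
have norel x y : al x != al y -> rel_count x y = 0.
  move=> xy; apply: le_anti; rewrite rel_count_ge0 andbT leNgt.
  apply/negP => /rel_count_gt0[t ht hs]; have [s [ws es _]] := rel_walk t.
  have := noc _ _ ws; rewrite (walk_cross ws) //.
  by rewrite es ht hs.
have cji : al j != al i by rewrite /al; do 2 case: pbP.
have := H j i Aj Ai; rewrite !eqxx euler_mx_sym // !norel //; last by rewrite eq_sym.
have := arrow_count_ge0 i j; have := arrow_count_ge0 j i; lia.
Qed.
End QuiverForm.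

Section WordSumConvolution.
Variables (m : nat) (V : zmodType).
Implicit Types (f : seq 'I_m -> V).

Lemma word_sum_recr K f :
  word_sum K.+1 f = word_sum K f + \sum_(t : K.-tuple 'I_m) f (val t).
Proof. by rewrite /word_sum big_ord_recr. Qed.

Lemma word_sum_stable K K' f : (forall s, (K <= size s)%N -> f s = 0) -> (K <= K')%N ->
  word_sum K' f = word_sum K f.
Proof.
move=> h; elim: K' => [|K' IH]; first by rewrite leqn0 => /eqP->.
rewrite leq_eqVlt => /orP[/eqP->//|]; rewrite ltnS => le.
rewrite word_sum_recr IH // big1 ?addr0 // => t _.
by apply: h; rewrite size_tuple.
Qed.

Lemma word_sumS K f : word_sum K.+1 f = f [::] + \sum_a word_sum K (fun s => f (a :: s)).
Proof.
rewrite /word_sum big_ord_recl /=; congr (_ + _).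
  rewrite (big_pred1 [tuple]) // => t; apply/esym/eqP; exact: tuple0.
rewrite exchange_big /=; apply: eq_bigr => l _.
rewrite pair_big /= (reindex (fun p : 'I_m * l.-tuple 'I_m => [tuple of p.1 :: p.2])) //=.
exists (fun t : l.+1.-tuple 'I_m => (thead t, [tuple of behead t])) => [[a t]|t] _.
  by congr (_, _); apply: val_inj.
by apply: val_inj; case: t => -[|a s] //= _.
Qed.

(** A Cauchy product: words with a marked cut correspond to pairs of words, and long factors
    contribute nothing. *)
Lemma word_sum_conv K1 K2 K (phi : seq 'I_m -> seq 'I_m -> V) :
  (forall u w, (K1 <= size u)%N -> phi u w = 0) ->
  (forall u w, (K2 <= size w)%N -> phi u w = 0) -> (K1 + K2 <= K)%N ->
  word_sum K (fun s => \sum_(l < (size s).+1) phi (take l s) (drop l s)) =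
  word_sum K1 (fun u => word_sum K2 (phi u)).
Proof.
elim: K1 K phi => [|K1 IH] K phi h1 h2 le.
  rewrite [RHS]big_ord0 (@eq_word_sum _ _ K _ (fun=> 0)) ?word_sum0 // => s.
  by rewrite big1 // => l _; rewrite h1.
case: K le => // K le; rewrite [RHS]word_sumS -(word_sum_stable (h2 [::]) (_ : K2 <= K.+1)%N); last by lia.
rewrite !word_sumS /= big_ord_recl big_ord0 addr0 -addrA -big_split /=; congr (_ + _).
apply: eq_bigr => a _.
have <- := IH K (fun u w => phi (a :: u) w) (fun u w hu => h1 (a :: u) w hu) (fun u w => h2 (a :: u) w) le.
rewrite -word_sumD; apply: eq_word_sum => s.
by rewrite big_ord_recl.
Qed.
End WordSumConvolution.

Section PathAlgebra.
Variables (F : fieldType) (n m N : nat) (src tgt : 'I_m -> 'I_n) (g : 'I_N -> 'I_n).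
Hypothesis acyclic : triangular src tgt.
Variable X : 'M[F]_N.
Local Notation kQ := (kQ F n m).
Local Notation is_elem := (@is_elem F n m src tgt).
Local Notation P := (fiber_proj F g).
Local Notation pm := (path_mx src tgt g X).

Lemma is_elem_long (f : kQ) i s : is_elem f -> (n <= size s)%N -> f (i, s) = 0.
Proof.
move=> hf ns; apply: hf; apply/negP => /= ws.
by have := size_walk acyclic ws; rewrite ltnNge ns.
Qed.

Lemma path_mx_nwalk i s : ~~ is_walk src tgt i s -> pm i s = 0.
Proof.
elim: s i => [|a s IH] i //=; rewrite negb_and; case: eqP => //= _ h.
by rewrite IH // mulmx0.
Qed.

Lemma path_mx_cat i u w : pm i (u ++ w) = pm i u *m pm (walk_end tgt i u) w.
Proof.
elim: u i => [|a u IH] i /=; first by rewrite path_mx_start.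
by case: ifP => _; rewrite ?mul0mx // IH !mulmxA.
Qed.

Definition eval (f : kQ) i : 'M[F]_N := word_sum n (fun s => f (i, s) *: pm i s).

Lemma eval_start f i : P i *m eval f i = eval f i.
Proof.
rewrite [LHS](word_sum_morph (mulmx (P i))); apply: eq_word_sum => s /=.
by rewrite -scalemxAr path_mx_start.
Qed.

Lemma pm_eval i u (g' : kQ) :
  pm i u *m (\sum_k eval g' k) = pm i u *m eval g' (walk_end tgt i u).
Proof.
rewrite mulmx_sumr (bigD1 (walk_end tgt i u)) //= big1 ?addr0 // => k hk.
rewrite -(path_mx_end src) -eval_start -mulmxA (mulmxA (P _)) fiber_projM eq_sym (negPf hk).
by rewrite mul0mx mulmx0.
Qed.

Lemma eval_mul f g' i : is_elem f -> is_elem g' ->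
  eval (kQmul tgt f g') i = eval f i *m \sum_k eval g' k.
Proof.
move=> hf hg; pose phi u w := (f (i, u) * g' (walk_end tgt i u, w)) *: pm i (u ++ w).
(* Concatenations can be longer than [n], so the range is doubled; words of length at least [n] are
   not walks and add nothing. *)
have st : eval (kQmul tgt f g') i =
    word_sum (n + n) (fun s => \sum_(l < (size s).+1) phi (take l s) (drop l s)).
  rewrite /eval -(@word_sum_stable _ _ n (n + n) (fun s => kQmul tgt f g' (i, s) *: pm i s)) ?leq_addr //.
    apply: eq_word_sum => s; rewrite /kQmul scaler_suml /=; apply: eq_bigr => l _.
    by rewrite /phi cat_take_drop.
  move=> s ns; rewrite path_mx_nwalk ?scaler0 //; apply/negP => /(size_walk acyclic).
  by rewrite ltnNge ns.
rewrite st (@word_sum_conv _ _ n n) //.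
- rewrite [RHS](word_sum_morph (mulmxr (\sum_k eval g' k))); apply: eq_word_sum => u /=.
  rewrite -scalemxAl pm_eval scalemxAl [RHS](word_sum_morph (mulmx (f (i, u) *: pm i u))).
  apply: eq_word_sum => w /=; rewrite /phi path_mx_cat -scalemxAl -scalemxAr scalerA.
  by [].
- by move=> u w hu; rewrite /phi is_elem_long ?mul0r ?scale0r.
- by move=> u w hw; rewrite /phi (is_elem_long _ hg hw) mulr0 scale0r.
Qed.

Definition annihilator (f : kQ) := is_elem f /\ forall i, eval f i = 0.

Lemma is_elem_mul f g' : is_elem f -> is_elem g' -> is_elem (kQmul tgt f g').
Proof.
move=> hf hg [i s] /= ns; rewrite /kQmul big1 // => l _ /=.
have [wu|nu] := boolP (is_walk src tgt i (take l s)); last by rewrite hf ?mul0r.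
rewrite hg ?mulr0 //=; apply: contra ns => ww.
by rewrite -(cat_take_drop l s) is_walk_cat wu.
Qed.

(** Being an ideal, the annihilator of [X] contains [I] as soon as it contains the generators. *)
Lemma annihilator_ideal : is_ideal src tgt annihilator.
Proof.
split.
- by move=> f [].
- split=> // i; rewrite /eval (@eq_word_sum _ _ n _ (fun=> 0)) ?word_sum0 // => s.
  by rewrite scale0r.
- move=> f g' [hf ef] [hg eg]; split=> [p np|i]; first by rewrite /kQadd hf // hg // addr0.
  rewrite -[RHS]addr0 -{1}(ef i) -(eg i) /eval -word_sumD; apply: eq_word_sum => s.
  by rewrite /kQadd scalerDl.
- move=> c f [hf ef]; split=> [p np|i]; first by rewrite /kQscale hf // mulr0.
  rewrite -[RHS](scaler0 _ c) -(ef i) [RHS](word_sum_morph ( *:%R c)); apply: eq_word_sum => s.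
  by rewrite /= scalerA.
- move=> f g' hg [hf ef]; split; split; try exact: is_elem_mul.
    by move=> i; rewrite eval_mul // big1 ?mulmx0.
  by move=> i; rewrite eval_mul // ef mul0mx.
Qed.
End PathAlgebra.

(** * From graded matrices back to a matrix for each arrow *)

Section Fibers.
Variables (F : fieldType) (n m : nat) (src tgt : 'I_m -> 'I_n) (v : 'I_n -> nat).
Local Notation T := {i : 'I_n & 'I_(v i)}.
Local Notation N := #|{: T}|.
Definition fiber_of (k : 'I_N) : 'I_n := tag (enum_val k).
Local Notation P := (fiber_proj F fiber_of).
(** The coordinate embedding of the space at [i] into the total space; its transpose is the
    coordinate projection. *)
Definition select_mx i : 'M[F]_(v i, N) :=
  \matrix_(a, k) (enum_rank (Tagged (fun i => 'I_(v i)) a) == k)%:R.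
Local Notation S := select_mx.

Lemma select_row i a : row a (S i) = delta_mx 0 (enum_rank (Tagged (fun i => 'I_(v i)) a)).
Proof. by apply/rowP => k; rewrite !mxE eqxx eq_sym. Qed.

Lemma select_mxP i j : S i *m P j = if i == j then S i else 0.
Proof.
apply/matrixP => a k; rewrite mul_mx_diag !mxE /fiber_of.
case: (i =P j) => [<-|ij]; rewrite !mxE.
  by case: eqP => [<-|]; rewrite ?mul0r // enum_rankK /= eqxx mulr1.
by case: eqP => [<-|]; rewrite ?mul0r // enum_rankK /=; case: eqP => // _; rewrite mulr0.
Qed.

Lemma select_mxK i : S i *m (S i)^T = 1%:M.
Proof.
apply/row_matrixP => a; rewrite row_mul select_row -rowE; apply/rowP => c.
rewrite !mxE (inj_eq enum_rank_inj) eq_Tagged /= eq_sym.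
by [].
Qed.

Lemma select_mxTK i : (S i)^T *m S i = P i.
Proof.
apply/matrixP => k l; rewrite !mxE.
under eq_bigr => a _ do rewrite !mxE.
have [/eqP gk|gk] := boolP (fiber_of k == i); last first.
  rewrite big1 ?mul0rn // => a _; case: eqP => [h|]; last by rewrite mul0r.
  by move: gk; rewrite -h /fiber_of enum_rankK eqxx.
have [a ka] : exists a : 'I_(v i), enum_rank (Tagged (fun i => 'I_(v i)) a) = k.
  have kE := enum_valK k; move: gk kE; rewrite /fiber_of.
  by case: (enum_val k) => j b /= <- <-; exists b.
rewrite (bigD1 a) //= ka eqxx mul1r big1 ?addr0 => [|c ca].
  by case: (k =P l).
case: eqP => [h|]; last by rewrite mul0r.
move: ca; rewrite -ka in h; move/enum_rank_inj: h => /eqP.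
by rewrite eq_Tagged /= => ->.
Qed.

Lemma select_trP i : P i *m (S i)^T = (S i)^T.
Proof. by rewrite -select_mxTK -mulmxA select_mxK mulmx1. Qed.

Lemma dim_of_fibers i : dim_of fiber_of setT 0 i = (v i)%:Z.
Proof.
rewrite /dim_of summxE; under eq_bigr => k _ do rewrite evecE.
transitivity (\sum_(x : T) (i == tag x)%:R : int).
  rewrite (eq_bigl xpredT) => [|k]; last by rewrite in_setT.
  rewrite [RHS](reindex (fun k : 'I_N => enum_val k)) //.
  by exists enum_rank => x _; [exact: enum_valK | exact: enum_rankK].
rewrite -(sig_big_dep (fun _ => true) (fun _ _ => true) (fun j (_ : 'I_(v j)) => (i == j)%:R : int)) /=.
rewrite (bigD1 i) //= [X in _ + X]big1 => [|j ji].
  by rewrite eqxx sumr_const card_ord addr0 /= -[RHS]natz.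
by rewrite big1 // => a _; rewrite eq_sym (negPf ji).
Qed.

Variable X : 'M[F]_N.
Definition rep_of a : 'M[F]_(v (src a), v (tgt a)) := S (src a) *m X *m (S (tgt a))^T.

Lemma peval_path i s j : peval rep_of i s j = S i *m path_mx src tgt fiber_of X i s *m (S j)^T.
Proof.
elim: s i => [|a s IH] i /=.
  rewrite select_mxP eqxx; case: (i =P j) => [<-|ij].
    by rewrite conform_mx_id select_mxK.
  by rewrite -select_trP mulmxA select_mxP; case: eqP ij => // _ _; rewrite mul0mx.
rewrite IH /arr_mx eqxx andbT; case: (src a =P i) => [<-|_]; last by rewrite mul0mx mulmx0 mul0mx.
rewrite conform_mx_id /rep_of !mulmxA select_mxP eqxx.
by rewrite -(mulmxA _ _ (S (tgt a))) select_mxTK -(mulmxA _ (P _)) path_mx_start.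
Qed.

Lemma act_eval f i j : act rep_of f i j = S i *m eval src tgt fiber_of X f i *m (S j)^T.
Proof.
rewrite -[LHS]/(word_sum n (fun s => f (i, s) *: peval rep_of i s j)).
rewrite [RHS](word_sum_morph (mulmxr ((S j)^T) \o mulmx (S i))); apply: eq_word_sum => s /=.
by rewrite peval_path -scalemxAr -scalemxAl.
Qed.

Lemma proj_intertwines p q (U W : 'M[F]_p) (U' W' : 'M[F]_q) (M : 'M[F]_(p, q)) :
  (U + W == 1%:M)%MS -> (U :&: W == (0 : 'M_p))%MS -> (U' :&: W' == (0 : 'M_q))%MS ->
  (U *m M <= U')%MS -> (W *m M <= W')%MS -> proj_mx U W *m M = M *m proj_mx U' W'.
Proof.
move=> /andP[_ UW1] /eqmx0P UW0 /eqmx0P UW0' UM WM.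
have M1 : proj_mx U W + proj_mx W U = 1%:M.
  by have := add_proj_mx UW0 UW1; rewrite !mul1mx.
have sub (U1 W1 : 'M[F]_p) (V1 : 'M[F]_q) : (U1 *m M <= V1)%MS -> (proj_mx U1 W1 *m M <= V1)%MS.
  by move=> h; apply: submx_trans h; rewrite submxMr // -[proj_mx _ _]mul1mx proj_mx_sub.
rewrite -[M in RHS]mul1mx -M1 !mulmxDl.
by rewrite (proj_mx_id UW0' (sub _ _ _ UM)) (proj_mx_0 UW0' (sub _ _ _ WM)) addr0.
Qed.

(** The projections along a decomposition assemble to a graded idempotent endomorphism of [X]; if it
    is 0 then [U] vanishes, if it is 1 then [W] does. *)
Lemma rep_of_indecomposable : supported fiber_of src tgt X -> (exists i, (0 < v i)%N) ->
  (forall e, graded fiber_of e -> e *m X = X *m e -> e *m e = e -> e = 0 \/ e = 1%:M) ->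
  indecomposable rep_of.
Proof.
move=> sX v0 ind; split=> // U W sU sW dec.
have dec1 i : (U i + W i == 1%:M)%MS by case/andP: (dec i).
have dec0 i : (U i :&: W i == (0 : 'M_(v i)))%MS by case/andP: (dec i).
pose pr i := proj_mx (U i) (W i).
have prr i : pr i *m pr i = pr i.
  by apply: proj_mx_id; [exact/eqmx0P | rewrite -[pr i]mul1mx proj_mx_sub].
pose e := \sum_i (S i)^T *m pr i *m S i.
have Pe i : P i *m e = (S i)^T *m pr i *m S i.
  rewrite mulmx_sumr (bigD1 i) //= big1 ?addr0 => [|j ji].
    by rewrite !mulmxA select_trP.
  by rewrite -(select_trP j) !mulmxA fiber_projM eq_sym (negPf ji) !mul0mx.
have eP i : e *m P i = (S i)^T *m pr i *m S i.
  rewrite mulmx_suml (bigD1 i) //= big1 ?addr0 => [|j ji].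
    by rewrite -mulmxA select_mxP eqxx.
  by rewrite -mulmxA select_mxP (negPf ji) mulmx0.
have ge : graded fiber_of e by move=> i; rewrite Pe eP.
have see i : S i *m e *m (S i)^T = pr i.
  have -> : S i *m e = S i *m (P i *m e) by rewrite mulmxA select_mxP eqxx.
  by rewrite Pe !mulmxA select_mxK mul1mx -mulmxA select_mxK mulmx1.
have Se i : S i *m e = pr i *m S i.
  have -> : S i *m e = S i *m (P i *m e) by rewrite mulmxA select_mxP eqxx.
  by rewrite Pe !mulmxA select_mxK mul1mx.
have ee : e *m e = e.
  rewrite {1}/e mulmx_suml; apply: eq_bigr => i _.
  by rewrite -(mulmxA _ (S i) e) Se mulmxA -(mulmxA _ (pr i) (pr i)) prr.
have eX : e *m X = X *m e.
  rewrite sX mulmx_sumr mulmx_suml; apply: eq_bigr => a _.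
  rewrite !mulmxA eP -(mulmxA _ (P _) e) Pe.
  rewrite -(select_mxTK (src a)) -(select_mxTK (tgt a)).
  have h : pr (src a) *m (S (src a) *m X *m (S (tgt a))^T) =
           S (src a) *m X *m (S (tgt a))^T *m pr (tgt a).
    by apply: proj_intertwines.
  have := congr1 (fun M => (S (src a))^T *m M *m S (tgt a)) h.
  by rewrite !mulmxA => ->.
have [e0|e1] := ind e ge eX ee; [left | right] => i.
  have pr0 : pr i = 0 by rewrite -see e0 mulmx0 mul0mx.
  have : U i *m pr i = U i by apply: proj_mx_id => //; exact/eqmx0P.
  by rewrite pr0 mulmx0 => <-; rewrite submx_refl.
have pr1 : pr i = 1%:M by rewrite -see e1 mulmx1 select_mxK.
have : W i *m pr i = 0 by apply: proj_mx_0 => //; exact/eqmx0P.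
by rewrite pr1 mulmx1 => ->; rewrite submx_refl.
Qed.
End Fibers.

Section Main.
Variables (F : closedFieldType) (n m R : nat) (src tgt : 'I_m -> 'I_n).
Variables (I : kQ F n m -> Prop) (rho : 'I_R -> kQ F n m) (v : 'I_n -> nat).
Hypotheses (adm : admissible src tgt I) (gens : minimal_generators src tgt I rho).

(** A zero generator could be dropped, against minimality. *)
Lemma generator_neq0 t : exists p, rho t p != 0.
Proof.
have [hin hgen hmin] := gens.
apply: NNPP => nex; have rho0 : rho t = @kQzero F n m.
  apply: functional_extensionality => p; apply/eqP; rewrite -[_ == _]negbK.
  by apply/negP => h; apply: nex; exists p.
apply: (hmin (setT :\ t)) => [|f].
  by apply/eqP => /setP/(_ t); rewrite !inE eqxx.
rewrite hgen; split=> h J idJ hJ; apply: h => // t' _; last exact: hJ.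
have [->|tt] := eqVneq t' t; first by rewrite rho0; case: idJ.
by apply: hJ; rewrite !inE tt.
Qed.

Lemma generator_endpoints : exists rs re : 'I_R -> 'I_n, forall t p, rho t p != 0 ->
  [/\ p.1 = rs t, walk_end tgt p.1 p.2 = re t, is_walk src tgt p.1 p.2 & (2 <= size p.2)%N].
Proof.
have [hin hgen hmin] := gens; have [idI sq _] := adm; have [Ielem _ _ _ _] := idI.
have [|f hf] := @fin_all_exists 'I_R (fun=> ('I_n * 'I_n)%type)
  (fun t p => in_Iij tgt I p.1 p.2 (rho t)).
  by move=> t; have [i [j h]] := hin t; exists (i, j).
exists (fun t => (f t).1), (fun t => (f t).2) => t p hp.
have [It hend] := hf t; have [h1 h2] := hend p hp; split=> //.
  by apply: contraNT hp => /(Ielem _ It) ->.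
by rewrite leqNgt; apply: contraNN hp => /(sq _ It) ->.
Qed.

Variables (rs re : 'I_R -> 'I_n).
Hypothesis ends : forall t p, rho t p != 0 ->
  [/\ p.1 = rs t, walk_end tgt p.1 p.2 = re t, is_walk src tgt p.1 p.2 & (2 <= size p.2)%N].

Lemma in_ideal_generator t : I (rho t).
Proof. by have [hin _ _] := gens; have [i [j []]] := hin t. Qed.

(** A generator is nonzero, so its endpoints are unique and it is counted for one pair only. *)
Lemma rcountE i j : (rcount tgt I rho i j)%:Z = rel_count rs re i j.
Proof.
have h t : pb (in_Iij tgt I i j (rho t)) = (rs t == i) && (re t == j).
  apply/pbP/andP => [[_ hend]|[/eqP<- /eqP<-]].
    have [p hp] := generator_neq0 t; have [h1 h2 _ _] := ends hp.
    by have [h3 h4] := hend p hp; split; apply/eqP; [rewrite -h3 h1 | rewrite -h4 h2].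
  by split; [exact: in_ideal_generator | move=> p /ends[h1 h2 _ _]].
rewrite /rcount cardsE -sum1_card big_mkcond (big_morph Posz PoszD (erefl _)).
by apply: eq_bigr => t _; rewrite unfold_in /= h; case: (_ && _).
Qed.

Lemma tits_formE x :
  tits_form src tgt I rho x = qform (euler_mx src tgt rs re) (\row_i x i).
Proof.
rewrite /qform euler_mxE; congr (_ - _ + _).
- by apply: eq_bigr => i _; rewrite mxE expr2.
- by apply: eq_bigr => a _; rewrite !mxE.
transitivity (\sum_t \sum_i \sum_j ((rs t == i) && (re t == j))%:R * (x i * x j)); last first.
  by apply: eq_bigr => t _; rewrite (sum_delta2 _ _ (fun i j => x i * x j)) !mxE.
rewrite [RHS]exchange_big; apply: eq_bigr => i _; rewrite [RHS]exchange_big; apply: eq_bigr => j _.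
by rewrite rcountE -mulrA mulr_suml.
Qed.

Lemma annihilator_generators N (g : 'I_N -> 'I_n) X :
  (forall t, rel_eval n src tgt g (fun t s => rho t (rs t, s)) rs X t = 0) ->
  forall t, annihilator src tgt g X (rho t).
Proof.
have [[Ielem _ _ _ _] _ _] := adm.
move=> hX t; split=> [|i]; first exact: Ielem (in_ideal_generator t).
have [->|it] := eqVneq i (rs t); first exact: hX.
rewrite /eval (@eq_word_sum _ _ n _ (fun=> 0)) ?word_sum0 // => s.
have [->|/ends[/= h _ _ _]] := eqVneq (rho t (i, s)) 0; first by rewrite scale0r.
by rewrite h eqxx in it.
Qed.
End Main.

Theorem theorem1 (F : closedFieldType) (n m : nat) (src tgt : 'I_m -> 'I_n)
    (I : kQ F n m -> Prop) (N : nat) (rho : 'I_N -> kQ F n m) (v : 'I_n -> nat) :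
  triangular src tgt ->
  no_double_arrows src tgt ->
  admissible src tgt I ->
  minimal_generators src tgt I rho ->
  maximal_omnipresent_root (tits_form src tgt I rho) v ->
  exists M : forall a : 'I_m, 'M[F]_(v (src a), v (tgt a)),
    satisfies M I /\ indecomposable M.
Proof.
move=> acyclic nodouble adm gens [vroot vpos vmax].
have [rs [re ends]] := generator_endpoints adm gens.
have tits := tits_formE gens ends.
have rho_walk t s : rho t (rs t, s) != 0 -> [/\ is_walk src tgt (rs t) s,
    walk_end tgt (rs t) s = re t & (0 < size s)%N].
  by move=> /ends[/= _ -> -> h]; split=> //; apply: ltnW.
have rel_walk t : exists s, [/\ is_walk src tgt (rs t) s, walk_end tgt (rs t) s = re t
    & (2 <= size s)%N].
  have [[i s] hp] := generator_neq0 gens t; have [/= h1 h2 h3 h4] := ends _ _ hp.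
  by exists s; rewrite -h1.
pose vr : 'rV[int]_n := \row_i (v i)%:Z.
have qv : qform (euler_mx src tgt rs re) vr = 1 by rewrite -tits.
(* Maximality is given among natural vectors; an integral [w] above [vr] is nonnegative, so its
   absolute values recover it. *)
have vmax' w : nonneg (w - vr) -> qform (euler_mx src tgt rs re) w = 1 -> w = vr.
  move=> hw qw; have w0 i : (v i)%:Z <= w 0 i by have := hw i; rewrite entryB [vr 0 i]mxE subr_ge0.
  have wE : w = \row_i (`|w 0%R i|%N)%:Z.
    by apply/rowP => i; rewrite mxE gez0_abs // (le_trans _ (w0 i)).
  apply/rowP => i; rewrite mxE {1}wE mxE; congr Posz.
  apply: (vmax (fun i => `|w 0%R i|%N)).
    by rewrite /is_root tits -wE.
  by move=> j; have := w0 j; lia.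
have v0 : exists i, (0 < v i)%N.
  have [|i] := exists_pos _ (q_eq0_null qv); first by move=> i; rewrite mxE.
  by rewrite mxE => h; exists i.
have dT : dim_of (@fiber_of n v) setT = vr.
  by apply/rowP => i; rewrite dim_of_fibers mxE.
have vpos' i : 0 < vr 0 i by rewrite mxE ltz_nat.
have Ediag i : euler_mx src tgt rs re i i = 1 by apply: euler_mx_diag.
have Eoff i j : i != j -> -1 <= euler_mx src tgt rs re i j + euler_mx src tgt rs re j i.
  by apply: euler_mx_off.
have Hconn (j i : 'I_n) (A : 'I_n -> Prop) : j != i -> A j -> ~ A i -> exists s t : 'I_n,
    [/\ A s, ~ A t & bform (euler_mx src tgt rs re) (evec s) (evec t)
                       != ((s == j) && (t == i))%:R].
  by apply: euler_mx_connected.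
have [X [sX _ _ hX] ind] := exists_brick n nodouble rho_walk dT Ediag Eoff vpos' qv vmax' Hconn.
exists (rep_of src tgt X); split; last exact: rep_of_indecomposable.
move=> f If i j; have [_ hgen _] := gens.
have [_ ev] : annihilator src tgt (@fiber_of n v) X f.
  move/hgen: If; apply; first exact: annihilator_ideal.
  by move=> t _; exact: (annihilator_generators adm gens ends).
by rewrite act_eval ev mulmx0 mul0mx.
Qed.
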